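(* Let $t:\mathcal{X}\to\mathbf{P}^1$ be the elliptic fibration over $\mathbf{Q}$ given by $y^2 = x^3 - 27 S(t)\, x + \frac{27}{4} T(t)$, with $S,T$ the explicit polynomials given in the context. (a) The fibration $t:\mathcal{X}\to\mathbf{P}^1$ has quadratic base changes, i.e. base changes by degree-$2$ morphisms $\mathbf{P}^1_{\mathbf{Q}}\to\mathbf{P}^1_{\mathbf{Q}}$, to elliptic surfaces of Mordell--Weil rank at least $18$ over $\mathbf{P}^1_{\mathbf{Q}}$. (b) There are pairs of quadratic base changes as in (a) whose compositum gives a biquadratic base change $E_0\to\mathbf{P}^1$ to an elliptic surface of Mordell--Weil rank at least $19$ over some elliptic curve $E_0/\mathbf{Q}$ with $E_0(\mathbf{Q})$ of positive rank. (c) There are infinitely many elliptic curves $E/\mathbf{Q}$ (up to isomorphism over $\mathbf{Q}$) of rank at least $19$.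
   Context: The polynomials $S,T\in\mathbf{Z}[t]$ are $$\begin{aligned} S(t) ={}& 307516108335972163537936\,t^8 + 10476571005172375234427296\,t^7\\ & + 234256046667228607566274912\,t^6 + 2020678721371875903158954848\,t^5\\ & + 8789387383568632081365832240\,t^4 + 21430123310022469548285709072\,t^3\\ & + 28607402618712438778345257832\,t^2 + 17860826619093915900857289304\,t\\ & + 4201305425690184127251888481, \end{aligned}$$ $$\begin{aligned} T(t) ={}& 1050290276365892761266194577222156800\,t^{12}\\ & + 67802587761728815952013525763236564480\,t^{11}\\ & + 2392486076703808362288120169049836903680\,t^{10}\\ & + 38126035250980128714796491999580538771200\,t^9\\ & + 372202978476351718721663756748866085220800\,t^8\\ & + 2373760737463050257069464720014664373086080\,t^7\\ & + 9904246958414858348647761354992989326760320\,t^6\\ & + 26905633537996991160744810870319331164617600\,t^5\\ & + 47243082583908684509409509915652973906060800\,t^4\\ & + 52862444598312784274784438443066814490530880\,t^3\\ & + 36435013603665838306995466090052055171475872\,t^2\\ & + 13865015501478235534002649882546248548532768\,t\\ & + 2193201312876924214657300134273061462776968. \end{aligned}$$ If $B/\mathbf{Q}$ is a smooth projective geometrically irreducible curve and $\varphi:B\to\mathbf{P}^1$ is a nonconstant morphism over $\mathbf{Q}$, the base change of the fibration by $\varphi$ is the elliptic surface over $B$ whose generic fiber is the elliptic curve $y^2 = x^3 - 27 S(t) x + \frac{27}{4}T(t)$ regarded over the function field $\mathbf{Q}(B)$ via $\varphi^*:\mathbf{Q}(t)\hookrightarrow\mathbf{Q}(B)$. Its Mordell--Weil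 rank over $B$ is the rank of the group of $\mathbf{Q}(B)$-points of this elliptic curve. The compositum of two quadratic covers $\varphi_1,\varphi_2:\mathbf{P}^1\to\mathbf{P}^1$ is the cover of the $t$-line (Galois with group $\{\pm1\}^2$ when biquadratic) whose function field is the compositum of the two quadratic extensions of $\mathbf{Q}(t)$. *)

(* Defs.v *)
From Stdlib Require Import BinNat.
From HB Require Import structures.
From mathcomp Require Import all_boot all_order all_algebra all_field.
From mathcomp Require Import ring.
Set Implicit Arguments. Unset Strict Implicit. Unset Printing Implicit Defensive.
Import GRing.Theory Num.Theory.
Local Open Scope ring_scope.

(* y^2 = x^3 + a x + b with discriminant - 16 (4 a^3 + 27 b^2) != 0; this     *)
(* forces the characteristic to differ from 2, and is the general elliptic    *)
(* curve when it also differs from 3.                                         *)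
Record ellcurve (K : fieldType) := EllCurve {
  ec_a : K;
  ec_b : K;
  _ : - 16 * (4 * ec_a ^+ 3 + 27 * ec_b ^+ 2) != 0 }.

Section GroupLaw.
Variables (K : fieldType) (E : ellcurve K).
Local Notation a := (ec_a E).
Local Notation b := (ec_b E).

(* None is the point at infinity (0 : 1 : 0). *)
Definition on_curve (p : option (K * K)) : bool :=
  if p is Some (x, y) then y ^+ 2 == x ^+ 3 + a * x + b else true.

Definition add_raw (p q : option (K * K)) : option (K * K) :=
  match p, q with
  | None, _ => q
  | _, None => p
  | Some (x1, y1), Some (x2, y2) =>
    if (x1 == x2) && (y1 == - y2) then None else
    let l := if x1 == x2 then (3 * x1 ^+ 2 + a) / (2 * y1)
             else (y1 - y2) / (x1 - x2) in
    let x3 := l ^+ 2 - x1 - x2 in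
    Some (x3, l * (x1 - x3) - y1)
  end.

Definition opp_raw (p : option (K * K)) : option (K * K) :=
  if p is Some (x, y) then Some (x, - y) else None.

Lemma two_neq0 : 2 != 0 :> K.
Proof.
case: E => a b /=; apply: contraNneq => h.
have -> : 16 = 2 * 8 :> K by rewrite -natrM.
by rewrite h mul0r oppr0 mul0r.
Qed.

Lemma divKid (x y z : K) : y != 0 -> x * y = z -> x = z / y.
Proof. by move=> h <-; rewrite mulfK. Qed.

(* The two relations determine the slope of the line through two points that  *)
(* are not opposite, whether it is a chord or a tangent.                      *)
Definition slope x1 y1 x2 y2 l :=
  l * (x1 - x2) = y1 - y2 /\
  l * (y1 + y2) = x1 ^+ 2 + x1 * x2 + x2 ^+ 2 + a.

Lemma sub_curve x1 y1 x2 y2 :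
  on_curve (Some (x1, y1)) -> on_curve (Some (x2, y2)) ->
  (y1 - y2) * (y1 + y2) = (x1 - x2) * (x1 ^+ 2 + x1 * x2 + x2 ^+ 2 + a).
Proof.
move=> /eqP h1 /eqP h2.
have -> : (y1 - y2) * (y1 + y2) = y1 ^+ 2 - y2 ^+ 2 by ring.
rewrite h1 h2; ring.
Qed.

Lemma slope_ex x1 y1 x2 y2 :
  on_curve (Some (x1, y1)) -> on_curve (Some (x2, y2)) ->
  ~~ ((x1 == x2) && (y1 == - y2)) -> exists l, slope x1 y1 x2 y2 l.
Proof.
move=> c1 c2; have := sub_curve c1 c2.
have [<-{x2 c2}|n12] := eqVneq x1 x2 => /= e ni.
  have s0 : y1 + y2 != 0 by rewrite addr_eq0.
  move/eqP: e; rewrite subrr mul0r mulf_eq0 (negPf s0) orbF subr_eq0 => /eqP e.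
  exists ((x1 ^+ 2 + x1 * x1 + x1 ^+ 2 + a) / (y1 + y2)); split; last by rewrite mulfVK.
  by rewrite e !subrr mulr0.
have d0 : x1 - x2 != 0 by rewrite subr_eq0.
exists ((y1 - y2) / (x1 - x2)); split; first by rewrite mulfVK.
apply: (mulfI d0); rewrite -e mulrA; congr (_ * _).
by rewrite mulrC mulfVK.
Qed.

Lemma addE x1 y1 x2 y2 l :
  on_curve (Some (x1, y1)) -> on_curve (Some (x2, y2)) ->
  ~~ ((x1 == x2) && (y1 == - y2)) -> slope x1 y1 x2 y2 l ->
  add_raw (Some (x1, y1)) (Some (x2, y2)) =
  Some (l ^+ 2 - x1 - x2, l * (x1 - (l ^+ 2 - x1 - x2)) - y1).
Proof.
move=> c1 c2 ni [s1 s2] /=; rewrite (negPf ni).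
suff -> : (if x1 == x2 then (3 * x1 ^+ 2 + a) / (2 * y1)
           else (y1 - y2) / (x1 - x2)) = l by [].
have := sub_curve c1 c2; move: ni s1 s2 c1 c2.
have [<-{x2}|n12] := eqVneq x1 x2 => /= ni s1 s2 c1 c2 e; last first.
  by rewrite -s1 mulfK // subr_eq0.
have s0 : y1 + y2 != 0 by rewrite addr_eq0.
move/eqP: e; rewrite subrr mul0r mulf_eq0 (negPf s0) orbF subr_eq0 => /eqP e.
rewrite -e in s0 s2.
rewrite (_ : 2 * y1 = y1 + y1); last by ring.
rewrite (_ : _ + a = x1 ^+ 2 + x1 * x1 + x1 ^+ 2 + a); last by ring.
by rewrite -s2 mulfK.
Qed.

Lemma slope_curve x1 y1 x2 y2 l :
  on_curve (Some (x1, y1)) -> slope x1 y1 x2 y2 l ->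
  on_curve (Some (l ^+ 2 - x1 - x2, l * (x1 - (l ^+ 2 - x1 - x2)) - y1)).
Proof.
move=> /eqP c1 [s1 s2]; apply/eqP.
have eb : b = y1 ^+ 2 - x1 ^+ 3 - a * x1 by rewrite c1; ring.
have ea : a = l * (y1 + y2) - x1 ^+ 2 - x1 * x2 - x2 ^+ 2 by rewrite s2; ring.
have ey : y2 = y1 - l * (x1 - x2) by rewrite s1; ring.
rewrite eb ea ey; ring.
Qed.

Lemma on_curve_add p q : on_curve p -> on_curve q -> on_curve (add_raw p q).
Proof.
case: p q => [[x1 y1]|] [[x2 y2]|] // c1 c2.
have [ni|ni] := boolP ((x1 == x2) && (y1 == - y2)); first by rewrite /= ni.
have [l sl] := slope_ex c1 c2 ni.
rewrite (addE c1 c2 ni sl); exact: slope_curve sl.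
Qed.

Lemma on_curve_opp p : on_curve p -> on_curve (opp_raw p).
Proof. by case: p => [[x y]|] //=; rewrite sqrrN. Qed.

Lemma slopeC x1 y1 x2 y2 l : slope x1 y1 x2 y2 l -> slope x2 y2 x1 y1 l.
Proof.
move=> [s1 s2]; split; last by rewrite addrC s2; ring.
by rewrite -opprB mulrN s1 opprB.
Qed.

Lemma inv_sym (x1 y1 x2 y2 : K) :
  ((x1 == x2) && (y1 == - y2)) = ((x2 == x1) && (y2 == - y1)).
Proof. by rewrite eq_sym -eqr_oppLR [_ == y2]eq_sym. Qed.

Lemma add_rawC p q : on_curve p -> on_curve q -> add_raw p q = add_raw q p.
Proof.
case: p q => [[x1 y1]|] [[x2 y2]|] // c1 c2.
have [ni|ni] := boolP ((x1 == x2) && (y1 == - y2)).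
  by rewrite /= ni; rewrite inv_sym in ni; rewrite ni.
have [l sl] := slope_ex c1 c2 ni.
rewrite (addE c1 c2 ni sl); rewrite inv_sym in ni.
rewrite (addE c2 c1 ni (slopeC sl)).
case: sl => s1 s2; have ey : y2 = y1 - l * (x1 - x2) by rewrite s1; ring.
by rewrite ey; congr Some; congr pair; ring.
Qed.

Lemma add_rawN p : add_raw p (opp_raw p) = None.
Proof. by case: p => [[x y]|] //=; rewrite opprK !eqxx. Qed.

Lemma add_raw0 p : add_raw p None = p.
Proof. by case: p => [[x y]|]. Qed.

Lemma opp_rawK p : opp_raw (opp_raw p) = p.
Proof. by case: p => [[x y]|] //=; rewrite opprK. Qed.

Lemma add_rawI p q : add_raw p q = None -> q = opp_raw p.
Proof.
case: p q => [[x1 y1]|] [[x2 y2]|] //=.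
by case: ifP => // /andP[/eqP-> /eqP->]; rewrite opprK.
Qed.

Lemma opp_rawD p q : on_curve p -> on_curve q ->
  opp_raw (add_raw p q) = add_raw (opp_raw p) (opp_raw q).
Proof.
case: p q => [[x1 y1]|] [[x2 y2]|] // c1 c2.
have [ni|ni] := boolP ((x1 == x2) && (y1 == - y2)).
  by case/andP: ni => /eqP-> /eqP->; rewrite /= !opprK !eqxx.
have [l sl] := slope_ex c1 c2 ni.
have ni' : ~~ ((x1 == x2) && (- y1 == - - y2)) by rewrite eqr_opp.
have sl' : slope x1 (- y1) x2 (- y2) (- l).
  by case: sl => s1 s2; split; rewrite ?mulNr ?s1 -?s2; ring.
rewrite (addE c1 c2 ni sl) (addE (on_curve_opp c1) (on_curve_opp c2) ni' sl') /=.
by congr Some; congr pair; ring.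
Qed.

Lemma add_rawK p q : on_curve p -> on_curve q ->
  add_raw (add_raw p q) (opp_raw q) = p.
Proof.
case: p q => [[x1 y1]|] [[x2 y2]|] // c1 c2; first last.
  exact: (add_rawN (Some (x2, y2))).
have [ni|ni] := boolP ((x1 == x2) && (y1 == - y2)).
  by rewrite [add_raw (Some _) (Some _)]/= ni; case/andP: ni => /eqP-> /eqP->.
have [l sl] := slope_ex c1 c2 ni.
have c3 := slope_curve c1 sl.
have c2' : on_curve (Some (x2, - y2)) by exact: (on_curve_opp c2).
rewrite (addE c1 c2 ni sl) [opp_raw _]/=.
case: (sl) => s1 s2.
have ey : y1 = y2 + l * (x1 - x2) by rewrite s1; ring.
have ea : a = l * (y1 + y2) - x1 ^+ 2 - x1 * x2 - x2 ^+ 2 by rewrite s2; ring.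
set x3 := _ - x1 - x2; set y3 := _ - y1.
have sl3 : slope x3 y3 x2 (- y2) (- l).
  by split; rewrite /y3 /x3 ?ea ?ey; ring.
have [/andP[/eqP e1 /eqP e2]|ni3] := boolP ((x3 == x2) && (y3 == - - y2)).
  have y20 : y2 = 0.
    have e3 : y2 = - y2 by rewrite -[LHS]opprK -e2 /y3 e1 ey; ring.
    have : 2 * y2 = 0 by rewrite [in LHS]mulr_natl mulr2n {1}e3 addNr.
    by move/eqP; rewrite mulf_eq0 (negPf two_neq0) => /eqP.
  have ex1 : x1 = l ^+ 2 - x2 *+ 2 by rewrite mulr2n -{1}e1 /x3; ring.
  have ea' : a = - 3 * x2 ^+ 2 by rewrite ea ey y20 ex1; ring.
  have eb : b = 2 * x2 ^+ 3.
    have -> : b = (x2 ^+ 3 + a * x2 + b) - x2 ^+ 3 - a * x2 by ring.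
    by rewrite -(eqP c2) y20 ea'; ring.
  have dE : - 16 * (4 * a ^+ 3 + 27 * b ^+ 2) != 0 by case: (E).
  by case/eqP: dE; rewrite eb ea'; ring.
rewrite (addE c3 c2' ni3 sl3).
by congr Some; congr pair; rewrite /y3 /x3 ?ey; ring.
Qed.

Lemma neq_scale (A B k : K) : A != 0 -> k != 0 -> B = A * k ^+ 2 -> B != 0.
Proof. by move=> hA hk ->; rewrite mulf_neq0 ?expf_neq0. Qed.

Lemma assoc_gen x1 y1 x2 y2 x3 y3 l m u v
    (x12 := l ^+ 2 - x1 - x2) (y12 := l * (x1 - x12) - y1)
    (x23 := m ^+ 2 - x2 - x3) (y23 := m * (x2 - x23) - y2) :
  slope x1 y1 x2 y2 l -> slope x2 y2 x3 y3 m ->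
  slope x12 y12 x3 y3 u -> slope x1 y1 x23 y23 v ->
  x12 != x3 -> x1 != x23 -> (x1 != x3) || (y1 != y3) ->
  u ^+ 2 - x12 - x3 = v ^+ 2 - x1 - x23 /\
  u * (x12 - (u ^+ 2 - x12 - x3)) - y12 = v * (x1 - (v ^+ 2 - x1 - x23)) - y1.
Proof.
move=> [l1 l2] [m1 m2] [u1 _] [v1 _] n12 n23 n13.
have ey1 : y1 = y2 + l * (x1 - x2) by rewrite l1; ring.
have ey3 : y3 = y2 + m * (x3 - x2) by rewrite -(opprB x2) mulrN m1; ring.
have d12 : x12 - x3 != 0 by rewrite subr_eq0.
have d23 : x1 - x23 != 0 by rewrite subr_eq0.
have R : 2 * y2 * (l - m) =
    (x1 - x3) * (x1 + x2 + x3) - l ^+ 2 * (x1 - x2) + m ^+ 2 * (x3 - x2).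
  have : l * (y1 + y2) - m * (y2 + y3) = (x1 - x3) * (x1 + x2 + x3).
    by rewrite l2 m2; ring.
  by rewrite ey1 ey3 => <-; ring.
have lm : l - m != 0.
  apply/eqP => lm0; have elm : m = l by apply/esym/eqP; rewrite -subr_eq0 lm0.
  have : (x1 - x3) * (x12 - x3) = 0.
    move: R; rewrite lm0 mulr0 elm /x12 => R0.
    by rewrite -[RHS]oppr0 [in RHS]R0; ring.
  move/eqP; rewrite mulf_eq0 (negPf d12) orbF subr_eq0 => /eqP e13.
  by move: n13; rewrite ey1 ey3 elm e13 !eqxx.
have ey2 : y2 = ((x1 - x3) * (x1 + x2 + x3) - l ^+ 2 * (x1 - x2) + m ^+ 2 * (x3 - x2))
   / (2 * (l - m)).
  by apply: divKid; rewrite -?R ?mulf_neq0 ?two_neq0 //; ring.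
have eu : u = (y12 - y3) / (x12 - x3) by rewrite -u1 mulfK.
have ev : v = (y1 - y23) / (x1 - x23) by rewrite -v1 mulfK.
have t0 := two_neq0.
rewrite /x12 in d12; rewrite /x23 in d23.
rewrite eu ev /y12 /y23 ey3 ey1 ey2 /x12 /x23.
split; field; rewrite ?lm ?d12 ?d23 ?t0 //.
Qed.

Lemma slope_dbl x y l : slope x y x y l -> l * (2 * y) = 3 * x ^+ 2 + a.
Proof.
move=> [_ h]; rewrite (_ : 2 * y = y + y); last by ring.
by rewrite h; ring.
Qed.

Lemma assoc_tan x1 y1 x2 y2 x12 y12 x23 y23 l m u v :
  x12 = l ^+ 2 - x1 - x2 -> y12 = l * (x1 - x12) - y1 ->
  x23 = m ^+ 2 - x2 - x12 -> y23 = m * (x2 - x23) - y2 ->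
  slope x1 y1 x2 y2 l -> slope x2 y2 x12 y12 m ->
  slope x12 y12 x12 y12 u -> slope x1 y1 x23 y23 v ->
  y12 != 0 -> x2 != x12 -> x1 != x23 ->
  u ^+ 2 - x12 - x12 = v ^+ 2 - x1 - x23 /\
  u * (x12 - (u ^+ 2 - x12 - x12)) - y12 = v * (x1 - (v ^+ 2 - x1 - x23)) - y1.
Proof.
move=> ex12 ey12 ex23 ey23.
move=> [l1 l2] [m1 _] /slope_dbl u1 [v1 _] d12 d2 d23.
have ey1 : y1 = y2 + l * (x1 - x2) by rewrite l1; ring.
have ea : a = l * (y1 + y2) - x1 ^+ 2 - x1 * x2 - x2 ^+ 2 by rewrite l2; ring.
have t0 := two_neq0.
rewrite -subr_eq0 in d2; rewrite -subr_eq0 in d23.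
have em := divKid d2 m1; have ev := divKid d23 v1.
have eu := divKid (mulf_neq0 t0 d12) u1.
rewrite eu ev ey23 ea.
move: d12 d2 d23; rewrite ex23 em ey12 ex12 ey1 => d12 d2 d23.
by split; field; rewrite d12 d2 t0 /= ?andbT;
  (apply: (neq_scale d23 d2); field).
Qed.

Lemma assoc_tan2 x1 y1 x2 x12 y12 l u v :
  x12 = l ^+ 2 - x1 - x2 -> y12 = l * (x1 - x12) - y1 ->
  slope x1 y1 x2 0 l -> slope x12 y12 x12 y12 u -> slope x1 y1 x1 y1 v ->
  y12 != 0 -> y1 != 0 ->
  u ^+ 2 - x12 - x12 = v ^+ 2 - x1 - x1 /\
  u * (x12 - (u ^+ 2 - x12 - x12)) - y12 = v * (x1 - (v ^+ 2 - x1 - x1)) - y1.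
Proof.
move=> ex12 ey12.
move=> [l1 l2] /slope_dbl u1 /slope_dbl v1 d12 d1.
have ey1 : y1 = l * (x1 - x2) by rewrite l1; ring.
have ea : a = l * y1 - x1 ^+ 2 - x1 * x2 - x2 ^+ 2 by rewrite -[y1]addr0 l2; ring.
have t0 := two_neq0.
have ev := divKid (mulf_neq0 t0 d1) v1.
have eu := divKid (mulf_neq0 t0 d12) u1.
rewrite eu ev ea.
move: d12 d1; rewrite ey12 ex12 ey1 => d12 d1.
have [l0 x0] : l != 0 /\ x1 - x2 != 0 by move: d1; rewrite mulf_eq0 negb_or => /andP.
split; field; rewrite ?d12 ?d1 ?l0 ?x0 ?t0 //.
Qed.

Lemma add_rawKl p q : on_curve p -> on_curve q ->
  add_raw (opp_raw p) (add_raw p q) = q.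
Proof.
move=> cp cq; have co := on_curve_opp cp.
by rewrite add_rawC ?on_curve_add // (add_rawC cp cq) add_rawK.
Qed.

Lemma add_rawA_affine x1 y1 x2 y2 x3 y3
    (p := Some (x1, y1)) (q := Some (x2, y2)) (r := Some (x3, y3)) :
  on_curve p -> on_curve q -> on_curve r ->
  add_raw p (add_raw q r) = add_raw (add_raw p q) r.
Proof.
move=> c1 c2 c3.
have [i12|n12] := boolP ((x1 == x2) && (y1 == - y2)).
  have -> : q = opp_raw p by rewrite /q /p; case/andP: i12 => /eqP-> /eqP->; rewrite /= opprK.
  by have := add_rawKl (on_curve_opp c1) c3; rewrite opp_rawK add_rawN.
have [i23|n23] := boolP ((x2 == x3) && (y2 == - y3)).
  have -> : q = opp_raw r by rewrite /q /r; case/andP: i23 => /eqP-> /eqP->.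
  have c3' := on_curve_opp c3.
  have := add_rawK c1 c3'; rewrite opp_rawK => ->.
  by rewrite (add_rawC c3' c3) add_rawN add_raw0.
have [l sl] := slope_ex c1 c2 n12; have [m sm] := slope_ex c2 c3 n23.
have := addE c1 c2 n12 sl; have := addE c2 c3 n23 sm.
set x12 := l ^+ 2 - _ - _; set y12 := l * _ - _.
set x23 := m ^+ 2 - _ - _; set y23 := m * _ - _.
rewrite -/p -/q -/r => e23 e12.
have c12 := slope_curve c1 sl; have c23 := slope_curve c2 sm.
rewrite -/x12 -/y12 in c12; rewrite -/x23 -/y23 in c23.
have [i12'|n12'] := boolP ((x12 == x3) && (y12 == - y3)).
  have er : r = opp_raw (add_raw p q).
    by rewrite e12 /r; case/andP: i12' => /eqP-> /eqP->; rewrite /= opprK.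
  rewrite {2}er add_rawN er (add_rawC c1 c2) opp_rawD //.
  have := add_rawKl (on_curve_opp c2) (on_curve_opp c1).
  by rewrite -/p -/q opp_rawK => ->; rewrite add_rawN.
have [i23'|n23'] := boolP ((x1 == x23) && (y1 == - y23)).
  have ep : p = opp_raw (add_raw q r).
    by rewrite e23 /p; case/andP: i23' => /eqP-> /eqP->.
  rewrite {1}ep (add_rawC (on_curve_opp (on_curve_add c2 c3)) (on_curve_add c2 c3)).
  rewrite add_rawN ep (add_rawC c2 c3) opp_rawD //.
  have := add_rawK (on_curve_opp c3) (on_curve_opp c2).
  by rewrite -/r -/q opp_rawK => ->; rewrite (add_rawC (on_curve_opp c3) c3) add_rawN.
have [/andP[/eqP e13x /eqP e13y]|n13] := boolP ((x1 == x3) && (y1 == y3)).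
  have -> : r = p by rewrite /p /r e13x e13y.
  by rewrite (add_rawC c2 c1) (add_rawC c1) ?on_curve_add.
have [u su] := slope_ex c12 c3 n12'; have [v sv] := slope_ex c1 c23 n23'.
rewrite e12 e23 (addE c12 c3 n12' su) (addE c1 c23 n23' sv).
rewrite negb_and in n13.
have same xa ya xb yb : on_curve (Some (xa, ya)) -> on_curve (Some (xb, yb)) ->
    ~~ ((xa == xb) && (ya == - yb)) -> xa = xb -> ya = yb.
  move=> ca cb ni ex; have := sub_curve ca cb; rewrite ex subrr mul0r.
  move: ni; rewrite ex eqxx /= -addr_eq0 => ni /eqP.
  by rewrite mulf_eq0 (negPf ni) orbF subr_eq0 => /eqP.
have [ex12|nx12] := eqVneq x12 x3; last first.
  have [ex23|nx23] := eqVneq x1 x23; last first.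
    by have [-> ->] := assoc_gen sl sm su sv nx12 nx23 n13.
  have ey23 := same _ _ _ _ c1 c23 n23' ex23.
  have eqrp : add_raw q r = p by rewrite e23 -ex23 -ey23.
  have y10 : y1 != 0.
    by apply: contraNneq n23' => y10; rewrite ex23 -ey23 y10 oppr0 !eqxx.
  have n21 : x2 != x1.
    apply/eqP => e21; have e21y := same _ _ _ _ c1 c2 n12 (esym e21).
    have := add_rawKl c2 c3; rewrite -/q -/r eqrp /p -e21 e21y.
    by rewrite (add_rawC (on_curve_opp c2) c2) add_rawN.
  rewrite -ex23 -ey23 in sv *.
  have sm' := slopeC sm; have sl' := slopeC sl; have su' := slopeC su.
  have h1 : x1 = m ^+ 2 - x3 - x2 by rewrite ex23 /x23; ring.
  have h2 : y1 = m * (x3 - x1) - y3.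
    by case: sm => m1 _; rewrite -[y3](subKr y2) -m1 ey23 ex23 /y23; ring.
  have h3 : x12 = l ^+ 2 - x2 - x1 by rewrite /x12; ring.
  have h4 : y12 = l * (x2 - x12) - y2.
    by case: sl => l1 _; rewrite -[y2](subKr y1) -l1 /y12; ring.
  have n31 : x3 != x12 by rewrite eq_sym.
  have [-> hy] := assoc_tan h1 h2 h3 h4 sm' sl' sv su' y10 n21 n31.
  rewrite hy; case: su' => u1 _; congr Some; congr pair; first by ring.
  by rewrite -[y12](subKr y3) -u1; ring.
have ey12 := same _ _ _ _ c12 c3 n12' ex12.
have epqr : add_raw p q = r by rewrite e12 ex12 ey12.
have y30 : y3 != 0.
  by apply: contraNneq n12' => y30; rewrite ex12 ey12 y30 oppr0 !eqxx.
rewrite ex12 ey12 in su *.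
have g2 : y3 = l * (x1 - x3) - y1 by rewrite -ex12 -ey12.
have [ex23|nx23] := eqVneq x1 x23; last first.
  have n23x : x2 != x3.
    apply/eqP => e23x; have e23y := same _ _ _ _ c2 c3 n23 e23x.
    have := add_rawK c1 c2; rewrite -/p -/q epqr /q e23x e23y.
    by rewrite -/r add_rawN.
  by have [-> ->] := assoc_tan (esym ex12) g2 erefl erefl sl sm su sv y30 n23x nx23.
have ey23 := same _ _ _ _ c1 c23 n23' ex23.
have eqrp : add_raw q r = p by rewrite e23 -ex23 -ey23.
have y10 : y1 != 0.
  by apply: contraNneq n23' => y10; rewrite ex23 -ey23 y10 oppr0 !eqxx.
have eqN : opp_raw q = q.
  rewrite -[RHS](add_rawKl c1 c2) -/p -/q epqr.
  have -> : r = add_raw p (opp_raw q).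
    by rewrite -eqrp (add_rawC c2 c3) -/q -/r add_rawK.
  by rewrite add_rawKl ?on_curve_opp.
have y20 : y2 = 0.
  case: eqN => /eqP; rewrite -subr_eq0 -opprD oppr_eq0 -mulr2n -mulr_natl.
  by rewrite mulf_eq0 (negPf two_neq0) => /eqP.
rewrite y20 in sl; rewrite -ex23 -ey23 in sv *.
by have [-> ->] := assoc_tan2 (esym ex12) g2 sl su sv y30 y10.
Qed.

Lemma add_rawA p q r : on_curve p -> on_curve q -> on_curve r ->
  add_raw p (add_raw q r) = add_raw (add_raw p q) r.
Proof.
case: p q r => [[x1 y1]|] [[x2 y2]|] [[x3 y3]|] // c1 c2 c3.
- exact: add_rawA_affine.
- by rewrite add_raw0 [RHS]add_raw0.
Qed.
End GroupLaw.

Section Points.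
Variables (K : fieldType) (E : ellcurve K).

Record ec_point := EcPoint { ec_coord : option (K * K); _ : on_curve E ec_coord }.

HB.instance Definition _ := [isSub for ec_coord].
HB.instance Definition _ := [Choice of ec_point by <:].

Definition ec_zero := @EcPoint None isT.
Definition ec_add (p q : ec_point) := EcPoint (on_curve_add (valP p) (valP q)).
Definition ec_opp (p : ec_point) := EcPoint (on_curve_opp (valP p)).

Fact ec_addA : associative ec_add.
Proof. by move=> p q r; apply: val_inj; apply: add_rawA; apply: valP. Qed.
Fact ec_addC : commutative ec_add.
Proof. by move=> p q; apply: val_inj; apply: (@add_rawC _ E); apply: valP. Qed.
Fact ec_add0 : left_id ec_zero ec_add.
Proof. by move=> p; apply: val_inj. Qed.
Fact ec_addN : left_inverse ec_zero ec_opp ec_add.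
Proof. by move=> p; rewrite ec_addC; apply: val_inj; apply: (add_rawN E). Qed.

HB.instance Definition _ :=
  GRing.isZmodule.Build ec_point ec_addA ec_addC ec_add0 ec_addN.
End Points.

(* The rank of A, the dimension of A tensored with the rationals, is at least *)
(* r: some r elements of A are linearly independent over the integers.        *)
Definition rank_ge (A : zmodType) (r : nat) : Prop :=
  exists P : 'I_r -> A, forall c : 'I_r -> int,
    \sum_(i < r) P i *~ c i = 0 -> forall i, c i = 0.

(* An isomorphism over Q between short Weierstrass models has the form        *)
(* (x, y) |-> (u^2 x, u^3 y) with u in Q^*.                                   *)
Definition ec_iso (E E' : ellcurve rat) : Prop :=
  exists2 u : rat, u != 0 & ec_a E' = u ^+ 4 * ec_a E /\ ec_b E' = u ^+ 6 * ec_b E.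

(* A nonconstant morphism B -> C of curves over Q is represented by its       *)
(* comorphism Q(C) -> Q(B), a ring morphism between function fields (Q is a   *)
(* prime field, so Q-linearity is automatic), and its degree is the degree of *)
(* the corresponding field extension.                                         *)
Section BaseChange.
Variables (K L : fieldType) (f : {rmorphism K -> L}) (E : ellcurve K).

Fact base_change_disc :
  - 16 * (4 * f (ec_a E) ^+ 3 + 27 * f (ec_b E) ^+ 2) != 0.
Proof.
have -> : - 16 * (4 * f (ec_a E) ^+ 3 + 27 * f (ec_b E) ^+ 2) =
    f (- 16 * (4 * ec_a E ^+ 3 + 27 * ec_b E ^+ 2)).
  rewrite (rmorphM f) (rmorphN f) (rmorph_nat f) (rmorphD f).
  rewrite [f (4 * _)](rmorphM f) [f (27 * _)](rmorphM f) !(rmorphXn f).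
  by rewrite !(rmorph_nat f).
by rewrite fmorph_eq0; case: E.
Qed.

Definition base_change : ellcurve L := EllCurve base_change_disc.
End BaseChange.

Definition ext_degree (K L : fieldType) (f : {rmorphism K -> L}) (d : nat) : Prop :=
  exists e : 'I_d -> L, forall z : L,
    exists! c : 'rV[K]_d, z = \sum_(i < d) f (c 0 i) * e i.

Definition subfield_pred (L : fieldType) (S : L -> Prop) : Prop :=
  [/\ S 1, forall x y, S x -> S y -> S (x - y)
    & forall x y, S x -> S y -> S (x / y)].

Notation ratfun K := {fraction {poly K}}.
Local Notation "p %:F" := (tofrac p).

(* L, as an extension of F, is the compositum of K1 and K2: the embeddings i1 *)
(* and i2 agree on F and their images generate L as a field.                  *)
Definition is_compositum (F K1 K2 L : fieldType)
    (f1 : {rmorphism F -> K1}) (f2 : {rmorphism F -> K2})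
    (i1 : {rmorphism K1 -> L}) (i2 : {rmorphism K2 -> L}) : Prop :=
  (forall x, i1 (f1 x) = i2 (f2 x)) /\
  (forall S : L -> Prop, subfield_pred S ->
    (forall x, S (i1 x)) -> (forall x, S (i2 x)) -> forall z, S z).

Section FunctionField.
Variables (K : fieldType) (E : ellcurve K).

Definition ec_cubic : {poly K} := 'X^3 + ec_a E *: 'X + (ec_b E)%:P.
Definition ec_poly : {poly ratfun K} := 'X^2 - ((ec_cubic)%:F)%:P.

Fact size_ec_cubic : size ec_cubic = 4.
Proof.
rewrite /ec_cubic -addrA size_polyDl size_polyXn //.
rewrite (leq_ltn_trans (size_polyD _ _)) // gtn_max.
rewrite (leq_ltn_trans (size_scale_leq _ _)) ?size_polyX //.
by rewrite (leq_ltn_trans (size_polyC_leq1 _)).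
Qed.

Fact ec_cubic_nonsquare (z : ratfun K) : z ^+ 2 != (ec_cubic)%:F.
Proof.
apply/eqP => zz.
have [p [q [q0 ez]]] : exists p q : {poly K}, q != 0 /\ z * q%:F = p%:F.
  elim/quotW: z {zz} => r; exists \n_r, \d_r; split; first exact: denom_ratioP.
  unlock tofrac; rewrite -[LHS]FracField.pi_mul; apply/eqmodP.
  have o : 1 != 0 :> {poly K} := oner_neq0 _.
  rewrite /= FracField.equivfE /FracField.mulf !numden_Ratio ?mulf_neq0 ?denom_ratioP //.
  by rewrite !mulr1 mulrC.
have : (p ^+ 2)%:F = (ec_cubic * q ^+ 2)%:F.
  by rewrite tofracXn -ez tofracM tofracXn exprMn zz.
move/eqP; rewrite tofrac_eq => /eqP h.
have c0 : ec_cubic != 0 by rewrite -size_poly_eq0 size_ec_cubic.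
have p0 : p != 0.
  by apply: contra_eq_neq h => ->; rewrite expr0n eq_sym mulf_neq0 ?expf_neq0.
have := congr1 (fun r : {poly K} => size r) h.
rewrite !expr2 !size_mul ?mulf_neq0 // size_ec_cubic.
have := size_poly_gt0 p; have := size_poly_gt0 q; rewrite p0 q0.
case: (size p) (size q) => [|m] [|n] // _ _.
rewrite !addnS !addSn /= => /(congr1 odd).
by rewrite /= !oddD !addbb.
Qed.

Fact ec_poly_irr : monic_irreducible_poly ec_poly.
Proof.
have s3 : size ec_poly = 3.
  rewrite /ec_poly size_polyDl size_polyXn // size_polyN.
  by rewrite (leq_ltn_trans (size_polyC_leq1 _)).
split; last first.
  rewrite monicE lead_coefDl ?lead_coefXn // size_polyN size_polyXn.
  by rewrite (leq_ltn_trans (size_polyC_leq1 _)).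
apply: cubic_irreducible; rewrite ?s3 // => z.
by rewrite /root !hornerE subr_eq0 ec_cubic_nonsquare.
Qed.

(* K(E) = K(x)[y] / (y^2 - (x^3 + a x + b)) *)
Definition ec_funfield : fieldType := {poly %/ ec_poly with ec_poly_irr}.
End FunctionField.

(* Coefficients in decreasing degree, in binary to keep the literals small.   *)
Definition poly_of_coefs (cs : seq N) : {poly rat} :=
  Poly [seq (nat_of_bin c)%:R | c <- rev cs].

Definition S_poly : {poly rat} := poly_of_coefs [::
  307516108335972163537936;
  10476571005172375234427296;
  234256046667228607566274912;
  2020678721371875903158954848;
  8789387383568632081365832240;
  21430123310022469548285709072;
  28607402618712438778345257832;
  17860826619093915900857289304;
  4201305425690184127251888481]%num.

Definition T_poly : {poly rat} := poly_of_coefs [::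
  1050290276365892761266194577222156800;
  67802587761728815952013525763236564480;
  2392486076703808362288120169049836903680;
  38126035250980128714796491999580538771200;
  372202978476351718721663756748866085220800;
  2373760737463050257069464720014664373086080;
  9904246958414858348647761354992989326760320;
  26905633537996991160744810870319331164617600;
  47243082583908684509409509915652973906060800;
  52862444598312784274784438443066814490530880;
  36435013603665838306995466090052055171475872;
  13865015501478235534002649882546248548532768;
  2193201312876924214657300134273061462776968]%num.

Fact disc_num_neq0 (s t : N) : N.eqb (t * t) (64 * (s * (s * s)))%num = false ->
  64 * (nat_of_bin s)%:R ^+ 3 - (nat_of_bin t)%:R ^+ 2 != 0 :> rat.
Proof.
move=> h; rewrite subr_eq0 -!natrX -natrM eqr_nat.
apply: contraFN h => /eqP e; apply/N.eqb_eq/(can_inj nat_of_binK).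
have M (m n : N) : nat_of_bin (m * n)%num = (m * n)%N.
  by case: m n => [|m] [|n] /=; rewrite ?muln0 ?nat_of_mul_pos.
rewrite !M -mulnn in e *.
by rewrite -e !expnS expn0 muln1.
Qed.

Fact disc_fraction_neq0 (S T : {poly rat}) :
  64 * S`_0 ^+ 3 - T`_0 ^+ 2 != 0 ->
  - 16 * (4 * (- 27 * S%:F) ^+ 3 + 27 * (27 / 4 * T%:F) ^+ 2) != 0.
Proof.
move=> h.
have nat_ratfun (n : nat) : n%:R = (n%:R : {poly rat})%:F :> ratfun rat.
  by rewrite -(rmorph_nat (@tofrac _)).
have n0 (n : nat) : n.+1%:R != 0 :> ratfun rat.
  by rewrite nat_ratfun tofrac_eq0 -polyC_natr polyC_eq0 pnatr_eq0.
have -> : - 16 * (4 * (- 27 * S%:F) ^+ 3 + 27 * (27 / 4 * T%:F) ^+ 2)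
        = 27 ^+ 3 * (64 * S ^+ 3 - T ^+ 2)%:F.
  rewrite rmorphB rmorphM !rmorphXn rmorph_nat.
  by field; exact: n0.
apply: mulf_neq0; first exact: expf_neq0 (n0 26).
rewrite tofrac_eq0.
apply: contraNneq h => /(congr1 (fun p : {poly rat} => p`_0)).
rewrite -!horner_coef0 -(polyC_natr _ 64) hornerD hornerN hornerM !horner_exp.
by rewrite hornerC horner0 => ->.
Qed.

Fact surface_disc :
  - 16 * (4 * (- 27 * S_poly%:F) ^+ 3
          + 27 * (27 / 4 * T_poly%:F) ^+ 2) != 0 :> ratfun rat.
Proof.
apply: disc_fraction_neq0; rewrite !coef_Poly.
by apply: (@disc_num_neq0 4201305425690184127251888481
  2193201312876924214657300134273061462776968)%num; vm_compute.
Qed.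

(* The generic fiber of the fibration, an elliptic curve over Q(t). *)
Definition surface : ellcurve (ratfun rat) :=
  @EllCurve _ (- 27 * S_poly%:F) (27 / 4 * T_poly%:F) surface_disc.

(* Main.v *)
(* The surface has 17 independent sections over Q(t), and two bisections,     *)
(* defined over the conics v1^2 = d1(t) and v2^2 = d2(t). The fiber product   *)
(* of the two conics is a curve of genus one E0; it has a rational point O    *)
(* over t = 75/11, and a point A0 of infinite order, as the denominator of    *)
(* the abscissa of 2^n A0 gains a factor 4 at each step.                      *)
(*   The points of E0 that are close to O at finitely many given primes are   *)
(* infinite in number, being the multiples of A0 in the kernels of reduction. *)
(* At these points the 17 sections and the 2 bisections specialize to 19      *)
(* rational points of the fiber. These are separated modulo doubling by the   *)
(* quadratic characters of x - e mod p, for roots e of the cubic modulo       *)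
(* various primes p; since the fiber has no 2-torsion, they are independent.  *)
(* Hence so are the 19 points over Q(E0), and 18 of them are already defined  *)
(* over each of the conics. The j-invariant of the fibers is not constant,    *)
(* and this gives the infinite family of elliptic curves.                     *)
Require Import Defs.
From HB Require Import structures.
From Stdlib Require Import ZArith Lia ClassicalEpsilon.
From mathcomp Require Import all_boot all_order all_algebra all_field.
From mathcomp Require Import cyclic.
From mathcomp Require Import ring ssrZ zify.
Set Implicit Arguments. Unset Strict Implicit. Unset Printing Implicit Defensive.
Import Order.TTheory GRing.Theory Num.Theory.
Local Open Scope ring_scope.
Local Notation "p %:F" := (tofrac p).
Local Notation XF := ('X%:F : ratfun rat).
Delimit Scope Z_scope with ZZ.

(** * Places and reduction of elliptic curves *)

(** All three parts follow from one statement, [generic_independent]: the 17 sections and the 2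
    bisections give 19 independent points over the function field of [E0]. A linear relation between
    them specializes to the same relation at all but finitely many points of any injective sequence
    of rational points of [E0] ([specialize_rank]), so independence on the fibres over such a
    sequence suffices.

    These infinitely many fibres are settled by one finite computation. The sequence of
    [E0_sequence] lies in the kernel of reduction modulo sixteen primes; by [near_infinity], modulo
    each of these primes, t and the two square roots are congruent to their values at the base point
    over t = 75/11. Hence the quadratic characters of x - e modulo p, which are homomorphisms to Z/2
    ([quad_charD], transported along the reduction homomorphism [red_raw_add]), take the same values
    on every fibre. Suitable products of them are dual to the 19 points ([dual_chars_table]). Hence
    every relation has even coefficients, and it can be halved because the cubic has no root modulo
    47 and so the fibre has no 2-torsion ([no_2torsion_near], [independent_of_chars]).

    The sequence exists because [A0] has infinite order: its repeated doublings go to the origin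
    2-adically ([doubling2], [A0_non_torsion]), and some positive multiple of it reduces to the
    origin at all the primes.

    The function field of [E0] is the compositum, of degree 4 over Q(t), of the function fields of
    the two conics ([e_biquadratic]). Over each conic 18 of the points are already defined, and
    independence descends ([rank18_descend]). Finally the fibres of the sequence have rank at least
    19, and their j-invariant varies ([same_j_neq0]), so infinitely many are pairwise non-isomorphic
    ([infinite_family]). *)

Record place (K k : fieldType) := Place {
  residue :> K -> option k;
  residue1 : residue 1 = Some 1;
  residueB : forall x y c d,
    residue x = Some c -> residue y = Some d -> residue (x - y) = Some (c - d);
  residueM : forall x y c d,
    residue x = Some c -> residue y = Some d -> residue (x * y) = Some (c * d);
  residue_inf : forall x, residue x = None -> residue x^-1 = Some 0 }.

Section PlaceTheory.
Variables (K k : fieldType) (v : place K k).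
Implicit Types (x y : K) (c d : k).

Lemma residue0 : v 0 = Some 0.
Proof. by rewrite -(subrr 1) (residueB (residue1 v) (residue1 v)) subrr. Qed.

Lemma residueN x c : v x = Some c -> v (- x) = Some (- c).
Proof. by move=> h; rewrite -[- x]add0r (residueB residue0 h) sub0r. Qed.

Lemma residueD x y c d : v x = Some c -> v y = Some d -> v (x + y) = Some (c + d).
Proof. by move=> hx /residueN hy; rewrite -[y]opprK (residueB hx hy) opprK. Qed.

Lemma residueX x c n : v x = Some c -> v (x ^+ n) = Some (c ^+ n).
Proof.
move=> h; elim: n => [|n IH]; first by rewrite !expr0 residue1.
by rewrite !exprS (residueM h IH).
Qed.

Lemma residue_nat n : v n%:R = Some n%:R.
Proof.
elim: n => [|n IH]; first exact: residue0.
by rewrite -!natr1 (residueD IH (residue1 v)).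
Qed.

Lemma residue_int n : v n%:~R = Some n%:~R.
Proof.
by case: n => n; rewrite ?NegzE ?mulrNz -?pmulrn; [|apply: residueN]; apply: residue_nat.
Qed.

Lemma residue_neq0 x c : v x = Some c -> c != 0 -> x != 0.
Proof. by move=> h; apply: contraNneq => x0; move: h; rewrite x0 residue0 => -[->]. Qed.

Lemma residueV x c : v x = Some c -> c != 0 -> v x^-1 = Some c^-1.
Proof.
move=> h c0; have x0 := residue_neq0 h c0.
case e: (v x^-1) => [d|]; last first.
  by have := residue_inf e; rewrite invrK h => -[c1]; rewrite c1 eqxx in c0.
have := residueM h e; rewrite divff // residue1 => -[h1].
by congr Some; apply: (mulfI c0); rewrite -h1 divff.
Qed.

Lemma residue_div x y c d :
  v x = Some c -> v y = Some d -> d != 0 -> v (x / y) = Some (c / d).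
Proof. by move=> hx hy d0; rewrite (residueM hx (residueV hy d0)). Qed.

Lemma residue_infP x : v x = None <-> x != 0 /\ v x^-1 = Some 0.
Proof.
split=> [h|[x0 h]].
  by split; [apply/eqP => x0; rewrite x0 residue0 in h | apply: residue_inf].
case e: (v x) => [c|] //; have := residueM e h.
by rewrite divff // residue1 mulr0 => -[/eqP]; rewrite oner_eq0.
Qed.

Lemma residue_inf_neq0 x : v x = None -> x != 0.
Proof. by case/residue_infP. Qed.

Lemma residue_sqr0 x : v (x ^+ 2) = Some 0 -> v x = Some 0.
Proof.
move=> h; case e: (v x) => [c|]; last first.
  have := residueM (residueX 2 (residue_inf e)) h.
  by rewrite -exprMn mulVf ?residue_inf_neq0 // expr1n residue1 mulr0 => -[/eqP]; rewrite oner_eq0.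
have := residueX 2 e; rewrite h => -[/esym/eqP].
by rewrite sqrf_eq0 => /eqP->.
Qed.

Lemma residue_infD x y c : v x = None -> v y = Some c -> v (x + y) = None.
Proof.
move=> hx hy; case e: (v (x + y)) => [d|] //.
by have := residueB e hy; rewrite addrK hx.
Qed.

Lemma residue_inf_sqr x : v x = None -> v (x ^+ 2) = None.
Proof.
move/residue_infP => [x0 h]; apply/residue_infP; rewrite expf_neq0 //; split=> //.
by rewrite -exprVn (residueX 2 h) expr0n.
Qed.
End PlaceTheory.

Section Reduction.
Variables (K k : fieldType) (v : place K k) (E : ellcurve K) (E' : ellcurve k).
Hypotheses (ha : v (ec_a E) = Some (ec_a E')) (hb : v (ec_b E) = Some (ec_b E')).
Local Notation a := (ec_a E).
Local Notation b := (ec_b E).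
Local Notation a' := (ec_a E').
Local Notation b' := (ec_b E').

Definition red_raw (P : option (K * K)) : option (k * k) :=
  if P is Some (x, y) then
    if (v x, v y) is (Some c, Some d) then Some (c, d) else None
  else None.

(** Where x has a pole the leading terms of the equation dominate, the coefficients being finite at
    [v]. This replaces a comparison of pole orders, which a place does not record. *)
Lemma curve_inf_ratio x y : on_curve E (Some (x, y)) -> v x = None ->
  v (y ^+ 2 / x ^+ 3) = Some 1.
Proof.
move=> /eqP-> hx; have x0 := residue_inf_neq0 hx.
have -> : (x ^+ 3 + a * x + b) / x ^+ 3 = 1 + a * x^-1 ^+ 2 + b * x^-1 ^+ 3 by field.
have hi := residue_inf hx.
have := residueD (residueD (residue1 v) (residueM ha (residueX 2 hi)))
                 (residueM hb (residueX 3 hi)).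
by rewrite !expr0n /= !mulr0 !addr0.
Qed.

Lemma curve_inf_y x y : on_curve E (Some (x, y)) -> v x = None -> v y = None.
Proof.
move=> h hx; have h1 := curve_inf_ratio h hx.
case hy: (v y) => [d|] //; move: h1.
have := residueM (residueX 2 hy) (residueX 3 (residue_inf hx)).
by rewrite exprVn expr0n mulr0 => -> [/eqP]; rewrite eq_sym oner_eq0.
Qed.

Lemma curve_int_y x y c : on_curve E (Some (x, y)) -> v x = Some c ->
  exists2 d, v y = Some d & on_curve E' (Some (c, d)).
Proof.
move=> /eqP h hx.
have h2 : v (y ^+ 2) = Some (c ^+ 3 + a' * c + b').
  by rewrite h; apply: residueD hb; apply: residueD (residueX 3 hx) (residueM ha hx).
case hy: (v y) => [d|].
  exists d => //; apply/eqP; have := residueX 2 hy.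
  by rewrite h2 => -[].
by have := residue_inf_sqr hy; rewrite h2.
Qed.

Lemma curve_y_int x y d : on_curve E (Some (x, y)) -> v y = Some d ->
  exists c, v x = Some c.
Proof.
move=> h hy; case hx: (v x) => [c|]; first by exists c.
by have := curve_inf_y h hx; rewrite hy.
Qed.

Lemma on_curve_red P : on_curve E P -> on_curve E' (red_raw P).
Proof.
case: P => [[x y]|] // h; rewrite /red_raw.
case hx: (v x) => [c|] //.
by have [d -> hd] := curve_int_y h hx.
Qed.

Lemma red_raw_opp P : red_raw (opp_raw P) = opp_raw (red_raw P).
Proof.
case: P => [[x y]|] //=; case: (v x) => [c|] //.
case hy: (v y) => [d|]; first by rewrite (residueN hy).
case hN: (v (- y)) => [d|] //.
by have := residueN hN; rewrite opprK hy.
Qed.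

Lemma red_int x y c d : v x = Some c -> v y = Some d ->
  red_raw (Some (x, y)) = Some (c, d).
Proof. by rewrite /red_raw => -> ->. Qed.

Lemma red_inf x y : v x = None -> red_raw (Some (x, y)) = None.
Proof. by rewrite /red_raw => ->. Qed.

(** A zero of the derivative at a point with zero ordinate would be a double root of the cubic,
    against the discriminant. *)
Lemma curve_nonsing c d : on_curve E' (Some (c, d)) -> d + d = 0 ->
  3 * c ^+ 2 + a' != 0.
Proof.
move=> /eqP h d2; apply/eqP => h0.
have d0 : d = 0.
  have : 2 * d = 0 by rewrite mulr_natl mulr2n.
  by move/eqP; rewrite mulf_eq0 (negPf (two_neq0 E')) => /eqP.
have ea : a' = - 3 * c ^+ 2.
  by apply/eqP; rewrite -subr_eq0; apply/eqP; rewrite -[RHS]h0; ring.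
have eb : b' = 2 * c ^+ 3.
  have -> : b' = (c ^+ 3 + a' * c + b') - c ^+ 3 - a' * c by ring.
  by rewrite -h d0 ea; ring.
have : - 16 * (4 * a' ^+ 3 + 27 * b' ^+ 2) != 0 by case: (E').
by rewrite ea eb => /eqP; apply; ring.
Qed.

Lemma red_add_int x1 y1 x2 y2 c1 c2 :
  on_curve E (Some (x1, y1)) -> on_curve E (Some (x2, y2)) ->
  v x1 = Some c1 -> v x2 = Some c2 ->
  red_raw (add_raw E (Some (x1, y1)) (Some (x2, y2))) =
  add_raw E' (red_raw (Some (x1, y1))) (red_raw (Some (x2, y2))).
Proof.
move=> h1 h2 hx1 hx2.
have [d1 hy1 o1] := curve_int_y h1 hx1; have [d2 hy2 o2] := curve_int_y h2 hx2.
rewrite (red_int hx1 hy1) (red_int hx2 hy2).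
have [ni|ni] := boolP ((x1 == x2) && (y1 == - y2)).
  have [/eqP e1 /eqP e2] := andP ni.
  have -> : add_raw E (Some (x1, y1)) (Some (x2, y2)) = None by rewrite /= ni.
  have e3 : c1 = c2 by move: hx1; rewrite e1 hx2 => -[].
  have e4 : d1 = - d2 by move: hy1; rewrite e2 (residueN hy2) => -[].
  by rewrite /= e3 e4 !eqxx.
have [l sl] := slope_ex h1 h2 ni.
rewrite (addE h1 h2 ni sl); case: (sl) => s1 s2.
have rx := residueD (residueD (residueD (residueX 2 hx1) (residueM hx1 hx2)) (residueX 2 hx2)) ha.
have [/andP[/eqP e1 /eqP e2]|ni'] := boolP ((c1 == c2) && (d1 == - d2)).
  have -> : add_raw E' (Some (c1, d1)) (Some (c2, d2)) = None.
    by rewrite /= e1 e2 !eqxx.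
  (* The reduced points are opposite, so the sum must reduce to the origin, which holds if the slope
     has a pole. With a finite slope, the two relations of [slope] would reduce to d2 + d2 = 0 and
     to a vanishing derivative, that is to a singular point. *)
  suff hl : v l = None.
    apply: red_inf; rewrite -addrA -opprD.
    exact: residue_infD (residue_inf_sqr hl) (residueN (residueD hx1 hx2)).
  case hl: (v l) => [m|] //.
  have := residueM hl (residueB hx1 hx2); rewrite s1 (residueB hy1 hy2) => -[f1].
  have := residueM hl (residueD hy1 hy2); rewrite s2 rx => -[f2].
  have t : d2 + d2 = 0.
    by move: f1; rewrite e1 e2 subrr mulr0 -opprD => /eqP; rewrite oppr_eq0 => /eqP.
  have := curve_nonsing o2 t; rewrite e1 e2 addNr mulr0 in f2.
  by rewrite -f2 => /eqP; case; ring.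
have [m hl] : exists m, v l = Some m.
  have [e1|n1] := eqVneq c1 c2; last first.
    have n2 : c1 - c2 != 0 by rewrite subr_eq0.
    exists ((d1 - d2) / (c1 - c2)).
    have -> : l = (y1 - y2) / (x1 - x2).
      by rewrite -s1 mulfK // (residue_neq0 (residueB hx1 hx2) n2).
    exact: residue_div (residueB hy1 hy2) (residueB hx1 hx2) n2.
  have n2 : d1 + d2 != 0 by move: ni'; rewrite e1 eqxx /= -addr_eq0.
  exists ((c1 ^+ 2 + c1 * c2 + c2 ^+ 2 + a') / (d1 + d2)).
  have -> : l = (x1 ^+ 2 + x1 * x2 + x2 ^+ 2 + a) / (y1 + y2).
    by rewrite -s2 mulfK // (residue_neq0 (residueD hy1 hy2) n2).
  exact: residue_div rx (residueD hy1 hy2) n2.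
have sl' : slope E' c1 d1 c2 d2 m.
  split; first by have := residueM hl (residueB hx1 hx2); rewrite s1 (residueB hy1 hy2) => -[].
  by have := residueM hl (residueD hy1 hy2); rewrite s2 rx => -[].
rewrite (addE o1 o2 ni' sl').
have r3 := residueB (residueB (residueX 2 hl) hx1) hx2.
by rewrite (red_int r3 (residueB (residueM hl (residueB hx1 r3)) hy1)).
Qed.

(* If the third point of the line through two points at infinity were         *)
(* integral, the squared slope would be equivalent to both x1 and x2, while   *)
(* x3 = l^2 - x1 - x2 would be equivalent to - l^2.                           *)
Lemma red_add_inf x1 y1 x2 y2 :
  on_curve E (Some (x1, y1)) -> on_curve E (Some (x2, y2)) ->
  v x1 = None -> v x2 = None ->
  red_raw (add_raw E (Some (x1, y1)) (Some (x2, y2))) = None.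
Proof.
move=> h1 h2 hx1 hx2.
have [ni|ni] := boolP ((x1 == x2) && (y1 == - y2)); first by rewrite /= ni.
have [l sl] := slope_ex h1 h2 ni; rewrite (addE h1 h2 ni sl).
have h3 := slope_curve h1 sl; case: sl => s1 s2.
set x3 := l ^+ 2 - x1 - x2 in h3 *; set y3 := l * (x1 - x3) - y1 in h3 *.
case hx3: (v x3) => [c|]; last exact: red_inf.
have [d hy3 _] := curve_int_y h3 hx3.
have key x y : on_curve E (Some (x, y)) -> v x = None -> l * (x - x3) = y + y3 ->
    v (l ^+ 2 / x) = Some 1.
  move=> h hx e; have hy := curve_inf_y h hx.
  have [x0 y0] := (residue_inf_neq0 hx, residue_inf_neq0 hy).
  have xx3 : x - x3 != 0.
    by rewrite subr_eq0; apply: contraTneq isT => exx; rewrite exx hx3 in hx.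
  have -> : l = (y + y3) / (x - x3) by rewrite -e mulfK.
  have -> : ((y + y3) / (x - x3)) ^+ 2 / x =
     y ^+ 2 / x ^+ 3 * ((1 + y3 * y^-1) / (1 - x3 * x^-1)) ^+ 2.
    by field; rewrite x0 y0 xx3.
  have n1 := residueD (residue1 v) (residueM hy3 (residue_inf hy)).
  have n2 := residueB (residue1 v) (residueM hx3 (residue_inf hx)).
  rewrite mulr0 subr0 in n2; rewrite mulr0 addr0 in n1.
  have := residueM (curve_inf_ratio h hx) (residueX 2 (residue_div n1 n2 (oner_neq0 _))).
  by rewrite divr1 expr1n mulr1.
have k1 : v (l ^+ 2 / x1) = Some 1 by apply: (key x1 y1) => //; rewrite /y3; ring.
have k2 : v (l ^+ 2 / x2) = Some 1.
  apply: (key x2 y2) => //; rewrite /y3.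
  by apply/eqP; rewrite -subr_eq0 -[y2](subKr y1) -s1; apply/eqP; ring.
have l0 : l != 0.
  by have := residue_neq0 k1 (oner_neq0 _); apply: contraNneq => ->; rewrite expr0n mul0r.
have x10 := residue_inf_neq0 hx1; have x20 := residue_inf_neq0 hx2.
have hl : v (l ^+ 2)^-1 = Some 0.
  have -> : (l ^+ 2)^-1 = (l ^+ 2 / x1)^-1 * x1^-1 by field; rewrite x10 l0.
  by rewrite (residueM (residueV k1 (oner_neq0 _)) (residue_inf hx1)) mulr0.
have := residueM hx3 hl; rewrite mulr0.
have -> : x3 / l ^+ 2 = 1 - (l ^+ 2 / x1)^-1 - (l ^+ 2 / x2)^-1.
  by rewrite /x3; field; rewrite l0 x10 x20.
have e := oner_neq0 k.
rewrite (residueB (residueB (residue1 v) (residueV k1 e)) (residueV k2 e)).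
by rewrite invr1 subrr sub0r => -[/eqP]; rewrite oppr_eq0 oner_eq0.
Qed.

Lemma red_rawP P : on_curve E P ->
  (exists x y c, P = Some (x, y) /\ v x = Some c) \/ red_raw P = None.
Proof.
case: P => [[x y]|] h; last by right.
case hx: (v x) => [c|]; first by left; exists x, y, c.
by right; rewrite red_inf.
Qed.

Lemma red_raw_None P : on_curve E P -> red_raw P = None ->
  P = None \/ exists x y, P = Some (x, y) /\ v x = None.
Proof.
case: P => [[x y]|] h; last by left.
case hx: (v x) => [c|]; last by right; exists x, y.
by have [d hy _] := curve_int_y h hx; rewrite (red_int hx hy).
Qed.

Lemma red_raw_ker P Q : on_curve E P -> on_curve E Q ->
  red_raw P = None -> red_raw Q = None -> red_raw (add_raw E P Q) = None.
Proof.
move=> hP hQ /(red_raw_None hP)[->|[x1 [y1 [eP hx1]]]] // rQ.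
rewrite eP in hP *.
have [->|[x2 [y2 [eQ hx2]]]] := red_raw_None hQ rQ; first by rewrite add_raw0 red_inf.
by rewrite eQ in hQ *; apply: red_add_inf.
Qed.

(** If P + Q reduced to the origin, so would P = (P + Q) - Q. Hence - P and P + Q are both integral,
    and [red_add_int] applies to their sum Q, which reduces to the origin. *)
Lemma red_raw_mixed P Q : on_curve E P -> on_curve E Q ->
  red_raw P <> None -> red_raw Q = None -> red_raw (add_raw E P Q) = red_raw P.
Proof.
move=> hP hQ rP rQ; have hS := on_curve_add hP hQ.
have eP : add_raw E (add_raw E P Q) (opp_raw Q) = P by apply: add_rawK.
have eQ : add_raw E (opp_raw P) (add_raw E P Q) = Q by apply: add_rawKl.
case: (red_rawP hS) => [[xs [ys [cs [eS hxs]]]]|rS]; last first.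
  case: rP; rewrite -eP; apply: red_raw_ker => //; first exact: on_curve_opp.
  by rewrite red_raw_opp rQ.
case: (red_rawP hP) => [[x [y [c [eP' hx]]]]|//].
have hoP := on_curve_opp hP.
have e : red_raw (add_raw E (opp_raw P) (add_raw E P Q)) =
    add_raw E' (red_raw (opp_raw P)) (red_raw (add_raw E P Q)).
  rewrite eS; move: hoP; rewrite eP' => hoP.
  by apply: red_add_int hx hxs => //; rewrite -eS.
move: e; rewrite eQ rQ red_raw_opp => /esym/add_rawI ->.
by rewrite opp_rawK.
Qed.

Lemma red_raw_add P Q : on_curve E P -> on_curve E Q ->
  red_raw (add_raw E P Q) = add_raw E' (red_raw P) (red_raw Q).
Proof.
move=> hP hQ.
case: (red_rawP hP) => [[x1 [y1 [c1 [eP hx1]]]]|rP];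
  case: (red_rawP hQ) => [[x2 [y2 [c2 [eQ hx2]]]]|rQ].
- by rewrite eP eQ in hP hQ *; apply: red_add_int hx1 hx2.
- rewrite rQ add_raw0; apply: red_raw_mixed => //.
  have [d1 hy1 _] : exists2 d, v y1 = Some d & on_curve E' (Some (c1, d)).
    by apply: curve_int_y hx1; rewrite -eP.
  by rewrite eP (red_int hx1 hy1).
- rewrite rP add_rawC // red_raw_mixed //.
  have [d2 hy2 _] : exists2 d, v y2 = Some d & on_curve E' (Some (c2, d)).
    by apply: curve_int_y hx2; rewrite -eQ.
  by rewrite eQ (red_int hx2 hy2).
- by rewrite rP rQ; apply: red_raw_ker.
Qed.

Definition reduce (P : ec_point E) : ec_point E' := EcPoint (on_curve_red (valP P)).

Lemma reduceD : {morph reduce : P Q / P + Q}.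
Proof. by move=> P Q; apply: val_inj; apply: red_raw_add; apply: valP. Qed.
End Reduction.

(** * Descent characters at a prime *)

Section Padic.
Variables (p : nat) (p_pr : prime p).

Lemma Fp_int_eq0 (n : int) : (n%:~R == 0 :> 'F_p) = (p %| `|n|)%N.
Proof.
rewrite (dvdn_pcharf (pchar_Fp p_pr)).
by case: (intP n) => [|m|m]; rewrite ?abszN ?mulrNz ?oppr_eq0 -?pmulrn.
Qed.

Definition padic_residue (x : rat) : option 'F_p :=
  if (denq x)%:~R == 0 :> 'F_p then None
  else Some ((numq x)%:~R / (denq x)%:~R).

Lemma numq_denq_Fp (x : rat) : (denq x)%:~R = 0 :> 'F_p -> (numq x)%:~R != 0 :> 'F_p.
Proof.
move/eqP; rewrite !Fp_int_eq0 => h1; apply/negP => h2.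
have := coprime_num_den x; rewrite /coprime => /eqP e.
have : (p %| gcdn `|numq x| `|denq x|)%N by rewrite dvdn_gcd h1 h2.
by rewrite e dvdn1 => /eqP e1; have := p_pr; rewrite e1.
Qed.

(** Frees the residue from fractions in lowest terms: any denominator prime to p will do. *)
Lemma padic_residue_ratio (n d : int) : d%:~R != 0 :> 'F_p ->
  padic_residue (n%:~R / d%:~R) = Some (n%:~R / d%:~R).
Proof.
move=> d0; set x := (_ / _ : rat).
have d0' : d%:~R != 0 :> rat.
  by rewrite intr_eq0; apply: contraNneq d0 => ->.
have e : numq x * d = n * denq x.
  apply: (@intr_inj rat); rewrite !intrM -{1}[n%:~R](divfK d0') -/x mulrAC.
  by congr (_ * _); rewrite -{2}[x]divq_num_den mulfVK // intr_eq0 denq_neq0.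
have e' : (numq x)%:~R * d%:~R = n%:~R * (denq x)%:~R :> 'F_p by rewrite -!intrM e.
rewrite /padic_residue; case: ifPn => [/eqP h|h].
  have := numq_denq_Fp h; move/eqP: e'.
  by rewrite h mulr0 mulf_eq0 (negPf d0) orbF => ->.
by congr Some; apply/eqP; rewrite eqr_div // e'.
Qed.

Lemma padic_residueP (x : rat) c : padic_residue x = Some c ->
  exists n d : int, [/\ d%:~R != 0 :> 'F_p, d%:~R != 0 :> rat,
    x = n%:~R / d%:~R & c = n%:~R / d%:~R].
Proof.
rewrite /padic_residue; case: ifPn => // h -[<-].
by exists (numq x), (denq x); rewrite divq_num_den intr_eq0 denq_neq0.
Qed.

Fact padic_residue1 : padic_residue 1 = Some 1.
Proof.
have := @padic_residue_ratio 1 1; rewrite !mulr1z !divr1; apply; exact: oner_neq0.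
Qed.

Fact padic_residueB x y c d : padic_residue x = Some c -> padic_residue y = Some d ->
  padic_residue (x - y) = Some (c - d).
Proof.
move=> /padic_residueP[n1 [d1 [h1 r1 -> ->]]] /padic_residueP[n2 [d2 [h2 r2 -> ->]]].
have -> : n1%:~R / d1%:~R - n2%:~R / d2%:~R =
    (n1 * d2 - n2 * d1)%:~R / (d1 * d2)%:~R :> rat.
  by rewrite intrB !intrM -mulNr addf_div // mulNr.
rewrite padic_residue_ratio; last by rewrite intrM mulf_neq0.
by rewrite intrB !intrM -[in RHS]mulNr addf_div // mulNr.
Qed.

Fact padic_residueM x y c d : padic_residue x = Some c -> padic_residue y = Some d ->
  padic_residue (x * y) = Some (c * d).
Proof.
move=> /padic_residueP[n1 [d1 [h1 r1 -> ->]]] /padic_residueP[n2 [d2 [h2 r2 -> ->]]].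
have -> : n1%:~R / d1%:~R * (n2%:~R / d2%:~R) = (n1 * n2)%:~R / (d1 * d2)%:~R :> rat.
  by rewrite !intrM mulf_div.
rewrite padic_residue_ratio; last by rewrite intrM mulf_neq0.
by rewrite !intrM mulf_div.
Qed.

Fact padic_residue_inf x : padic_residue x = None -> padic_residue x^-1 = Some 0.
Proof.
rewrite {1}/padic_residue; case: ifPn => // /eqP h _.
rewrite -{1}[x]divq_num_den invf_div padic_residue_ratio ?numq_denq_Fp //.
by rewrite h mul0r.
Qed.

Definition padic : place rat 'F_p :=
  Place padic_residue1 padic_residueB padic_residueM padic_residue_inf.
End Padic.

Section DescentMap.
Variables (k : fieldType) (E : ellcurve k) (e : k).
Local Notation a := (ec_a E).
Local Notation b := (ec_b E).
Hypothesis root_e : e ^+ 3 + a * e + b = 0.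

(* The map x - e of 2-descent; at (e, 0) it is replaced by the product of the *)
(* values at the other two 2-torsion points.                                  *)
Definition descent_raw (P : option (k * k)) : k :=
  if P is Some (x, _) then if x == e then 3 * e ^+ 2 + a else x - e else 1.

Lemma deriv_root_neq0 : 3 * e ^+ 2 + a != 0.
Proof.
have h : on_curve E (Some (e, 0)) by apply/eqP; rewrite root_e expr0n.
by apply: (curve_nonsing h); rewrite addr0.
Qed.

Lemma descent_raw_neq0 P : descent_raw P != 0.
Proof.
case: P => [[x y]|] /=; last exact: oner_neq0.
by case: (eqVneq x e) => [_|h]; [exact: deriv_root_neq0 | rewrite subr_eq0].
Qed.

(* On the line y = l (X - x1) + y1 through the three points,                  *)
(* X^3 + a X + b - (l (X - x1) + y1)^2 = (X - x1) (X - x2) (X - x3); the      *)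
(* value at e settles the generic case and the derivative at e the others.    *)
Lemma descent_raw_add P Q : on_curve E P -> on_curve E Q ->
  exists2 s, s != 0 &
    descent_raw (add_raw E P Q) * (descent_raw P * descent_raw Q) = s ^+ 2.
Proof.
case: P Q => [[x1 y1]|] [[x2 y2]|] h1 h2; last first.
- by exists 1; rewrite ?oner_neq0 //= !mulr1 expr1n.
- by exists (descent_raw (Some (x2, y2))); rewrite ?descent_raw_neq0 // [add_raw _ _ _]/= [descent_raw None]/= mul1r.
- by exists (descent_raw (Some (x1, y1))); rewrite ?descent_raw_neq0 // [add_raw _ _ _]/= [descent_raw None]/= mulr1.
have [/andP[/eqP e1 /eqP e2]|ni] := boolP ((x1 == x2) && (y1 == - y2)).
  exists (descent_raw (Some (x1, y1))); first exact: descent_raw_neq0.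
  by rewrite /= e1 e2 !eqxx mul1r.
have [l sl] := slope_ex h1 h2 ni.
rewrite (addE h1 h2 ni sl); have h3 := slope_curve h1 sl; case: sl => s1 s2.
set x3 := l ^+ 2 - x1 - x2 in h3 *; set y3 := l * (x1 - x3) - y1 in h3 *.
have ey : y2 = y1 - l * (x1 - x2) by rewrite s1; ring.
have ea : a = l * (y1 + y2) - x1 ^+ 2 - x1 * x2 - x2 ^+ 2 by rewrite s2; ring.
have eb : b = - e ^+ 3 - a * e by rewrite -[b]subr0 -root_e; ring.
have eb1 : b = y1 ^+ 2 - x1 ^+ 3 - a * x1 by rewrite (eqP h1); ring.
set m := l * (e - x1) + y1.
have m2 : (x3 - e) * ((x1 - e) * (x2 - e)) = m ^+ 2.
  have -> : m ^+ 2 = m ^+ 2 - (e ^+ 3 + a * e + b) by rewrite root_e subr0.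
  by rewrite eb1 /m ea ey /x3; ring.
have dm : 3 * e ^+ 2 + a - 2 * l * m =
    (e - x1) * (e - x2) + (e - x1) * (e - x3) + (e - x2) * (e - x3).
  by rewrite /m ea ey /x3; ring.
have y0 y : on_curve E (Some (e, y)) -> y = 0.
  by rewrite /= root_e sqrf_eq0 => /eqP.
have D := deriv_root_neq0.
rewrite /=.
have [e1|n1] := eqVneq x1 e.
  have m0 : m = 0 by rewrite /m e1 subrr mulr0 add0r; apply: y0; rewrite -e1.
  move: dm; rewrite m0 mulr0 subr0 e1 subrr !mul0r !add0r => dm.
  have n2 : x2 != e by apply: contraNneq D => e2; rewrite dm e2 subrr mul0r.
  have n3 : x3 != e by apply: contraNneq D => e2; rewrite dm e2 subrr mulr0.
  exists (3 * e ^+ 2 + a) => //.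
  by rewrite (negPf n2) (negPf n3) [in RHS]expr2 {2}dm; ring.
have [e2|n2] := eqVneq x2 e.
  have m0 : m = 0.
    have y20 : y2 = 0 by apply: y0; rewrite -e2.
    by rewrite -[RHS]y20 ey /m -e2; ring.
  move: dm; rewrite m0 mulr0 subr0 e2 subrr !(mulr0, mul0r) addr0 add0r => dm.
  have n3 : x3 != e by apply: contraNneq D => e3; rewrite dm e3 subrr mulr0.
  exists (3 * e ^+ 2 + a) => //.
  by rewrite (negPf n3) [in RHS]expr2 {2}dm; ring.
have [e3|n3] := eqVneq x3 e.
  have m0 : m = 0.
    have : y3 = 0 by apply: y0; rewrite -e3.
    rewrite /y3 e3 => y30; apply/eqP; rewrite -oppr_eq0; apply/eqP.
    by rewrite -[RHS]y30 /m; ring.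
  move: dm; rewrite m0 mulr0 subr0 e3 subrr !(mulr0, mul0r) !addr0 => dm.
  exists (3 * e ^+ 2 + a) => //.
  by rewrite [in RHS]expr2 {2}dm; ring.
exists m => //.
have : m ^+ 2 != 0 by rewrite -m2 !mulf_neq0 // subr_eq0.
by rewrite expf_eq0.
Qed.
End DescentMap.

Section QuadraticCharacter.
Variables (k : finFieldType) (h : nat) (E : ellcurve k) (e : k).
Hypothesis card_k : #|k| = h.*2.+1.
Hypothesis root_e : e ^+ 3 + ec_a E * e + ec_b E = 0.

Lemma sqr_expf_half (s : k) : s != 0 -> (s ^+ 2) ^+ h = 1.
Proof.
move=> s0; apply: (mulfI s0); rewrite -exprM mul2n -exprS -card_k expf_card.
by rewrite mulr1.
Qed.

Lemma expf_half_sqr (s : k) : s != 0 -> (s ^+ h) ^+ 2 = 1.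
Proof. by move=> s0; rewrite exprAC sqr_expf_half. Qed.

(** By Euler's criterion this is true exactly when the value of the descent map is not a square. *)
Definition quad_char (P : ec_point E) : bool := descent_raw E e (val P) ^+ h != 1.

Lemma quad_charD P Q : quad_char (P + Q) = quad_char P (+) quad_char Q.
Proof.
have [s s0] := descent_raw_add root_e (valP P) (valP Q).
rewrite -[add_raw _ _ _]/(val (P + Q)) /quad_char => /(congr1 (fun x => x ^+ h)).
rewrite /= sqr_expf_half // !exprMn.
have H (R : ec_point E) : descent_raw E e (val R) ^+ h = 1 \/ descent_raw E e (val R) ^+ h = -1.
  have := expf_half_sqr (descent_raw_neq0 root_e (val R)).
  by move/eqP; rewrite sqrf_eq1 => /orP[]/eqP->; [left|right].
case: (H P) => ->; case: (H Q) => ->; rewrite ?mulrNN ?mulr1 ?mulrN1 ?mul1r.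
- by move->; rewrite eqxx.
- by move/eqP; rewrite eqr_oppLR => /eqP->; rewrite eqxx; case: eqP.
- by move/eqP; rewrite eqr_oppLR => /eqP->; rewrite eqxx; case: eqP.
- by move->; rewrite eqxx addbb.
Qed.
End QuadraticCharacter.

(** * Independence from characters of order two *)

Section Independence.
Variables (A : zmodType) (n : nat) (P : 'I_n -> A) (chi : 'I_n -> A -> bool).
Hypothesis chiD : forall i x y, chi i (x + y) = chi i x (+) chi i y.
Hypothesis chiP : forall i j, chi i (P j) = (i == j).
Hypothesis no_2torsion : forall x : A, x + x = 0 -> x = 0.

Lemma chi0 i : chi i 0 = false.
Proof. by have := chiD i 0 0; rewrite addr0; case: (chi i 0). Qed.

Lemma chiMz i x (c : int) : chi i (x *~ c) = odd `|c|%N && chi i x.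
Proof.
have chiMn m : chi i (x *+ m) = odd m && chi i x.
  elim: m => [|m IH]; first by rewrite mulr0n chi0.
  by rewrite mulrS chiD IH /=; case: (odd m); case: (chi i x).
have chiN y : chi i (- y) = chi i y.
  by have := chiD i y (- y); rewrite subrr chi0; case: (chi i y); case: (chi i (- y)).
by case: c => m; rewrite ?NegzE ?mulrNz ?chiN -pmulrn chiMn ?abszN.
Qed.

Lemma chi_sum i (c : 'I_n -> int) : chi i (\sum_(j < n) P j *~ c j) = odd `|c i|%N.
Proof.
rewrite (bigD1 i) //= chiD chiMz chiP eqxx andbT.
elim/big_rec: _ => [|j x ji IH]; first by rewrite chi0 addbF.
by rewrite chiD chiMz chiP eq_sym (negPf ji) andbF.
Qed.

(** Infinite descent on the sum of the |c i|: evaluating [chi i] on the relation shows that c i is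
    even, and in the absence of 2-torsion half of the relation is again a relation. *)
Lemma independent_of_chars (c : 'I_n -> int) :
  \sum_(i < n) P i *~ c i = 0 -> forall i, c i = 0.
Proof.
have [m] := ubnP (\sum_(i < n) `|c i|)%N; elim: m c => // m IH c le_m h.
have even_c i : ~~ odd `|c i|%N by rewrite -chi_sum h chi0.
pose d i := Num.sg (c i) * `|c i|./2%:Z.
have cd i : c i = d i + d i.
  by rewrite /d -mulrDr -PoszD addnn even_halfK // -intEsg.
have ad i : (`|d i|.*2 = `|c i|)%N.
  rewrite /d abszM absz_sg absz_nat.
  by case: (eqVneq (c i) 0) => [->|_] //=; rewrite mul1n even_halfK.
have hd : \sum_(i < n) P i *~ d i = 0.
  apply: no_2torsion; rewrite -big_split /= -[RHS]h.
  by apply: eq_bigr => i _; rewrite -mulrzDr -cd.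
have [/eqP z|nz] := eqVneq (\sum_(i < n) `|c i|)%N 0%N.
  by move: z; rewrite sum_nat_eq0 => /forallP z i; have := z i; rewrite absz_eq0 => /eqP.
have eS : (\sum_(i < n) `|c i| = (\sum_(i < n) `|d i|).*2)%N.
  by rewrite -mul2n big_distrr /=; apply: eq_bigr => i _; rewrite mul2n ad.
have lt_d : (\sum_(i < n) `|d i| < m)%N.
  move: nz le_m; rewrite eS; case: (\sum_(i < n) _)%N => // q _.
  by rewrite doubleS ltnS; apply: leq_trans; rewrite !ltnS -addnn leq_addr.
by move=> i; rewrite cd (IH d lt_d hd).
Qed.
End Independence.

(** * Function fields and their extensions *)

Lemma rat_rmorph_unique (L : fieldType) (f g : {rmorphism rat -> L}) : f =1 g.
Proof. by move=> x; rewrite -[x]divq_num_den !fmorph_div !rmorph_int. Qed.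

Section Fractions.
Variable R : idomainType.
Implicit Types (z : {fraction R}) (p q : R).

Lemma fracP z : z = (\n_(repr z))%:F / (\d_(repr z))%:F.
Proof.
have d0 : (\d_(repr z))%:F != 0 by rewrite tofrac_eq0 denom_ratioP.
apply/(mulIf d0); rewrite mulfVK //.
rewrite -{1}[z]reprK; move: (repr z) d0 => r _.
unlock tofrac; rewrite -[LHS]FracField.pi_mul; apply/eqmodP.
have o : 1 != 0 :> R := oner_neq0 _.
rewrite /= FracField.equivfE /FracField.mulf !numden_Ratio ?mulf_neq0 ?denom_ratioP //.
by rewrite !mulr1 mulrC.
Qed.

Lemma frac_ratio_eq p q p' q' : q != 0 -> q' != 0 ->
  p%:F / q%:F = p'%:F / q'%:F -> p * q' = p' * q.
Proof.
move=> q0 q0' /eqP; rewrite eqr_div ?tofrac_eq0 // -!tofracM tofrac_eq => /eqP->.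
by rewrite mulrC.
Qed.

Lemma fraction_lift (L : fieldType) (g : {rmorphism R -> L}) :
  (forall p, p != 0 -> g p != 0) ->
  exists f : {rmorphism {fraction R} -> L}, forall p, f p%:F = g p.
Proof.
move=> g0.
pose h z := g \n_(repr z) / g \d_(repr z).
have hE p q : q != 0 -> h (p%:F / q%:F) = g p / g q.
  move=> q0; have d0 := denom_ratioP (repr (p%:F / q%:F)).
  have := frac_ratio_eq d0 q0 (esym (fracP (p%:F / q%:F))).
  rewrite /h => e; apply/eqP; rewrite eqr_div ?g0 // -!rmorphM e.
  by rewrite (mulrC p).
have hB : zmod_morphism h.
  move=> x y; rewrite (fracP x) (fracP y).
  set n := \n_(repr x); set d := \d_(repr x); set n' := \n_(repr y); set d' := \d_(repr y).
  have d0 : d != 0 by exact: denom_ratioP.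
  have d0' : d' != 0 by exact: denom_ratioP.
  have -> : n%:F / d%:F - n'%:F / d'%:F = (n * d' - n' * d)%:F / (d * d')%:F.
    by rewrite tofracB !tofracM -mulNr addf_div ?tofrac_eq0 // mulNr.
  rewrite !hE ?mulf_neq0 // rmorphB !rmorphM.
  by rewrite -[in RHS]mulNr addf_div ?g0 // mulNr.
have hM : monoid_morphism h.
  split=> [|x y].
    by have := hE 1 1 (oner_neq0 _); rewrite tofrac1 !rmorph1 !divr1.
  rewrite (fracP x) (fracP y).
  set n := \n_(repr x); set d := \d_(repr x); set n' := \n_(repr y); set d' := \d_(repr y).
  have d0 : d != 0 by exact: denom_ratioP.
  have d0' : d' != 0 by exact: denom_ratioP.
  by rewrite mulf_div -!tofracM !hE ?mulf_neq0 // !rmorphM mulf_div.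
pose F : {rmorphism {fraction R} -> L} :=
  HB.pack h (GRing.isZmodMorphism.Build _ _ h hB) (GRing.isMonoidMorphism.Build _ _ h hM).
exists F => p; rewrite -[F _]/(h _) -[p%:F]divr1 -tofrac1 hE ?oner_neq0 //.
by rewrite rmorph1 divr1.
Qed.
End Fractions.

Section RatfunMorphisms.
Variables (L : fieldType).
Implicit Types (f g : {rmorphism ratfun rat -> L}) (iota : {rmorphism rat -> L}).

Lemma ratfun_rmorph_horner f iota (p : {poly rat}) :
  f p%:F = (map_poly iota p).[f 'X%:F].
Proof.
elim/poly_ind: p => [|p c IH]; first by rewrite tofrac0 !rmorph0 horner0.
rewrite tofracD tofracM rmorphD rmorphM IH rmorphD rmorphM /= map_polyX map_polyC.
rewrite hornerD hornerM hornerX hornerC; congr (_ + _).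
exact: (rat_rmorph_unique (f \o (@tofrac _ \o polyC)) iota).
Qed.

Lemma ratfun_rmorph_ext f g : f 'X%:F = g 'X%:F -> f =1 g.
Proof.
pose iota : {rmorphism rat -> L} := f \o (@tofrac _ \o polyC).
move=> e; have h p : f p%:F = g p%:F.
  by rewrite (ratfun_rmorph_horner f iota) (ratfun_rmorph_horner g iota) e.
by move=> z; rewrite (fracP z) (fmorph_div f) (fmorph_div g) !h.
Qed.

Lemma ratfun_var_transcendental f iota : ~ algebraicOver iota (f 'X%:F).
Proof.
move=> [p p0 /rootP]; rewrite -ratfun_rmorph_horner => /eqP.
by rewrite fmorph_eq0 tofrac_eq0 (negPf p0).
Qed.

Lemma ratfun_lift iota (u : L) : ~ algebraicOver iota u ->
  exists f, f 'X%:F = u.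
Proof.
move=> tr_u.
have cu : commr_rmorph iota u by move=> c; apply: mulrC.
have g0 (p : {poly rat}) : p != 0 -> horner_morph cu p != 0.
  by move=> p0; apply/eqP => h; apply: tr_u; exists p => //; apply/rootP.
have [f hf] := fraction_lift g0.
by exists f; rewrite hf /= horner_morphX.
Qed.

(** If [w] were algebraic, [u] would be a root of a nonzero polynomial with algebraic coefficients.
    Transcendence is carried in this way from the abscissa on [E0] to the parameters of the two
    conics. *)
Lemma transcendental_of_quadratic iota (u w a b c : L) :
  ~ algebraicOver iota u -> a * u ^+ 2 + b * u + c = 0 ->
  [|| a != 0, b != 0 | c != 0] ->
  (algebraicOver iota w -> [/\ algebraicOver iota a, algebraicOver iota b
                             & algebraicOver iota c]) ->
  ~ algebraicOver iota w.
Proof.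
move=> tr_u e nz h /h[ha hb hc]; apply: tr_u.
apply/integral_algebraic; apply: (@integral_root _ _ _ (Poly [:: c; b; a])).
- apply: contraTneq nz => /polyP p0; have := (p0 0%N, p0 1%N, p0 2%N).
  by rewrite !coef_Poly !coef0 /= => -[[-> ->] ->]; rewrite eqxx.
- by apply/rootP; rewrite horner_Poly /= mul0r add0r -[RHS]e; ring.
- move=> x /(nthP 0)[i _ <-]; rewrite coef_Poly.
  by case: i => [|[|[|i]]]; rewrite /= ?nth_nil; apply/integral_algebraic => //; apply: algebraic0.
Qed.
End RatfunMorphisms.

(** If p / q squares to a polynomial, then q ^ 2 divides p ^ 2, so q divides p and the root is
    itself a polynomial. *)
Lemma poly_nonsquare_frac (F : fieldType) (d : {poly F}) :
  (forall s, s ^+ 2 != d) -> forall z : ratfun F, z ^+ 2 != d%:F.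
Proof.
move=> nsq z; rewrite (fracP z).
have := denom_ratioP (repr z); move: (\n_(repr z)) (\d_(repr z)) => p q q0.
apply/eqP => e.
have h : p ^+ 2 = d * q ^+ 2.
  apply/eqP; rewrite -tofrac_eq [X in _ == X]tofracM ![(_ ^+ 2)%:F]tofracXn.
  by rewrite -e -exprMn mulfVK // tofrac_eq0.
have : q %| p by rewrite -(@dvdp_pexp2r _ _ _ 2) // h dvdp_mull.
move/dvdpP => [s es]; move: (nsq s); rewrite es exprMn in h.
by rewrite (mulIf (expf_neq0 2 q0) h) eqxx.
Qed.

Section Degrees.

(** The basis is 1, w. The combinations of 1 and w form a subfield, inverses being obtained from the
    norm a' ^ 2 - d b' ^ 2; that the norm does not vanish and that coordinates are unique both come
    from d not being a square. *)
Lemma ext_degree2 (K L : fieldType) (f : {rmorphism K -> L}) (d : K) (w : L) :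
  w ^+ 2 = f d -> (forall z, z ^+ 2 != d) ->
  (forall S : L -> Prop, subfield_pred S -> (forall x, S (f x)) -> S w ->
     forall z, S z) ->
  ext_degree f 2.
Proof.
move=> w2 nsq gen.
have nz a b : f a + f b * w = 0 -> a = 0 /\ b = 0.
  have [->|b0] := eqVneq b 0.
    by rewrite rmorph0 mul0r addr0 => /eqP; rewrite fmorph_eq0 => /eqP.
  move=> h; have /eqP[] := nsq (a / b).
  apply: (fmorph_inj f); rewrite -w2 rmorphXn fmorph_div.
  have -> : f a = - (f b * w) by apply/eqP; rewrite -addr_eq0 h.
  by rewrite mulNr sqrrN mulrAC divff ?fmorph_eq0 // mul1r.
have ex z : exists a b, z = f a + f b * w.
  apply: (gen (fun z => exists a b, z = f a + f b * w)) => [|x|];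
    last by exists 0, 1; rewrite rmorph0 rmorph1 add0r mul1r.
    split; first by exists 1, 0; rewrite rmorph0 rmorph1 mul0r addr0.
      by move=> _ _ [a [b ->]] [a' [b' ->]]; exists (a - a'), (b - b'); rewrite !rmorphB; ring.
    move=> _ _ [a [b ->]] [a' [b' ->]].
    have [h|h] := eqVneq (f a' + f b' * w) 0.
      by exists 0, 0; rewrite h invr0 !rmorph0; ring.
    pose n := a' ^+ 2 - d * b' ^+ 2.
    have n0 : n != 0.
      have [b0|b0] := eqVneq b' 0.
        rewrite /n b0 expr0n mulr0 subr0 expf_neq0 //.
        by apply: contraNneq h => ->; rewrite b0 !rmorph0 mul0r addr0.
      rewrite subr_eq0; apply/eqP => e; have /eqP[] := nsq (a' / b').
      by rewrite exprMn e exprVn mulfK // expf_neq0.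
    have fn : f n = (f a' + f b' * w) * (f a' - f b' * w).
      by rewrite /n rmorphB [f (d * _)]rmorphM ![f (_ ^+ 2)]rmorphXn -w2; ring.
    have fn0 : f n != 0 by rewrite fmorph_eq0.
    exists ((a * a' - b * b' * d) / n), ((b * a' - a * b') / n).
    rewrite !fmorph_div !rmorphB !rmorphM -w2.
    move: fn0; rewrite fn mulf_eq0 negb_or h /= => h'.
    have h2 : f a' * f a' - w ^+ 2 * (f b' * f b') != 0.
      by rewrite (_ : _ - _ = (f a' + f b' * w) * (f a' - f b' * w)) ?mulf_neq0 //; ring.
    by field; rewrite h2 h.
  by exists x, 0; rewrite rmorph0 mul0r addr0.
exists (fun i : 'I_2 => if i == 0 then 1 else w) => z.
have [a [b ->]] := ex z.
exists (\row_(i < 2) if i == 0 then a else b); split.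
  by rewrite !big_ord_recl big_ord0 !mxE /= mulr1 addr0.
move=> c; rewrite !big_ord_recl big_ord0 /= mulr1 addr0 => e.
have [] := nz (a - c 0 0) (b - c 0 (lift ord0 ord0)).
  by rewrite !rmorphB mulrBl addrACA -opprD e subrr.
move=> /eqP; rewrite subr_eq0 => /eqP e1 /eqP; rewrite subr_eq0 => /eqP e2.
by apply/rowP => -[[|[|i]] hi]; rewrite !mxE //= ?e1 ?e2; congr (c 0 _); apply: val_inj.
Qed.

Lemma ext_degree_comp (F K L : fieldType) (f : {rmorphism F -> K})
    (g : {rmorphism K -> L}) m n :
  ext_degree f m -> ext_degree g n -> ext_degree (g \o f) (m * n).
Proof.
move=> [e he] [e' he'].
pose pr (k : 'I_(m * n)) : 'I_m * 'I_n :=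
  enum_val (cast_ord (esym (mxvec_cast m n)) k).
exists (fun k => g (e (pr k).1) * e' (pr k).2) => z.
have prK i j : pr (mxvec_index i j) = (i, j).
  by rewrite /pr /mxvec_index /= cast_ordK enum_rankK.
have sumE (c : 'rV[F]_(m * n)) :
    \sum_k (g \o f) (c 0 k) * (g (e (pr k).1) * e' (pr k).2) =
    \sum_j g (\sum_i f (vec_mx c i j) * e i) * e' j.
  rewrite (reindex _ (curry_mxvec_bij _ _)) /=.
  transitivity (\sum_i \sum_j g (f (c 0 (mxvec_index i j))) * (g (e i) * e' j)).
    by rewrite pair_bigA; apply: eq_bigr => -[i j] _ /=; rewrite prK.
  rewrite exchange_big; apply: eq_bigr => j _; rewrite rmorph_sum mulr_suml.
  by apply: eq_bigr => i _; rewrite mxE rmorphM mulrA.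
have [b [hb ub]] := he' z.
have [c hc] : exists c : 'M[F]_(m, n), forall j, b 0 j = \sum_i f (c i j) * e i.
  have h j : exists r : 'rV[F]_m, b 0 j == \sum_i f (r 0 i) * e i.
    by have [r [-> _]] := he (b 0 j); exists r.
  exists (\matrix_(i, j) (xchoose (h j)) 0 i) => j.
  by rewrite {1}(eqP (xchooseP (h j))); apply: eq_bigr => i _; rewrite mxE.
exists (mxvec c); split.
  by rewrite sumE hb; apply: eq_bigr => j _; rewrite mxvecK hc.
move=> c' hc'; rewrite sumE in hc'.
pose b' := \row_j (\sum_i f (vec_mx c' i j) * e i).
have eb : b = b' by apply: ub; rewrite hc'; apply: eq_bigr => j _; rewrite mxE.
apply: (can_inj vec_mxK); rewrite mxvecK; apply/matrixP => i j.
have [r [hr ur]] := he (b 0 j).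
have e1 : r = \row_i c i j by apply: ur; rewrite hc; apply: eq_bigr => i' _; rewrite mxE.
have e2 : r = \row_i vec_mx c' i j.
  by apply: ur; rewrite eb mxE; apply: eq_bigr => i' _; rewrite !mxE.
by have := congr1 (fun s : 'rV_m => s 0 i) e1; rewrite e2 !mxE.
Qed.
End Degrees.

(** * Function field of an elliptic curve, and specialization *)

Section FunctionFieldCoordinates.
Variables (K : fieldType) (E : ellcurve K).
Local Notation L := (ec_funfield E).

Definition ff_base : {rmorphism ratfun K -> L} := qpolyC (ec_poly E).
Definition ff_y : L := 'qX.

Lemma size_ec_poly : size (ec_poly E) = 3.
Proof.
rewrite /ec_poly size_polyDl size_polyXn // size_polyN.
by rewrite (leq_ltn_trans (size_polyC_leq1 _)).
Qed.

Lemma mk_monic_ec_poly : mk_monic (ec_poly E) = ec_poly E.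
Proof. by rewrite /mk_monic size_ec_poly; case: (ec_poly_irr E) => _ ->. Qed.

Definition ff_coord (i : nat) (z : L) : ratfun K := (val z)`_i.

Lemma in_qpoly_linear (A B : ratfun K) :
  in_qpoly (ec_poly E) (A%:P + B%:P * 'X) = ff_base A + ff_base B * ff_y :> L.
Proof.
have C c : in_qpoly (ec_poly E) c%:P = ff_base c.
  apply: val_inj; apply: (etrans (in_qpoly_small _)); rewrite ?qpolyCE //.
  by rewrite mk_monic_ec_poly size_ec_poly (leq_ltn_trans (size_polyC_leq1 _)).
by rewrite -(C A) -(C B); apply: (etrans (in_qpolyD _ _ _)); congr (_ + _); apply: in_qpolyM.
Qed.

Lemma val_ff_linear (A B : ratfun K) :
  val (ff_base A + ff_base B * ff_y : L) = A%:P + B%:P * 'X :> {poly ratfun K}.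
Proof.
rewrite -in_qpoly_linear; apply: (etrans (in_qpoly_small _)) => //.
rewrite mk_monic_ec_poly size_ec_poly addrC size_MXaddC; case: ifP => // _.
by rewrite !ltnS size_polyC_leq1.
Qed.

Lemma ff_coord0E (A B : ratfun K) : ff_coord 0 (ff_base A + ff_base B * ff_y) = A.
Proof. by rewrite /ff_coord val_ff_linear coefD coefC coefMX /= addr0. Qed.

Lemma ff_coord1E (A B : ratfun K) : ff_coord 1 (ff_base A + ff_base B * ff_y) = B.
Proof. by rewrite /ff_coord val_ff_linear coefD coefC coefMX /= coefC add0r. Qed.

Lemma ff_coordK (z : L) : z = ff_base (ff_coord 0 z) + ff_base (ff_coord 1 z) * ff_y.
Proof.
apply: val_inj; rewrite val_ff_linear; apply/polyP => i.
rewrite coefD coefC coefMX coefC; case: i => [|[|i]] /=; rewrite ?addr0 ?add0r //.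
rewrite nth_default // -ltnS (leq_trans (size_mk_monic z)) //.
by rewrite mk_monic_ec_poly size_ec_poly.
Qed.

Lemma ff_ySqr : ff_y ^+ 2 = ff_base (ec_cubic E)%:F.
Proof.
have h0 : in_qpoly (ec_poly E) (ec_poly E) = 0 :> L.
  apply: val_inj; rewrite /= /in_qpoly /= mk_monic_ec_poly.
  by rewrite Pdiv.RingMonic.rmodpp //; case: (ec_poly_irr E).
have C c : in_qpoly (ec_poly E) c%:P = ff_base c.
  by have := in_qpoly_linear c 0; rewrite polyC0 mul0r rmorph0 mul0r !addr0.
apply/eqP; rewrite -subr_eq0 -C -h0 /ec_poly; apply/eqP.
by rewrite rmorphB rmorphXn.
Qed.

Definition ff_x : L := ff_base 'X%:F.

Lemma ff_on_curve (iota : {rmorphism K -> L}) :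
  (forall c, iota c = ff_base c%:P%:F) ->
  ff_y ^+ 2 = ff_x ^+ 3 + iota (ec_a E) * ff_x + iota (ec_b E).
Proof.
move=> hi; rewrite ff_ySqr /ec_cubic !hi -mul_polyC.
rewrite -[ff_x ^+ 3](rmorphXn ff_base) -[_ * ff_x](rmorphM ff_base) -2!rmorphD.
by rewrite -tofracXn -tofracM -2!tofracD.
Qed.

Lemma subfield_sum (L' : fieldType) (S : L' -> Prop) x y :
  subfield_pred S -> S x -> S y -> S (x + y).
Proof.
move=> [s1 sB _] hx hy; have s0 : S 0 by rewrite -(subrr 1); apply: sB.
by rewrite -[y]opprK; apply: (sB) => //; rewrite -[- y]add0r; apply: sB.
Qed.

Lemma subfield_mul (L' : fieldType) (S : L' -> Prop) x y :
  subfield_pred S -> S x -> S y -> S (x * y).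
Proof.
move=> [s1 _ sV] hx hy; rewrite -[y]invrK; apply: (sV) => //.
by rewrite -div1r; apply: sV.
Qed.

Lemma ff_generated (S : L -> Prop) : subfield_pred S ->
  (forall x, S (ff_base x)) -> S ff_y -> forall z, S z.
Proof.
move=> hS hb hy z; rewrite (ff_coordK z).
by apply: subfield_sum => //; apply: subfield_mul.
Qed.
End FunctionFieldCoordinates.

Section Subfields.
Variables (L : fieldType) (S : L -> Prop).
Hypothesis hS : subfield_pred S.

Lemma subfield_opp x : S x -> S (- x).
Proof. by case: hS => s1 sB _ hx; rewrite -sub0r -(subrr 1); apply: (sB) => //; apply: sB. Qed.

Lemma subfield_rat (iota : {rmorphism rat -> L}) c : S (iota c).
Proof.
case: (hS) => s1 sB sV.
have s0 : S 0 by rewrite -(subrr 1); apply: sB.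
have sn (n : nat) : S n%:R.
  by elim: n => [|n IH] //; rewrite -natr1; apply: subfield_sum.
have sz (z : int) : S z%:~R.
  by case: z => n; rewrite ?NegzE ?mulrNz -?pmulrn; [|apply: subfield_opp]; apply: sn.
by rewrite -[c]divq_num_den fmorph_div !rmorph_int; apply: sV.
Qed.

Lemma subfield_ratfun (f : {rmorphism ratfun rat -> L}) :
  S (f 'X%:F) -> forall z, S (f z).
Proof.
move=> sX z; case: (hS) => s1 sB sV; rewrite (fracP z) fmorph_div.
have sp (p : {poly rat}) : S (f p%:F).
  elim/poly_ind: p => [|p c IH].
    by rewrite tofrac0 rmorph0 -(subrr 1); apply: sB.
  rewrite tofracD tofracM rmorphD rmorphM; apply: subfield_sum => //.
    exact: subfield_mul.
  exact: (subfield_rat (f \o (@tofrac _ \o polyC))).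
exact: sV.
Qed.
End Subfields.

(** * Germs of functions along a sequence of rationals *)

Definition eventually (P : nat -> Prop) := exists N, forall n, (N <= n)%N -> P n.

Lemma eventually_of (P : nat -> Prop) : (forall n, P n) -> eventually P.
Proof. by exists 0%N. Qed.

Lemma eventually_mono (P Q : nat -> Prop) :
  eventually P -> (forall n, P n -> Q n) -> eventually Q.
Proof. by move=> [N h] hPQ; exists N => n /h/hPQ. Qed.

Lemma eventually_and (P Q : nat -> Prop) :
  eventually P -> eventually Q -> eventually (fun n => P n /\ Q n).
Proof.
move=> [N h] [M h']; exists (maxn N M) => n; rewrite geq_max => /andP[/h ? /h' ?].
by split.
Qed.

(* A germ is a ring morphism from L to the ring of sequences of rationals     *)
(* modulo the sequences that are eventually zero.                             *)
Record germ (L : fieldType) := Germ {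
  germ_val :> L -> nat -> rat;
  germ1 : eventually (fun n => germ_val 1 n = 1);
  germB : forall x y,
    eventually (fun n => germ_val (x - y) n = germ_val x n - germ_val y n);
  germM : forall x y,
    eventually (fun n => germ_val (x * y) n = germ_val x n * germ_val y n) }.

Section GermTheory.
Variables (L : fieldType) (g : germ L).
Implicit Types x y : L.

Lemma germ0 : eventually (fun n => g 0 n = 0).
Proof. by apply: eventually_mono (germB g 1 1) _ => n; rewrite subrr => ->; rewrite subrr. Qed.

Lemma germN x : eventually (fun n => g (- x) n = - g x n).
Proof.
apply: eventually_mono (eventually_and germ0 (germB g 0 x)) _ => n [e].
by rewrite sub0r => ->; rewrite e sub0r.
Qed.

Lemma germD x y : eventually (fun n => g (x + y) n = g x n + g y n).
Proof.
apply: eventually_mono (eventually_and (germN y) (germB g x (- y))) _ => n [e].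
by rewrite opprK => ->; rewrite e opprK.
Qed.

Lemma germV x : x != 0 ->
  eventually (fun n => g x n != 0 /\ g x^-1 n = (g x n)^-1).
Proof.
move=> x0; apply: eventually_mono (eventually_and (germ1 g) (germM g x x^-1)) _ => n [e].
rewrite divff // e => e'; have gx0 : g x n != 0.
  by apply/eqP => h; move/eqP: e'; rewrite h mul0r oner_eq0.
by split=> //; apply: (mulfI gx0); rewrite -e' divff.
Qed.

Lemma germ_neq x y : x != y -> eventually (fun n => g x n != g y n).
Proof.
rewrite -subr_eq0 => /germV h.
apply: eventually_mono (eventually_and h (germB g x y)) _ => n [[+ _] e].
by rewrite e subr_eq0.
Qed.

Lemma germ_div x y : y != 0 ->
  eventually (fun n => g y n != 0 /\ g (x / y) n = g x n / g y n).
Proof.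
move=> /germV h; apply: eventually_mono (eventually_and h (germM g x y^-1)) _.
by move=> n [[y0 e] e']; rewrite e' e.
Qed.

(** Division by 0 is covered as well, since it gives 0 on both sides. This serves for tangent slopes
    of pairs that are not assumed to lie on the curve. *)
Lemma germ_ratio x y : eventually (fun n => g (x / y) n = g x n / g y n).
Proof.
have [->|y0] := eqVneq y 0; last by apply: eventually_mono (germ_div x y0) _ => n [].
apply: eventually_mono (eventually_and germ0 (germM g x 0^-1)) _ => n [e1 e2].
by rewrite e2 !invr0 e1 mulr0 invr0 mulr0.
Qed.

Lemma germ_nat m : eventually (fun n => g m%:R n = m%:R).
Proof.
elim: m => [|m IH]; first exact: germ0.
rewrite -natr1; apply: eventually_mono (eventually_and (eventually_and IH (germ1 g)) (germD m%:R 1)) _.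
by move=> n [[e1 e2] e3]; rewrite e3 e1 e2 natr1.
Qed.

Lemma germ_int (m : int) : eventually (fun n => g m%:~R n = m%:~R).
Proof.
case: m => m; rewrite ?NegzE ?mulrNz -?pmulrn; first exact: germ_nat.
apply: eventually_mono (eventually_and (germ_nat m.+1) (germN m.+1%:R)) _.
by move=> n [e1 e2]; rewrite e2 e1.
Qed.

Lemma germ_rat (iota : {rmorphism rat -> L}) c :
  eventually (fun n => g (iota c) n = c).
Proof.
have d0 : (denq c)%:~R != 0 :> L.
  by rewrite -(rmorph_int iota) fmorph_eq0 intr_eq0 denq_neq0.
rewrite -{1}[c]divq_num_den fmorph_div !rmorph_int.
apply: eventually_mono (eventually_and (eventually_and (germ_int (numq c))
   (germ_int (denq c))) (germ_div (numq c)%:~R d0)) _.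
by move=> n [[e1 e2] [_ e3]]; rewrite e3 e1 e2 divq_num_den.
Qed.

Lemma germX x m : eventually (fun n => g (x ^+ m) n = g x n ^+ m).
Proof.
elim: m => [|m IH]; first by rewrite expr0; apply: germ1.
rewrite exprS; apply: eventually_mono (eventually_and IH (germM g x (x ^+ m))) _.
by move=> n [e1 e2]; rewrite e2 e1 exprS.
Qed.

Section Specialization.
Variables (E : ellcurve L) (E_ : nat -> ellcurve rat).
Hypothesis ea : eventually (fun n => g (ec_a E) n = ec_a (E_ n)).

Definition specialize (n : nat) (P : option (L * L)) : option (rat * rat) :=
  if P is Some (x, y) then Some (g x n, g y n) else None.

(** The group law is made of finitely many field operations and comparisons. Equalities persist
    along a germ, and so do inequalities, a nonzero element of [L] being invertible ([germ_neq]). *)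
Lemma specialize_add P Q : eventually (fun n =>
  specialize n (add_raw E P Q) = add_raw (E_ n) (specialize n P) (specialize n Q)).
Proof.
case: P Q => [[x1 y1]|] [[x2 y2]|]; try exact: eventually_of.
have fin (l : L) (l_ : nat -> rat) : eventually (fun n => g l n = l_ n) ->
  let x3 := l ^+ 2 - x1 - x2 in let y3 := l * (x1 - x3) - y1 in
  eventually (fun n => let x3_ := l_ n ^+ 2 - g x1 n - g x2 n in
    (g x3 n, g y3 n) = (x3_, l_ n * (g x1 n - x3_) - g y1 n)).
  move=> hl x3 y3.
  apply: eventually_mono (eventually_and hl (eventually_and (eventually_and
    (germX l 2) (eventually_and (germB g (l ^+ 2) x1) (germB g (l ^+ 2 - x1) x2)))
    (eventually_and (germB g (l * (x1 - x3)) y1) (eventually_and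
    (germM g l (x1 - x3)) (germB g x1 x3))))) _.
  move=> n [e1 [[e2 [e3 e4]] [e5 [e6 e7]]]] /=.
  by rewrite e5 e6 e7 /x3 e4 e3 e2 e1.
rewrite /=; have [e12x|n12] := eqVneq x1 x2; last first.
  have hl := germ_div (y1 - y2) (_ : x1 - x2 != 0); rewrite subr_eq0 in hl.
  have hl' : eventually (fun n => g ((y1 - y2) / (x1 - x2)) n =
      (g y1 n - g y2 n) / (g x1 n - g x2 n)).
    apply: eventually_mono (eventually_and (hl n12) (eventually_and (germB g y1 y2)
      (germB g x1 x2))) _.
    by move=> n [[_ e1] [e2 e3]]; rewrite e1 e2 e3.
  apply: eventually_mono (eventually_and (fin _ _ hl') (germ_neq n12)) _.
  by move=> n [e h]; rewrite (negPf h) /=; congr Some.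
rewrite -{x2}e12x in fin *; have [e12|n12] := eqVneq y1 (- y2).
  apply: eventually_mono (germN y2) _ => n e.
  by rewrite eqxx e12 e eqxx.
have hl : eventually (fun n => g ((3 * x1 ^+ 2 + ec_a E) / (2 * y1)) n =
    (3 * g x1 n ^+ 2 + ec_a (E_ n)) / (2 * g y1 n)).
  apply: eventually_mono (eventually_and (eventually_and
    (germ_ratio (3 * x1 ^+ 2 + ec_a E) (2 * y1))
    (eventually_and (germD (3 * x1 ^+ 2) (ec_a E)) ea))
    (eventually_and (eventually_and (germM g 3 (x1 ^+ 2)) (germX x1 2))
    (eventually_and (germM g 2 y1) (eventually_and (germ_nat 3) (germ_nat 2))))) _.
  by move=> n [[e1 [e2 e3]] [[e4 e5] [e6 [e7 e8]]]]; rewrite e1 e2 e3 e4 e5 e6 e7 e8.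
apply: eventually_mono (eventually_and (fin _ _ hl)
  (eventually_and (germ_neq n12) (germN y2))) _.
by move=> n [e [h e']]; rewrite eqxx /= -e' (negPf h); congr Some.
Qed.

Variables (r : nat) (P : 'I_r -> ec_point E) (P_ : forall n, 'I_r -> ec_point (E_ n)).
Hypothesis P_spec : forall i,
  eventually (fun n => specialize n (val (P i)) = val (P_ n i)).

(** The relation, built from finitely many additions, holds between the [P_ n i] for all large n; a
    single such n is enough to conclude. *)
Lemma specialize_rank :
  (forall n (c : 'I_r -> int), \sum_(i < r) P_ n i *~ c i = 0 -> forall i, c i = 0) ->
  forall c : 'I_r -> int, \sum_(i < r) P i *~ c i = 0 -> forall i, c i = 0.
Proof.
move=> indep c sum0.
pose near (X : ec_point E) (X_ : forall n, ec_point (E_ n)) :=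
  eventually (fun n => specialize n (val X) = val (X_ n)).
have near0 : near 0 (fun=> 0) by apply: eventually_of.
have nearD X X_ Y Y_ : near X X_ -> near Y Y_ -> near (X + Y) (fun n => X_ n + Y_ n).
  move=> hX hY; apply: eventually_mono (eventually_and (eventually_and hX hY)
    (specialize_add (val X) (val Y))) _.
  by move=> n [[e1 e2] e3]; rewrite e3 e1 e2.
have nearN X X_ : near X X_ -> near (- X) (fun n => - X_ n).
  move=> hX; have hN : eventually (fun n =>
      specialize n (opp_raw (val X)) = opp_raw (specialize n (val X))).
    case: (val X) => [[x y]|]; last exact: eventually_of.
    by apply: eventually_mono (germN y) _ => n /= ->.
  apply: eventually_mono (eventually_and hX hN) _ => n [e1 e2].
  by rewrite e2 e1.
have nearMn X X_ m : near X X_ -> near (X *+ m) (fun n => X_ n *+ m).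
  move=> hX; elim: m => [|m IH]; first exact: near0.
  have h := nearD _ _ _ _ hX IH.
  by rewrite mulrS; apply: eventually_mono h _ => n ->; rewrite mulrS.
have nearMz X X_ (m : int) : near X X_ -> near (X *~ m) (fun n => X_ n *~ m).
  by move=> hX; case: m => m; [apply: nearMn | apply: nearN; apply: nearMn].
have near_sum (s : seq 'I_r) :
    near (\sum_(i <- s) P i *~ c i) (fun n => \sum_(i <- s) P_ n i *~ c i).
  elim: s => [|i s IH].
    by rewrite big_nil; apply: eventually_of => n; rewrite big_nil.
  have h := nearD _ _ _ _ (nearMz _ _ (c i) (P_spec i)) IH.
  by rewrite big_cons; apply: eventually_mono h _ => n ->; rewrite big_cons.
have [N hN] := near_sum (index_enum _).
apply: (indep N); apply: val_inj; rewrite -hN // sum0.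
by [].
Qed.
End Specialization.
End GermTheory.

Section RatfunGerm.
Variable xs : nat -> rat.
Hypothesis xs_generic : forall q : {poly rat}, q != 0 -> eventually (fun n => q.[xs n] != 0).

(** The value of a chosen representative. By [xs_generic] its denominator vanishes at finitely many
    indices only, which a germ ignores. *)
Definition ratfun_eval (z : ratfun rat) (n : nat) : rat :=
  (\n_(repr z)).[xs n] / (\d_(repr z)).[xs n].

Lemma ratfun_eval_ratio (p q : {poly rat}) : q != 0 ->
  eventually (fun n => ratfun_eval (p%:F / q%:F) n = p.[xs n] / q.[xs n]).
Proof.
move=> q0; have d0 := denom_ratioP (repr (p%:F / q%:F)).
apply: eventually_mono (eventually_and (xs_generic d0) (xs_generic q0)) _ => n [h1 h2].
have := frac_ratio_eq d0 q0 (esym (fracP (p%:F / q%:F))).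
rewrite /ratfun_eval => e; apply/eqP; rewrite eqr_div // -!hornerM e.
by [].
Qed.

Fact ratfun_eval1 : eventually (fun n => ratfun_eval 1 n = 1).
Proof.
have := ratfun_eval_ratio 1 (oner_neq0 _); rewrite tofrac1 divr1.
by move/eventually_mono; apply=> n ->; rewrite hornerC divr1.
Qed.

Fact ratfun_evalB x y :
  eventually (fun n => ratfun_eval (x - y) n = ratfun_eval x n - ratfun_eval y n).
Proof.
have [d0 d0'] := (denom_ratioP (repr x), denom_ratioP (repr y)).
have := ratfun_eval_ratio (\n_(repr x) * \d_(repr y) - \n_(repr y) * \d_(repr x))
  (mulf_neq0 d0 d0').
rewrite tofracB !tofracM -[in X in X -> _]mulNr -addf_div ?tofrac_eq0 // mulNr -!fracP => h.
apply: eventually_mono (eventually_and h (eventually_and (xs_generic d0) (xs_generic d0'))) _.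
move=> n [-> [h1 h2]]; rewrite hornerD hornerN !hornerM /ratfun_eval.
by rewrite -[in RHS]mulNr addf_div // mulNr.
Qed.

Fact ratfun_evalM x y :
  eventually (fun n => ratfun_eval (x * y) n = ratfun_eval x n * ratfun_eval y n).
Proof.
have [d0 d0'] := (denom_ratioP (repr x), denom_ratioP (repr y)).
have := ratfun_eval_ratio (\n_(repr x) * \n_(repr y)) (mulf_neq0 d0 d0').
rewrite !tofracM -mulf_div -!fracP.
by move/eventually_mono; apply=> n ->; rewrite !hornerM /ratfun_eval mulf_div.
Qed.

Definition ratfun_germ : germ (ratfun rat) := Germ ratfun_eval1 ratfun_evalB ratfun_evalM.

Lemma ratfun_germ_poly (p : {poly rat}) :
  eventually (fun n => ratfun_germ p%:F n = p.[xs n]).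
Proof.
have := ratfun_eval_ratio p (oner_neq0 _); rewrite tofrac1 divr1.
by move/eventually_mono; apply=> n e; rewrite /= e hornerC divr1.
Qed.

Variables (E : ellcurve rat) (ys : nat -> rat).
Hypothesis on_E : forall n, on_curve E (Some (xs n, ys n)).
Local Notation L := (ec_funfield E).
Local Notation g := ratfun_germ.

Definition ff_eval (z : L) (n : nat) : rat :=
  g (ff_coord 0 z) n + g (ff_coord 1 z) n * ys n.

Lemma ff_eval_linear A B n :
  ff_eval (ff_base E A + ff_base E B * ff_y E) n = g A n + g B n * ys n.
Proof. by rewrite /ff_eval ff_coord0E ff_coord1E. Qed.

Fact ff_eval1 : eventually (fun n => ff_eval 1 n = 1).
Proof.
have -> : 1 = ff_base E 1 + ff_base E 0 * ff_y E by rewrite rmorph1 rmorph0 mul0r addr0.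
apply: eventually_mono (eventually_and (germ1 g) (germ0 g)) _ => n [e1 e2].
by rewrite ff_eval_linear e1 e2 mul0r addr0.
Qed.

Fact ff_evalB x y : eventually (fun n => ff_eval (x - y) n = ff_eval x n - ff_eval y n).
Proof.
set A := ff_coord 0 x; set B := ff_coord 1 x; set C := ff_coord 0 y; set D := ff_coord 1 y.
have -> : x - y = ff_base E (A - C) + ff_base E (B - D) * ff_y E.
  by rewrite (ff_coordK x) (ff_coordK y) !rmorphB; ring.
apply: eventually_mono (eventually_and (germB g A C) (germB g B D)) _ => n [e1 e2].
by rewrite ff_eval_linear e1 e2 /ff_eval -/A -/B -/C -/D; ring.
Qed.

Fact ff_evalM x y : eventually (fun n => ff_eval (x * y) n = ff_eval x n * ff_eval y n).
Proof.
set A := ff_coord 0 x; set B := ff_coord 1 x; set C := ff_coord 0 y; set D := ff_coord 1 y.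
set c := (ec_cubic E)%:F.
have -> : x * y = ff_base E (A * C + B * D * c) + ff_base E (A * D + B * C) * ff_y E.
  by rewrite (ff_coordK x) (ff_coordK y) !rmorphD !rmorphM /= -ff_ySqr; ring.
have e := eventually_and (eventually_and (germD g (A * C) (B * D * c))
  (germD g (A * D) (B * C))) (eventually_and (eventually_and (germM g A C)
  (germM g (B * D) c)) (eventually_and (germM g B D) (eventually_and
  (germM g A D) (eventually_and (germM g B C) (ratfun_germ_poly (ec_cubic E)))))).
apply: eventually_mono e _ => n [[e1 e2] [[e3 e4] [e5 [e6 [e7 e8]]]]].
rewrite ff_eval_linear e1 e2 e3 e4 e5 e6 e7 e8.
have -> : (ec_cubic E).[xs n] = ys n ^+ 2.
  by rewrite (eqP (on_E n)) /ec_cubic !hornerE.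
by rewrite /ff_eval -/A -/B -/C -/D; ring.
Qed.

Definition ff_germ : germ L := Germ ff_eval1 ff_evalB ff_evalM.

Lemma ff_germ_x : eventually (fun n => ff_germ (ff_x E) n = xs n).
Proof.
have -> : ff_x E = ff_base E 'X%:F + ff_base E 0 * ff_y E by rewrite rmorph0 mul0r addr0.
apply: eventually_mono (eventually_and (ratfun_germ_poly 'X) (germ0 g)) _ => n [e1 e2].
by rewrite /= ff_eval_linear e1 e2 hornerX mul0r addr0.
Qed.

Lemma ff_germ_y : eventually (fun n => ff_germ (ff_y E) n = ys n).
Proof.
have -> : ff_y E = ff_base E 0 + ff_base E 1 * ff_y E by rewrite rmorph0 rmorph1 mul1r add0r.
apply: eventually_mono (eventually_and (germ1 g) (germ0 g)) _ => n [e1 e2].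
by rewrite /= ff_eval_linear e1 e2 mul1r add0r.
Qed.
End RatfunGerm.

(** A nonzero polynomial has finitely many roots and an injective sequence meets each at most once;
    the induction splits off one linear factor at a time. *)
Lemma injective_seq_generic (xs : nat -> rat) : injective xs ->
  forall q : {poly rat}, q != 0 -> eventually (fun n => q.[xs n] != 0).
Proof.
move=> inj q q0.
have hit r : eventually (fun n => xs n != r).
  have [[m <-]|no] := classic (exists m, xs m = r); last first.
    by exists 0%N => n _; apply/eqP => e; apply: no; exists n.
  by exists m.+1 => n hn; rewrite (inj_eq inj) neq_ltn hn orbT.
have [m] := ubnP (size q); elim: m q q0 => // m IH q q0.
rewrite ltnS => le_m; have [[r qr]|no] := classic (exists r, root q r); last first.
  by exists 0%N => n _; apply/eqP => e; apply: no; exists (xs n); apply/rootP.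
have /factor_theorem[s es] := qr.
have s0 : s != 0 by apply: contraNneq q0 => s0; rewrite es s0 mul0r.
have lt_s : (size s < m)%N.
  by rewrite (leq_trans _ le_m) // es size_Mmonic ?monicXsubC // size_XsubC addn2.
apply: eventually_mono (eventually_and (IH s s0 lt_s) (hit r)) _ => n [h1 h2].
by rewrite es hornerM hornerXsubC mulf_neq0 // subr_eq0.
Qed.

(** * Integer polynomials *)

Lemma Zeqb_true (a b : Z) : Z.eqb a b -> a = b.
Proof. exact: (proj1 (Z.eqb_eq a b)). Qed.

Section ZEmbedding.
Variable R : comNzRingType.
Implicit Types (a b : Z) (t : R).

(* Sealed, lest conversion expand large integers in unary. *)
Fact zR_spec : {f : Z -> R | forall a, f a = (int_of_Z a)%:~R}.
Proof. by exists (fun a => (int_of_Z a)%:~R). Qed.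

Definition zR : Z -> R := sval zR_spec.

Lemma zRE a : zR a = (int_of_Z a)%:~R. Proof. exact: (svalP zR_spec). Qed.
Lemma zR0 : zR 0 = 0. Proof. exact: zRE. Qed.
Lemma zR1 : zR 1 = 1. Proof. exact: zRE. Qed.
Lemma zRD a b : zR (a + b)%ZZ = zR a + zR b.
Proof. by rewrite !zRE (rmorphD int_of_Z) intrD. Qed.
Lemma zRM a b : zR (a * b)%ZZ = zR a * zR b.
Proof. by rewrite !zRE (rmorphM int_of_Z) intrM. Qed.
Lemma zRN a : zR (- a)%ZZ = - zR a.
Proof. by rewrite !zRE (rmorphN int_of_Z) mulrNz. Qed.
Lemma zRB a b : zR (a - b)%ZZ = zR a - zR b.
Proof. by rewrite /Z.sub zRD zRN. Qed.
Lemma zR_of_nat n : zR (Z.of_nat n) = n%:R.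
Proof.
elim: n => [|n IH]; first exact: zR0.
by rewrite Nat2Z.inj_succ -Z.add_1_r zRD zR1 IH natr1.
Qed.

(* Coefficients in increasing degree. *)
Definition peval (s : seq Z) t : R := foldr (fun c acc => zR c + t * acc) 0 s.

Lemma peval_cons c s t : peval (c :: s) t = zR c + t * peval s t. Proof. by []. Qed.
End ZEmbedding.

Fixpoint zadd (s s' : seq Z) : seq Z :=
  match s, s' with
  | [::], _ => s'
  | _, [::] => s
  | c :: r, c' :: r' => (c + c')%ZZ :: zadd r r'
  end.
Definition zscale (c : Z) (s : seq Z) : seq Z := [seq (c * x)%ZZ | x <- s].
Definition zmul (s s' : seq Z) : seq Z :=
  foldr (fun c acc => zadd (zscale c s') (0%ZZ :: acc)) [::] s.
Definition zsub s s' := zadd s (zscale (-1) s').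
Definition znull (s : seq Z) := all (Z.eqb 0) s.

Section ListPolynomials.
Variable R : comNzRingType.
Implicit Types (s : seq Z) (t : R).

Lemma pevalD s s' t : peval (zadd s s') t = peval s t + peval s' t.
Proof.
elim: s s' => [|c s IH] [|c' s'] /=; rewrite ?add0r ?addr0 //.
by rewrite zRD IH; ring.
Qed.

Lemma pevalZ c s t : peval (zscale c s) t = zR R c * peval s t.
Proof. by elim: s => [|x s IH] /=; rewrite ?mulr0 // zRM IH; ring. Qed.

Lemma pevalM s s' t : peval (zmul s s') t = peval s t * peval s' t.
Proof.
elim: s => [|c s IH] /=; first by rewrite mul0r.
by rewrite pevalD pevalZ /= zR0 IH; ring.
Qed.

Lemma pevalB s s' t : peval (zsub s s') t = peval s t - peval s' t.
Proof. by rewrite pevalD pevalZ [zR R _]zRE mulN1r. Qed.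

Lemma peval_null s t : znull s -> peval s t = 0.
Proof.
by elim: s => // c s IH /andP[/Zeqb_true <- /IH h]; rewrite peval_cons h zR0 mulr0 addr0.
Qed.

(** An identity between lists of binary integers, decided once by computation, becomes an identity
    in every commutative ring. *)
Lemma peval_eq s s' t : znull (zsub s s') -> peval s t = peval s' t.
Proof. by move/peval_null => /(_ t) /eqP; rewrite pevalB subr_eq0 => /eqP. Qed.

Lemma pevalC c t : peval [:: c] t = zR R c.
Proof. by rewrite /= mulr0 addr0. Qed.

Definition zpeval s (z : Z) : Z := foldr (fun c acc => c + z * acc)%ZZ Z0 s.

Lemma peval_zR s z : peval s (zR R z) = zR R (zpeval s z).
Proof. by elim: s => [|c s IH] /=; rewrite ?zR0 // IH zRD zRM. Qed.
End ListPolynomials.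

Lemma zR_rmorph (R R' : comNzRingType) (f : {rmorphism R -> R'}) z : f (zR R z) = zR R' z.
Proof. by rewrite !zRE rmorph_int. Qed.

Lemma peval_rmorph (R R' : comNzRingType) (f : {rmorphism R -> R'}) s t :
  f (peval s t) = peval s (f t).
Proof.
by elim: s => [|c s IH] /=; rewrite ?rmorph0 // rmorphD rmorphM zR_rmorph IH.
Qed.

Lemma residue_zR (K k : fieldType) (v : place K k) z : v (zR K z) = Some (zR k z).
Proof. by rewrite !zRE; apply: residue_int. Qed.

Lemma residue_peval (K k : fieldType) (v : place K k) s t c : v t = Some c ->
  v (peval s t) = Some (peval s c).
Proof.
move=> h; elim: s => [|x s IH]; first exact: residue0.
exact: residueD (residue_zR v x) (residueM h IH).
Qed.

Section ZModPrime.
Variables (p : nat) (p_pr : prime p).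
Local Notation F := 'F_p.

Lemma zR_modp z : zR F (z mod Z.of_nat p)%ZZ = zR F z.
Proof.
have zp : zR F (Z.of_nat p) = 0 by rewrite zR_of_nat pchar_Fp_0.
have p0 : Z.of_nat p <> Z0.
  by move/(Nat2Z.inj p 0) => e; have := p_pr; rewrite e.
by rewrite [in RHS](Z.div_mod z _ p0) zRD zRM zp mul0r add0r.
Qed.

Lemma zR_Fp_eq0 z : (zR F z == 0) = Z.eqb (z mod Z.of_nat p) 0.
Proof.
have p_gt0 : (0 < Z.of_nat p)%ZZ.
  by apply: (proj1 (Nat2Z.inj_lt 0 p)); apply/ssrnat.ltP; apply: prime_gt0.
rewrite -zR_modp; have [r_ge0 r_lt] := Z.mod_pos_bound z _ p_gt0.
move: (z mod _)%ZZ r_ge0 r_lt => r r_ge0 r_lt.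
rewrite -(Z2Nat.id r) // in r_lt *; move: (Z.to_nat r) r_lt => m /(proj2 (Nat2Z.inj_lt _ _))/ssrnat.ltP lt_m.
rewrite zR_of_nat -(dvdn_pcharf (pchar_Fp p_pr)).
apply/idP/idP => [dv|/Zeqb_true/(Nat2Z.inj m 0)-> //].
by case: m lt_m dv => // m lt_m /(dvdn_leq (ltn0Sn m)); rewrite leqNgt lt_m.
Qed.
End ZModPrime.

Definition Zpowmod (m : Z) (a : Z) (n : nat) : Z :=
  iter n (fun x => (x * a) mod m)%ZZ 1%ZZ.

Lemma zR_powmod p (p_pr : prime p) a n :
  zR 'F_p (Zpowmod (Z.of_nat p) a n) = zR 'F_p a ^+ n.
Proof.
elim: n => [|n IH]; first exact: zR1.
by rewrite /= zR_modp // zRM IH exprSr.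
Qed.

(* The point ((C + D v) / m^2, (A + B v) / m^3) over Q(t, v), v^2 = d(t). *)
Record bipoint := BiPoint { bp_m : Z; bp_C : seq Z; bp_D : seq Z; bp_A : seq Z; bp_B : seq Z }.

Definition list_S : seq Z := [::
  4201305425690184127251888481; 17860826619093915900857289304;
  28607402618712438778345257832; 21430123310022469548285709072;
  8789387383568632081365832240; 2020678721371875903158954848;
  234256046667228607566274912; 10476571005172375234427296;
  307516108335972163537936]%ZZ.

(* The coefficients of T / 4. *)
Definition list_T4 : seq Z := [seq (c / 4)%ZZ | c <- [::
  2193201312876924214657300134273061462776968;
  13865015501478235534002649882546248548532768;
  36435013603665838306995466090052055171475872;
  52862444598312784274784438443066814490530880;
  47243082583908684509409509915652973906060800;
  26905633537996991160744810870319331164617600;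
  9904246958414858348647761354992989326760320;
  2373760737463050257069464720014664373086080;
  372202978476351718721663756748866085220800;
  38126035250980128714796491999580538771200;
  2392486076703808362288120169049836903680;
  67802587761728815952013525763236564480;
  1050290276365892761266194577222156800]%ZZ].

(** The equation of the surface at [P], multiplied by m ^ 6 and with v ^ 2 replaced by d, is a sum
    of a part free of v and a multiple of v; the two tests say that each component vanishes. *)
Definition bp_check (d : seq Z) (P : bipoint) : bool :=
  let: BiPoint m C D A B := P in
  let m4 := (m * m * m * m)%ZZ in let m6 := (m4 * m * m)%ZZ in
  let sq x := zmul x x in
  let a := zscale (-27 * m4)%ZZ list_S in
  znull (zsub (zadd (sq A) (zmul (sq B) d))
     (zadd (zmul C (zadd (zadd (sq C) (zscale 3 (zmul (sq D) d))) a))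
           (zscale (27 * m6)%ZZ list_T4))) &&
  znull (zsub (zscale 2 (zmul A B))
     (zmul D (zadd (zadd (zscale 3 (sq C)) (zmul (sq D) d)) a))).

Section Points.
Variable F : fieldType.
Implicit Types (t v : F) (P : bipoint).

Definition bp_x P t v : F := (peval (bp_C P) t + peval (bp_D P) t * v) / zR F (bp_m P) ^+ 2.
Definition bp_y P t v : F := (peval (bp_A P) t + peval (bp_B P) t * v) / zR F (bp_m P) ^+ 3.

Lemma bp_on_curve d P t v (E : ellcurve F) : bp_check d P -> zR F (bp_m P) != 0 ->
  ec_a E = - 27 * peval list_S t -> ec_b E = 27 * peval list_T4 t ->
  v ^+ 2 = peval d t -> on_curve E (Some (bp_x P t v, bp_y P t v)).
Proof.
case: P => m C D A B /andP[/peval_eq h1 /peval_eq h2]; rewrite [bp_m _]/= => m0 ea eb ev.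
move: {h1 h2} (h1 F t) (h2 F t).
rewrite !(pevalD, pevalM, pevalZ, zRM) -ev.
have -> : zR F (-27) = - 27 by rewrite zRE.
have -> : zR F 27 = 27 by rewrite zRE.
have -> : zR F 3 = 3 by rewrite zRE.
have -> : zR F 2 = 2 by rewrite zRE.
rewrite /bp_x /bp_y [bp_m _]/= [bp_A _]/= [bp_B _]/= [bp_C _]/= [bp_D _]/=.
rewrite /on_curve ea eb; move: (27 : F) => k; move: (peval C t) (peval D t) (peval A t) (peval B t) (peval list_S t) (peval list_T4 t) (zR F m) m0.
move=> c e a b S T w w0 h1 h2; apply/eqP.
have w6 : w ^+ 6 != 0 by rewrite expf_neq0.
apply: (mulIf w6).
transitivity (a * a + b * b * (v ^+ 2) + v * (2 * (a * b))).
  by field.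
by rewrite h1 h2; field.
Qed.
End Points.

(** * The nineteen points *)

(** The conics over which the bisections are defined are v1 ^ 2 = [quad1] and v2 ^ 2 = [quad2]. *)
Definition quad1 : seq Z :=
  [:: 12931523136; -48136690560; 6791058145]%ZZ.

Definition quad2 : seq Z :=
  [:: 126480025; 108563070; 21650409]%ZZ.

Definition bisection1 : bipoint :=
  (BiPoint 187 [:: 5805846719763997467; 14457309314294814396;
  8658674100060040998; 919812347635027002; 56973647433858636] [::
  8904106438920; -3978855342; 3574517233014; 320411329056] [::
  -3394571170234473164782566720; -2115330032600597324407491288;
  1293717600934600662987548382; -992591627020896407196093822;
  989877691119462408930076956; 87748303096357728475947660;
  -700006478420469464008128] [:: 47953570970447704968120;
  87997654222400818886958; 1632134955481441340094; -27658342784446414870752;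
  -4040398033678236921444; -64561567882064999616])%ZZ.

Definition bisection2 : bipoint :=
  (BiPoint 1 [:: 468483680699103; 494442690963390; 335925604220180;
  122276931217662; 16510743626988] [:: -24601967676; 4443284586; 13476601814;
  2864817696] [:: 9434712513482559363060; 8036034788751349467438;
  -2623415835222356600556; -6530030770073295911530; -3614861722930113310200;
  -874413152586190863828; -79342031184033968064] [:: -810375343426672452;
  -396333400123293282; -281511905083284330; -362392407351396760;
  -147270533569952988; -17822505543006528])%ZZ.

Definition sections : seq bipoint := [::
  (BiPoint 1 [:: 261737580543123; 336747134509260; 235868383985616;
  51403002331488; 269002453836] [::] [:: -1744873474432769049600;
  465051744216316976472; 2314742380081045995060; 850956023087700024384;
  16592204688135616908; -7713065159873441496; 2208034224887812992] [::])%ZZ;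
  (BiPoint 1 [:: 64009087848723; 247406159531076; 277406556178284;
  42553029302628; 902582184972] [::] [:: -2793828536490662236800;
  -6746544184870667848320; -2750018959045177961544; 894247858121169762756;
  12290041192627768284; -40832461813624971984; 575039953874251008] [::])%ZZ;
  (BiPoint 1 [:: 180359154789523; 413998166390596; 157286982486628;
  21115669558212; 2376674330124] [::] [:: -460438083376856806400;
  -55838272409600021760; 3017159731670687230368; 1882756947538813352948;
  366452797440736860876; 18172242102544805232; -883699170088990464] [::])%ZZ;
  (BiPoint 1 [:: 171175622040723; 587297907382596; 375771115033380;
  64319027052228; 118700545548] [::] [:: -634344466543620940800;
  3116716950114929053440; 9208407002072176256544; 5420217389748971323788;
  990912547082624456628; 21697572642453356688; -2470944946670643456] [::])%ZZ;
  (BiPoint 1 [:: 326245684018323; 431787540049476; 213740523250020;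
  25032327471528; 925868688888] [::] [:: -3538462274709538176000;
  -3554225882656876177920; 61441225542495811584; 252481387110205563648;
  -263955757263237170352; -59113140369034407552; -442399059660117456] [::])%ZZ;
  (BiPoint 1 [:: 167840236602723; 446130233718756; 156202250105808;
  17982894309432; 2473494639564] [::] [:: -702301662504207334800;
  181386044543763371520; 2264279206266278081028; 1837822470299055735048;
  450135202333544819676; 23588121598801696872; -1298256219916066944] [::])%ZZ;
  (BiPoint 1 [:: 408936541867923; 494998206601236; 206429765168484;
  25332675721548; 2607059076492] [::] [:: -6066496464706290412800;
  -7299634325222441320560; -1551446814563827212096; 205407447948314030484;
  -13135661087874082524; 7427947850417731104; 1778416320474772992] [::])%ZZ;
  (BiPoint 1 [:: 391274552710803; 404600386491204; 204083949285180;
  34977765986124; -1171472883828] [::] [:: 5506565594625198512640;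
  4070739889548476417664; -474969724049923029288; -404755618134889917468;
  220811790627849759156; 82392130471059830304; 3899801684268052992] [::])%ZZ;
  (BiPoint 1 [:: 167894039559315; 247147544558148; 128290366933092;
  31891527194280; 3919760310648] [::] [:: 701193892436915125248;
  3913388987798546800128; 6287496795330935243904; 2721668094769878933120;
  259756680779587294992; -46984827271182622848; -5896539983118614544] [::])%ZZ;
  (BiPoint 1 [:: 204703479290379; 406961327786208; 325925623995192;
  82519463165100; 4140780769164] [::] [:: -401639676277371812280;
  164643569057210460516; 3422717176341211663356; 3658382858132030206620;
  1432425557838048281820; 215233846638208785504; 6611121227546694144] [::])%ZZ;
  (BiPoint 1 [:: 304456582100883; 448019664127620; 84146613883956;
  -6900780974412; 419884536396] [::] [:: -2913630401455186533120;
  -3523393851784245137088; 3519107150812739581680; 4035207954948742785564;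
  1140847719698231045748; 102352278854532258864; 1917605876395727232] [::])%ZZ;
  (BiPoint 1 [:: 576950070168723; 537129721331268; 192355889576292;
  26043199114920; 2370526462200] [::] [:: -11891501313402624076800;
  -12227851022946558465024; -2581139670889783910400; 508419950867157813120;
  131467074087519303120; 5818194496242445824; 853263522616705200] [::])%ZZ;
  (BiPoint 1 [:: 237328635226323; 365849371875156; 250582562789364;
  49844730647868; -327529607028] [::] [:: -1118116177053577416000;
  242373418395628693680; 2079192929499580278384; 1186098747877063146204;
  146273639415245534556; -24389616942859761216; -3126304596373291008] [::])%ZZ;
  (BiPoint 1 [:: 298396834281643; 347924756768304; 172528953204280;
  34823789883324; 2511412539532] [::] [:: -2743145033393593478440;
  -576109517900433225876; 3241094758998414931812; 1658324162618010440532;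
  92219850093143421636; -40606609872606613056; -1441293838129553408] [::])%ZZ;
  (BiPoint 1 [:: 188843907506323; 328631585868196; 244537197826636;
  50626081079652; -201254386164] [::] [:: -342212121782026496000;
  -585785505278784401760; -1253264961999891378408; -797314994611668261820;
  -124106473954472595300; 16968845380047827760; 2958430321094347008] [::])%ZZ;
  (BiPoint 1 [:: 153831271666323; 380028594433956; 220622056585164;
  57848928328932; 7009919824908] [::] [:: -997242752055041856000;
  -1642191306126637050720; 782013980171293196184; -134695646735456276028;
  -591478601165000500068; -190408236270200808912; -17127370870287065856]
  [::])%ZZ;
  (BiPoint 1 [:: 498609006990163; 365295134904648; -41387090499248;
  -41851950439260; -3148687080500] [::] [:: -9066638191392497235520;
  -4640653357499621613996; 9014077805255040608220; 7343649601863992555580;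
  1846315545150635484900; 158830358228754906096; 1419857154168618880] [::])%ZZ].

Arguments sections : simpl never.
Arguments bisection1 : simpl never.
Arguments bisection2 : simpl never.
Arguments quad1 : simpl never.
Arguments quad2 : simpl never.

Definition all_points := [:: bisection1, bisection2 & sections].

Lemma bp_check_bisection1 : bp_check quad1 bisection1. Proof. by vm_compute. Qed.
Lemma bp_check_bisection2 : bp_check quad2 bisection2. Proof. by vm_compute. Qed.
Lemma bp_check_sections :
  all (fun P => bp_check quad1 P && bp_check quad2 P) sections.
Proof. by vm_compute. Qed.

(** Index 0 is the bisection over the first conic and index 1 the one over the second. The other
    indices are sections, whose coefficients of the square root are zero, so that either root may be
    supplied. *)
Definition point_x (F : fieldType) (t v1 v2 : F) (i : 'I_19) : F :=
  bp_x (nth bisection1 all_points i) t (if i == 0 :> nat then v1 else v2).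
Definition point_y (F : fieldType) (t v1 v2 : F) (i : 'I_19) : F :=
  bp_y (nth bisection1 all_points i) t (if i == 0 :> nat then v1 else v2).

Lemma bp_check_section j : (j < 17)%N ->
  bp_check quad1 (nth bisection1 sections j) /\ bp_check quad2 (nth bisection1 sections j).
Proof. by move=> lt_j; apply/andP; apply: (all_nthP bisection1 bp_check_sections). Qed.

Section PointsOnSurface.
Variables (F : fieldType) (t v1 v2 : F) (E : ellcurve F).
Hypothesis ea : ec_a E = - 27 * peval list_S t.
Hypothesis eb : ec_b E = 27 * peval list_T4 t.
Hypothesis m_neq0 : forall i : 'I_19, zR F (bp_m (nth bisection1 all_points i)) != 0.

Lemma point_on_curve1 (i : 'I_19) : i != 1%N :> nat -> v1 ^+ 2 = peval quad1 t ->
  on_curve E (Some (bp_x (nth bisection1 all_points i) t v1,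
                    bp_y (nth bisection1 all_points i) t v1)).
Proof.
move=> n1 ev; apply: (bp_on_curve _ (m_neq0 i) ea eb ev).
case: i n1 => [[|[|j]] hj] n1; [exact: bp_check_bisection1 | by [] | ].
by rewrite -[nth _ _ _]/(nth bisection1 sections j); have [] := @bp_check_section j hj.
Qed.

Lemma point_on_curve2 (i : 'I_19) : i != 0%N :> nat -> v2 ^+ 2 = peval quad2 t ->
  on_curve E (Some (bp_x (nth bisection1 all_points i) t v2,
                    bp_y (nth bisection1 all_points i) t v2)).
Proof.
move=> n1 ev; apply: (bp_on_curve _ (m_neq0 i) ea eb ev).
case: i n1 => [[|[|j]] hj] n1; [by [] | exact: bp_check_bisection2 | ].
by rewrite -[nth _ _ _]/(nth bisection1 sections j); have [] := @bp_check_section j hj.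
Qed.

Lemma point_on_curve (i : 'I_19) :
  v1 ^+ 2 = peval quad1 t -> v2 ^+ 2 = peval quad2 t ->
  on_curve E (Some (point_x t v1 v2 i, point_y t v1 v2 i)).
Proof.
move=> ev1 ev2; rewrite /point_x /point_y.
by case: eqP => [e|/eqP n]; [apply: point_on_curve1; rewrite ?e | apply: point_on_curve2].
Qed.
End PointsOnSurface.

(** Pairs of a prime p and a root e modulo p of the cubic of the fibre over the base point. *)
Definition descent_chars : seq (nat * Z) := [::
  (31%N, 9%ZZ); (41%N, 29%ZZ); (53%N, 28%ZZ); (67%N, 13%ZZ); (67%N, 64%ZZ);
  (73%N, 33%ZZ); (83%N, 56%ZZ); (83%N, 81%ZZ); (89%N, 23%ZZ); (97%N, 51%ZZ);
  (107%N, 27%ZZ); (113%N, 7%ZZ); (113%N, 33%ZZ); (127%N, 90%ZZ); (139%N,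
  105%ZZ); (149%N, 137%ZZ); (151%N, 77%ZZ); (151%N, 103%ZZ); (163%N, 50%ZZ)].

(** The inverse over the field with two elements of the matrix [char_table]: row i lists the
    characters whose product takes the value -1 at point i only. *)
Definition dual_chars : seq (seq nat) := [::
  [:: 0; 1; 2; 3; 4; 7; 8; 11; 13; 15; 17];
  [:: 0; 2; 3; 5; 6; 8; 9; 14; 15; 16; 17];
  [:: 3; 5; 6; 11; 13; 14; 17];
  [:: 0; 3; 5; 6; 8; 11; 12; 17];
  [:: 0; 3; 5; 7; 8; 9; 12; 13; 15; 16];
  [:: 0; 2; 4; 5; 8; 11; 12; 14; 15; 17];
  [:: 0; 1; 4; 5; 6; 9; 10; 11; 13; 16; 17; 18];
  [:: 0; 1; 3; 5; 9; 14];
  [:: 5; 6; 7; 13; 14; 15; 18];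
  [:: 0; 2; 3; 8; 11; 12; 14; 16; 18];
  [:: 3; 4; 8; 9; 10; 13; 14; 17];
  [:: 0; 1; 3; 4; 6; 9; 10; 11; 13; 14; 15; 17];
  [:: 1; 4; 5; 6; 10; 14; 15; 16; 18];
  [:: 2; 4; 7; 8; 10; 12; 13; 17; 18];
  [:: 0; 1; 5; 6; 7; 8; 10; 11; 13; 14; 17; 18];
  [:: 0; 3; 4; 5; 6; 7; 8; 9; 10; 12; 13; 14; 16];
  [:: 0; 1; 4; 5; 6; 8; 9; 10; 12; 13; 14; 18];
  [:: 0; 1; 2; 3; 4; 6; 8; 9; 11; 13; 15; 18];
  [:: 0; 5; 7; 8; 9; 12]]%N.

(** * Independence near the base point *)

(* Integers congruent modulo p to the coordinates t = 75/11, v1 = -227259/11, *)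
(* v2 = 43280 of the base point of the genus 1 curve v1^2 = d1(t),            *)
(* v2^2 = d2(t).                                                              *)
Definition base_t (p : nat) : Z :=
  ((75 * Zpowmod (Z.of_nat p) 11 (p - 2)) mod Z.of_nat p)%ZZ.
Definition base_v1 (p : nat) : Z :=
  ((-227259 * Zpowmod (Z.of_nat p) 11 (p - 2)) mod Z.of_nat p)%ZZ.
Definition base_v2 : Z := 43280.

Definition base_a p : Z := (-27 * zpeval list_S (base_t p))%ZZ.
Definition base_b p : Z := (27 * zpeval list_T4 (base_t p))%ZZ.

Definition base_X p (i : nat) : Z :=
  let P := nth bisection1 all_points i in
  (zpeval (bp_C P) (base_t p) +
   zpeval (bp_D P) (base_t p) * (if (i == 0)%N then base_v1 p else base_v2))%ZZ.

Definition mod0 p z := Z.eqb (z mod Z.of_nat p) 0.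

Definition good_prime p : bool :=
  [&& prime p, odd p, ~~ mod0 p 11, mod0 p (11 * base_t p - 75)%ZZ,
      mod0 p (11 * base_v1 p - -227259)%ZZ,
      ~~ mod0 p (- 16 * (4 * (base_a p * base_a p * base_a p) + 27 * (base_b p * base_b p)))%ZZ
    & all (fun P => ~~ mod0 p (bp_m P)) all_points].

Definition root_mod p (x : Z) : bool :=
  mod0 p (x * x * x + base_a p * x + base_b p)%ZZ.

(** Euler's criterion for x - e at point i of the base fibre, after multiplication by the square m ^
    2. *)
Definition symbol p e i : Z :=
  let m := bp_m (nth bisection1 all_points i) in
  Zpowmod (Z.of_nat p) ((base_X p i - e * m * m) mod Z.of_nat p)%ZZ p./2.

(** Requiring 1 or p - 1 excludes 0: no abscissa is congruent to e, so the special value of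
    [descent_raw] at (e, 0) does not occur at the 19 points. *)
Definition good_char (c : nat * Z) : bool :=
  let: (p, e) := c in
  [&& good_prime p, root_mod p e
    & all (fun i => Z.eqb (symbol p e i) 1 || Z.eqb (symbol p e i) (Z.of_nat p - 1)%ZZ)
        (iota 0 19)].

Definition char_table : seq (seq bool) :=
  [seq [seq ~~ Z.eqb (symbol c.1 c.2 i) 1 | i <- iota 0 19] | c <- descent_chars].

Definition no_root p : bool := all (fun n => ~~ root_mod p (Z.of_nat n)) (iota 0 p).

Lemma good_chars : all good_char descent_chars. Proof. by vm_compute. Qed.
Lemma good_prime47 : good_prime 47 && no_root 47. Proof. by vm_compute. Qed.

Definition dual_entry (i k : nat) : bool :=
  foldr (fun j b => nth false (nth [::] char_table j) k (+) b) false (nth [::] dual_chars i).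

Arguments descent_chars : simpl never.
Arguments dual_chars : simpl never.
Arguments char_table : simpl never.
Arguments symbol : simpl never.

Lemma dual_chars_table :
  all (fun i => all (fun k => dual_entry i k == (i == k)) (iota 0 19)) (iota 0 19).
Proof. by vm_compute. Qed.

Definition near_base (p : nat) (t v1 v2 : rat) :=
  [/\ padic_residue p t = Some (zR _ 75 / zR _ 11),
      padic_residue p v1 = Some (zR _ (-227259) / zR _ 11)
    & padic_residue p v2 = Some (zR _ base_v2)].

Lemma mod0_cubic p (p_pr : prime p) (x a b : Z) :
  mod0 p (x * x * x + a * x + b)%ZZ =
  (zR 'F_p x ^+ 3 + zR 'F_p a * zR 'F_p x + zR 'F_p b == 0).
Proof. by rewrite /mod0 -(zR_Fp_eq0 p_pr) !zRD !zRM !exprS expr0 mulr1 !mulrA. Qed.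

Section NearBase.
Variables (t v1 v2 : rat) (E : ellcurve rat).
Hypothesis ea : ec_a E = - 27 * peval list_S t.
Hypothesis eb : ec_b E = 27 * peval list_T4 t.

Section OnePrime.
Variable p : nat.
Hypothesis hp : good_prime p.
Hypothesis near : near_base p t v1 v2.

Lemma good_prime_prime : prime p. Proof. by case/and5P: hp. Qed.
Local Notation p_pr := good_prime_prime.
Local Notation v := (padic p_pr).

Lemma near_base_zR : [/\ v t = Some (zR _ (base_t p)), v v1 = Some (zR _ (base_v1 p))
  & v v2 = Some (zR _ base_v2)].
Proof.
case: near => h1 h2 h3; case/and5P: hp => _ _ n11 mt /and3P[mv _ _].
move: n11 mt mv; rewrite /mod0 -!(zR_Fp_eq0 p_pr) !zRB !zRM !subr_eq0.
move=> n11 /eqP e1 /eqP e2.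
by split; [rewrite [LHS]h1 -e1 | rewrite [LHS]h2 -e2 | exact: h3]; rewrite mulrC mulKf.
Qed.

Fact base_disc : - 16 * (4 * zR 'F_p (base_a p) ^+ 3 + 27 * zR 'F_p (base_b p) ^+ 2) != 0.
Proof.
case/and5P: hp => _ _ _ _ /and3P[_ h _]; move: h; rewrite /mod0 -(zR_Fp_eq0 p_pr).
rewrite zRM zRD [zR _ (4 * _)]zRM [zR _ (27 * _)]zRM.
have -> : zR 'F_p (-16) = - 16 by rewrite zRE.
have -> : zR 'F_p 4 = 4 by rewrite zRE.
have -> : zR 'F_p 27 = 27 by rewrite zRE.
by rewrite !zRM -!expr2 -exprSr.
Qed.

Definition base_curve : ellcurve 'F_p := EllCurve base_disc.

Lemma base_curve_a : v (ec_a E) = Some (ec_a base_curve).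
Proof.
have [ht _ _] := near_base_zR; rewrite ea /= /base_a zRM.
have := residueM (residue_zR v (-27)%ZZ) (residue_peval list_S ht).
by rewrite peval_zR [zR rat (-27)]zRE.
Qed.

Lemma base_curve_b : v (ec_b E) = Some (ec_b base_curve).
Proof.
have [ht _ _] := near_base_zR; rewrite eb /= /base_b zRM.
have := residueM (residue_zR v 27%ZZ) (residue_peval list_T4 ht).
by rewrite peval_zR [zR rat 27]zRE.
Qed.

Lemma bp_m_neq0 (i : 'I_19) : zR 'F_p (bp_m (nth bisection1 all_points i)) != 0.
Proof.
case/and5P: hp => _ _ _ _ /and3P[_ _ /(all_nthP bisection1)/(_ i)].
by rewrite /mod0 -(zR_Fp_eq0 p_pr); apply; apply: ltn_ord.
Qed.

Lemma point_x_residue (i : 'I_19) : v (point_x t v1 v2 i) =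
  Some (zR _ (base_X p i) / zR _ (bp_m (nth bisection1 all_points i)) ^+ 2).
Proof.
have [ht hv1 hv2] := near_base_zR; rewrite /point_x /bp_x /base_X zRD zRM -!peval_zR.
apply: residue_div; [|exact: residueX (residue_zR v _)|exact: expf_neq0 (bp_m_neq0 i)].
apply: residueD; first exact: residue_peval.
apply: residueM; first exact: residue_peval.
by case: ifP.
Qed.

Definition char_raw (e : Z) (P : option (rat * rat)) : bool :=
  descent_raw base_curve (zR _ e) (red_raw v P) ^+ p./2 != 1.

(** A point of order two has y = 0, so it does not reduce to the origin; its abscissa is then
    p-integral and reduces to a root of the cubic modulo p. *)
Lemma no_2torsion_near : no_root p -> forall P : ec_point E, P + P = 0 -> P = 0.
Proof.
move=> nr P PP; apply: val_inj; have := congr1 val PP; have := valP P.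
rewrite -[val (P + P)]/(add_raw E (val P) (val P)).
case: (val P) => [[x y]|] // h /add_rawI/= -[] y2.
have y0 : y = 0.
  by apply/eqP; move/eqP: y2; rewrite -addr_eq0 -mulr2n -mulr_natl mulf_eq0 pnatr_eq0.
have [c hx] : exists c, v x = Some c.
  by apply: (curve_y_int base_curve_a base_curve_b h); rewrite y0; apply: residue0.
have [d hy o] := curve_int_y base_curve_a base_curve_b h hx.
have d0 : d = 0 by move: hy; rewrite y0 residue0 => -[].
move: o; rewrite d0 /= expr0n /= eq_sym => /eqP root_c.
have ec : c = zR _ (Z.of_nat c) by rewrite zR_of_nat natr_Zp.
have := allP nr (c : nat); rewrite mem_iota leq0n add0n.
have -> : (c < p)%N by rewrite -[ltnRHS](Fp_cast p_pr) ltn_ord.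
move=> /(_ isT); rewrite /root_mod (mod0_cubic p_pr) -ec => /eqP; case.
exact: root_c.
Qed.

Lemma card_Fp_half : #|'F_p| = (p./2).*2.+1.
Proof.
have odd_p : odd p by case/and5P: hp.
by rewrite (card_Fp p_pr) -[LHS]odd_double_half odd_p.
Qed.

Lemma char_rawD e (P Q : ec_point E) : root_mod p e ->
  char_raw e (val (P + Q)) = char_raw e (val P) (+) char_raw e (val Q).
Proof.
move=> root_e.
have re : zR 'F_p e ^+ 3 + ec_a base_curve * zR _ e + ec_b base_curve = 0.
  by apply/eqP; rewrite -(mod0_cubic p_pr).
have := quad_charD card_Fp_half re (reduce base_curve_a base_curve_b P) (reduce base_curve_a base_curve_b Q).
by rewrite -reduceD.
Qed.

Lemma expf_half_unit (m : 'F_p) : m != 0 -> (m ^+ 2) ^+ p./2 = 1.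
Proof. exact: (sqr_expf_half card_Fp_half). Qed.

Lemma char_raw_point e (i : 'I_19) : good_char (p, e) ->
  on_curve E (Some (point_x t v1 v2 i, point_y t v1 v2 i)) ->
  char_raw e (Some (point_x t v1 v2 i, point_y t v1 v2 i)) = ~~ Z.eqb (symbol p e i) 1.
Proof.
case/and3P=> _ _ /allP/(_ (i : nat)); rewrite mem_iota ltn_ord => /(_ isT) sym.
move=> on_i; have hx := point_x_residue i; have m0 := bp_m_neq0 i.
have [d hy _] := curve_int_y base_curve_a base_curve_b on_i hx.
rewrite /char_raw (red_int hx hy) /descent_raw.
set P := nth _ _ _ in hx m0 *; set w := zR 'F_p (base_X p i - e * bp_m P * bp_m P)%ZZ.
have ew : zR 'F_p (base_X p i) / zR 'F_p (bp_m P) ^+ 2 - zR 'F_p e = w / zR 'F_p (bp_m P) ^+ 2.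
  have m2 : zR 'F_p (bp_m P) ^+ 2 != 0 by rewrite expf_neq0.
  apply: (mulIf m2); rewrite mulrBl !(mulfVK m2) /w zRB !zRM -!mulrA -expr2.
  reflexivity.
have es : zR 'F_p (symbol p e i) = w ^+ p./2 by rewrite /symbol (zR_powmod p_pr) (zR_modp p_pr).
have p_odd : odd p by case/and5P: hp.
have p_gt2 : (2 < p)%N by rewrite (odd_prime_gt2 p_odd p_pr).
have sym1 : (w ^+ p./2 != 1) = ~~ Z.eqb (symbol p e i) 1.
  have [/Zeqb_true e1|n1] := boolP (Z.eqb (symbol p e i) 1).
    by rewrite -es e1 zR1 eqxx.
  move: sym; rewrite (negPf n1) => /Zeqb_true es'; rewrite -es es' zRB zR_of_nat zR1.
  rewrite (pchar_Fp_0 p_pr) sub0r; apply/eqP => /eqP.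
  rewrite eq_sym -subr_eq0 opprK -(dvdn_pcharf (pchar_Fp p_pr) 2).
  by move/(dvdn_leq (isT : 0 < 2)%N); rewrite leqNgt p_gt2.
have w0 : w != 0.
  apply/eqP => w0; move: sym1 sym es; rewrite w0 expr0n.
  have -> : (p./2 == 0)%N = false by case: (p) p_gt2 => [|[|[|q]]].
  move=> /= _ /orP[|] /Zeqb_true -> /eqP; rewrite ?zRB ?zR_of_nat ?zR1 ?(pchar_Fp_0 p_pr).
    by rewrite oner_eq0.
  by rewrite sub0r oppr_eq0 oner_eq0.
have -> : (zR 'F_p (base_X p i) / zR 'F_p (bp_m P) ^+ 2 == zR 'F_p e) = false.
  by rewrite -subr_eq0 ew mulf_eq0 invr_eq0 (negPf w0) expf_eq0 (negPf m0).
by rewrite ew expr_div_n (expf_half_unit m0) divr1.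
Qed.
End OnePrime.

Hypothesis near : forall p, p \in 47%N :: unzip1 descent_chars -> near_base p t v1 v2.
Hypothesis ev1 : v1 ^+ 2 = peval quad1 t.
Hypothesis ev2 : v2 ^+ 2 = peval quad2 t.

Lemma good_char_nth j : (j < 19)%N ->
  good_char (nth (2%N, 1%ZZ) descent_chars j).
Proof. by move=> lt_j; apply: (all_nthP _ good_chars). Qed.

(** [char_raw] takes a proof that p is good; deciding the boolean equality supplies one and makes
    the definition total. The value false for a bad prime is a default. *)
Definition char_nth (j : nat) (P : option (rat * rat)) : bool :=
  if eq_comparable (good_prime (nth (2%N, 1%ZZ) descent_chars j).1) true is left hp
  then char_raw hp (nth (2%N, 1%ZZ) descent_chars j).2 P else false.

Definition dual_char (i : 'I_19) (P : ec_point E) : bool :=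
  foldr (fun j b => char_nth j (val P) (+) b) false (nth [::] dual_chars i).

Lemma near_base_nth j : (j < 19)%N -> near_base (nth (2%N, 1%ZZ) descent_chars j).1 t v1 v2.
Proof.
move=> lt_j; apply: near; rewrite inE; apply/orP; right.
by apply: map_f; apply: mem_nth.
Qed.

Lemma char_nthD j (P Q : ec_point E) : (j < 19)%N ->
  char_nth j (val (P + Q)) = char_nth j (val P) (+) char_nth j (val Q).
Proof.
move=> lt_j; have := near_base_nth lt_j; have := good_char_nth lt_j.
rewrite /char_nth; case: (nth _ descent_chars j) => p e /and3P[hp re _] nb.
by case: eq_comparable => [hp'|/(_ hp)//]; apply: char_rawD.
Qed.

Lemma bp_m_rat_neq0 (i : 'I_19) : zR rat (bp_m (nth bisection1 all_points i)) != 0.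
Proof.
have : all (fun P => ~~ Z.eqb (bp_m P) 0) all_points by vm_compute.
move/(all_nthP bisection1)/(_ i (ltn_ord i)); apply: contraNneq.
move/eqP; rewrite zRE intr_eq0 => /eqP e; apply/Z.eqb_eq.
by apply: (can_inj int_of_ZK).
Qed.

Definition rat_point (i : 'I_19) : ec_point E :=
  EcPoint (point_on_curve ea eb bp_m_rat_neq0 i ev1 ev2).

Lemma char_nth_point j (i : 'I_19) : (j < 19)%N ->
  char_nth j (val (rat_point i)) = nth false (nth [::] char_table j) i.
Proof.
move=> lt_j; rewrite /char_table.
have lt_j' : (j < size descent_chars)%N by [].
rewrite (nth_map (2%N, 1%ZZ) [::] _ lt_j').
have lt_i : (i < size (iota 0 19))%N by rewrite size_iota.
rewrite (nth_map 0%N false _ lt_i) (nth_iota _ _ (ltn_ord i)) add0n.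
have := near_base_nth lt_j; have := good_char_nth lt_j.
rewrite /char_nth; case: (nth _ descent_chars j) => p e gc nb.
have [hp _ _] := and3P gc.
rewrite -[val _]/(Some (point_x t v1 v2 i, point_y t v1 v2 i)).
rewrite -[RHS]/(~~ Z.eqb (symbol p e i) 1).
case: eq_comparable => [hp'|/(_ hp)//].
exact: (char_raw_point hp' nb gc (point_on_curve ea eb bp_m_rat_neq0 i ev1 ev2)).
Qed.

Lemma dual_chars_lt (i : 'I_19) j : j \in nth [::] dual_chars i -> (j < 19)%N.
Proof.
have : all (all (fun j => j < 19)%N) dual_chars by vm_compute.
by move/(all_nthP [::])/(_ i (ltn_ord i))/allP; apply.
Qed.

Lemma dual_charD i P Q : dual_char i (P + Q) = dual_char i P (+) dual_char i Q.
Proof.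
rewrite /dual_char; elim: (nth _ _ _) (@dual_chars_lt i) => // j s IH lt_s.
rewrite [foldr _ _ _]/= char_nthD ?lt_s ?mem_head //= IH => [|k ks].
  by rewrite addbACA.
by apply: lt_s; rewrite inE ks orbT.
Qed.

Lemma dual_char_point i k : dual_char i (rat_point k) = (i == k).
Proof.
have /allP/(_ (i : nat)) := dual_chars_table.
rewrite mem_iota ltn_ord => /(_ isT)/allP/(_ (k : nat)).
rewrite mem_iota ltn_ord => /(_ isT)/eqP e; apply: (etrans _ e) => {e}.
rewrite /dual_char /dual_entry; elim: (nth _ _ _) (@dual_chars_lt i) => // j s IH lt_s.
rewrite [LHS]/= [RHS]/= char_nth_point ?lt_s ?mem_head // IH // => m ms.
by apply: lt_s; rewrite inE ms orbT.
Qed.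

Lemma rat_points_independent (c : 'I_19 -> int) :
  \sum_i rat_point i *~ c i = 0 -> forall i, c i = 0.
Proof.
apply: (independent_of_chars dual_charD dual_char_point).
have /andP[hp nr] := good_prime47.
by apply: (no_2torsion_near hp _ nr); apply: near; rewrite mem_head.
Qed.
End NearBase.

(** * The curve of genus one *)

(* With t = (75 + z) / 11, v1 = V1 / 11, v2 = V2 / 11 the two quadratic       *)
(* equations become Vi^2 = ri^2 + bi z + ci z^2, and projecting the first     *)
(* conic from its point (z, V1) = (0, r1) with slope u1 turns the second into *)
(* a quartic in u1, which is put in Weierstrass form y^2 = x^3 + A x + B:     *)
(* U = sigma u1 - S is the slope of the line through (x, y) and (X0, - Y0).   *)
Definition e_r1 : Z := 227259.
Definition e_b1 : Z := 489155125590.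
Definition e_c1 : Z := 6791058145.
Definition e_r2 : Z := 476080.
Definition e_b2 : Z := 4441755120.
Definition e_c2 : Z := 21650409.
Definition e_sigma : Z := 140486880.
Definition e_S : Z := 312839512443.
Definition e_X0 : Z := 13177605098595301197689793.
Definition e_Y0 : Z := -75399460437471492877674344504832105.
Definition e_A : Z := -509551800554471420925005977382930518742079223634352.
Definition e_B : Z :=
  4426396503505954496502536964420706295486972647536854349095369071180645739904.

Section ConicParametrization.
Variables (F : fieldType) (r b c : F).
Implicit Types u V z : F.

Definition conic_z u := (b - 2 * r * u) / (u ^+ 2 - c).
Definition conic_V u := r + u * conic_z u.

Lemma conic_V_sqr u : u ^+ 2 - c != 0 ->
  conic_V u ^+ 2 = r ^+ 2 + b * conic_z u + c * conic_z u ^+ 2.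
Proof. by move=> h; rewrite /conic_V /conic_z; field. Qed.

Lemma conic_param V z : z != 0 -> V ^+ 2 = r ^+ 2 + b * z + c * z ^+ 2 ->
  let u := (V - r) / z in u ^+ 2 - c != 0 -> conic_z u = z.
Proof.
move=> z0 h u h0; apply: (mulIf h0); rewrite /conic_z mulfVK //.
apply: (mulIf z0); rewrite /u.
have -> : z * (((V - r) / z) ^+ 2 - c) * z = V ^+ 2 - 2 * r * V + r ^+ 2 - c * z ^+ 2 by field.
by rewrite h; field.
Qed.
End ConicParametrization.

Section IntegerIdentities.
Variable F : fieldType.
Local Notation "n %:z" := (zR F n) (at level 2, left associativity, format "n %:z").

Lemma zR_cubic (x y a b : Z) : (y * y = x * x * x + a * x + b)%ZZ ->
  y%:z ^+ 2 = x%:z ^+ 3 + a%:z * x%:z + b%:z.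
Proof. by move/(congr1 (zR F)); rewrite !zRD !zRM !exprS !expr0 !mulr1 !mulrA. Qed.

Lemma zR_shift (q0 q1 q2 n d r b c : Z) (z : F) : d%:z != 0 ->
  (r * r = d * d * q0 + d * q1 * n + q2 * n * n)%ZZ ->
  (b = d * q1 + 2 * n * q2)%ZZ -> c = q2 ->
  d%:z ^+ 2 * peval [:: q0; q1; q2] ((n%:z + z) / d%:z) =
  r%:z ^+ 2 + b%:z * z + c%:z * z ^+ 2.
Proof.
move=> d0 /(congr1 (zR F)); rewrite !zRD !zRM => h -> ->.
rewrite zRD !zRM [zR F 2]zRE (expr2 r%:z) h !peval_cons [peval [::] _]/=.
by field.
Qed.

(** Here u' is sg times the slope on the first conic, for which z = sg l' / q'. The right-hand side
    is therefore q' ^ 2 times the second quadratic r2 ^ 2 + b2 z + c2 z ^ 2. The left-hand side is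
    r2 ^ 2 times the discriminant of [chord_discriminant], which is a square on the elliptic
    curve. *)
Lemma zR_quartic (sg S X0 Y0 A r1 b1 c1 r2 b2 c2 : Z) (U : F)
    (u := [:: S; 1%ZZ]) (q := zsub (zmul u u) [:: (c1 * sg * sg)%ZZ])
    (l := zsub [:: (b1 * sg)%ZZ] (zscale (2 * r1) u))
    (u' := U + S%:z) (q' := u' ^+ 2 - c1%:z * sg%:z ^+ 2)
    (l' := b1%:z * sg%:z - 2 * r1%:z * u') :
  znull (zsub
    (zscale (r2 * r2) [:: -3 * (X0 * X0) - 4 * A; -8 * Y0; -6 * X0; 0; 1]%ZZ)
    (zadd (zscale (r2 * r2) (zmul q q))
      (zadd (zscale (b2 * sg) (zmul l q)) (zscale (c2 * sg * sg) (zmul l l))))) ->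
  r2%:z ^+ 2 * (U ^+ 4 - 6 * X0%:z * U ^+ 2 - 8 * Y0%:z * U - 3 * X0%:z ^+ 2 - 4 * A%:z) =
  r2%:z ^+ 2 * q' ^+ 2 + b2%:z * sg%:z * l' * q' + c2%:z * sg%:z ^+ 2 * l' ^+ 2.
Proof.
move/(@peval_eq F _ _ U).
rewrite /l /q /u !(pevalD, pevalM, pevalB, pevalZ, pevalC) !zRM !peval_cons [peval [::] U]/=.
rewrite !zRB !zRM zR0 zR1 [zR F (-3)]zRE [zR F 4]zRE [zR F (-8)]zRE [zR F (-6)]zRE.
rewrite [zR F 2]zRE /l' /q' /u' => h.
transitivity (r2%:z * r2%:z * ((- 3 * (X0%:z * X0%:z) - 4 * A%:z) + U * (- 8 * Y0%:z
   + U * (- 6 * X0%:z + U * (0 + U * (1 + U * 0)))))); first by ring.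
by apply: (etrans h); ring.
Qed.
End IntegerIdentities.

(** Substituting the line of slope U through (x0, - y0) in the cubic gives an equation divisible by
    x - x0; this is the quotient. *)
Lemma chord_quadratic (F : fieldType) (A B x0 y0 x y : F) (U := (y + y0) / (x - x0)) :
  x - x0 != 0 -> y ^+ 2 = x ^+ 3 + A * x + B -> y0 ^+ 2 = x0 ^+ 3 + A * x0 + B ->
  x ^+ 2 + (x0 - U ^+ 2) * x + (x0 ^+ 2 + A + U ^+ 2 * x0 + 2 * U * y0) = 0.
Proof.
move=> n0 h e.
have eU : U * (x - x0) = y + y0 by rewrite /U mulfVK.
apply: (mulIf n0); rewrite mul0r.
have ey : y = U * (x - x0) - y0 by rewrite eU addrK.
transitivity (x ^+ 3 + A * x + B - (x0 ^+ 3 + A * x0 + B) - (U * (x - x0)) ^+ 2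
              + 2 * (U * (x - x0)) * y0); first by ring.
by rewrite -h -e ey; ring.
Qed.

(* The discriminant of the quadratic equation satisfied by the abscissas of   *)
(* the two other points on the line of slope U through (x0, - y0).            *)
Lemma chord_discriminant (F : fieldType) (A B x0 y0 x y : F) (U := (y + y0) / (x - x0)) :
  x - x0 != 0 -> y ^+ 2 = x ^+ 3 + A * x + B -> y0 ^+ 2 = x0 ^+ 3 + A * x0 + B ->
  (2 * x + x0 - U ^+ 2) ^+ 2 =
  U ^+ 4 - 6 * x0 * U ^+ 2 - 8 * y0 * U - 3 * x0 ^+ 2 - 4 * A.
Proof.
move=> n0 h e; have key := chord_quadratic n0 h e; rewrite -/U in key.
apply/eqP; rewrite -subr_eq0; apply/eqP; rewrite -[RHS](mulr0 4) -key.
by ring.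
Qed.

Lemma quartic_to_conic (F : fieldType) (sg c1 r1 b1 r2 b2 c2 u W v : F) :
  sg != 0 -> u ^+ 2 - c1 != 0 -> v = sg * u ->
  r2 ^+ 2 * W ^+ 2 = r2 ^+ 2 * (v ^+ 2 - c1 * sg ^+ 2) ^+ 2 +
    b2 * sg * (b1 * sg - 2 * r1 * v) * (v ^+ 2 - c1 * sg ^+ 2) +
    c2 * sg ^+ 2 * (b1 * sg - 2 * r1 * v) ^+ 2 ->
  (r2 * W / (sg ^+ 2 * (u ^+ 2 - c1))) ^+ 2 =
  r2 ^+ 2 + b2 * conic_z r1 b1 c1 u + c2 * conic_z r1 b1 c1 u ^+ 2.
Proof.
move=> s0 n1 -> h.
have d0 : sg ^+ 2 * (u ^+ 2 - c1) != 0 by rewrite mulf_neq0 // expf_neq0.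
apply: (mulIf (expf_neq0 2 d0)); rewrite -exprMn mulfVK // exprMn h /conic_z.
by field.
Qed.

Section GenusOneCurve.
Variable F : fieldType.
Local Notation r1 := (zR F e_r1).
Local Notation b1 := (zR F e_b1).
Local Notation c1 := (zR F e_c1).
Local Notation r2 := (zR F e_r2).
Local Notation b2 := (zR F e_b2).
Local Notation c2 := (zR F e_c2).
Local Notation sg := (zR F e_sigma).
Local Notation S := (zR F e_S).
Local Notation X0 := (zR F e_X0).
Local Notation Y0 := (zR F e_Y0).
Local Notation A := (zR F e_A).
Local Notation B := (zR F e_B).
Implicit Types x y : F.

Definition e_U x y := (y + Y0) / (x - X0).
Definition e_u1 x y := (e_U x y + S) / sg.
Definition e_z x y := conic_z r1 b1 c1 (e_u1 x y).
Definition e_t x y := (zR F 75 + e_z x y) / zR F 11.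
Definition e_v1 x y := conic_V r1 b1 c1 (e_u1 x y) / zR F 11.
Definition e_V2 x y :=
  r2 * (2 * x + X0 - e_U x y ^+ 2) / (sg ^+ 2 * (e_u1 x y ^+ 2 - c1)).
Definition e_v2 x y := e_V2 x y / zR F 11.
(** Slope on the second conic from its point (z, V2) = (0, - r2). The origin of the elliptic curve
    corresponds to (0, r2), so this slope has a pole there. *)
Definition e_u2 x y := (e_V2 x y + r2) / e_z x y.

Lemma e_basepoint : Y0 ^+ 2 = X0 ^+ 3 + A * X0 + B.
Proof. by apply: zR_cubic; vm_compute. Qed.

Lemma e_quartic U (u := U + S) (q := u ^+ 2 - c1 * sg ^+ 2) (l := b1 * sg - 2 * r1 * u) :
  r2 ^+ 2 * (U ^+ 4 - 6 * X0 * U ^+ 2 - 8 * Y0 * U - 3 * X0 ^+ 2 - 4 * A) =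
  r2 ^+ 2 * q ^+ 2 + b2 * sg * l * q + c2 * sg ^+ 2 * l ^+ 2.
Proof. by apply: zR_quartic; vm_compute. Qed.

Lemma e_W_sqr x y : y ^+ 2 = x ^+ 3 + A * x + B -> x - X0 != 0 ->
  let U := e_U x y in
  (2 * x + X0 - U ^+ 2) ^+ 2 = U ^+ 4 - 6 * X0 * U ^+ 2 - 8 * Y0 * U - 3 * X0 ^+ 2 - 4 * A.
Proof. by move=> h n0; apply: chord_discriminant n0 h e_basepoint. Qed.

Lemma e_V2_sqr x y : y ^+ 2 = x ^+ 3 + A * x + B -> x - X0 != 0 -> sg != 0 ->
  e_u1 x y ^+ 2 - c1 != 0 ->
  e_V2 x y ^+ 2 = r2 ^+ 2 + b2 * e_z x y + c2 * e_z x y ^+ 2.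
Proof.
move=> h n0 s0 n1; apply: (@quartic_to_conic _ _ _ _ _ _ _ _ _ _ (e_U x y + S) s0 n1).
  by rewrite /e_u1 [RHS]mulrC mulfVK.
rewrite (e_W_sqr h n0); exact: e_quartic.
Qed.

Lemma e_shift1 z : zR F 11 != 0 -> zR F 11 ^+ 2 * peval quad1 ((zR F 75 + z) / zR F 11) =
  r1 ^+ 2 + b1 * z + c1 * z ^+ 2.
Proof. by move=> n11; apply: zR_shift => //; vm_compute. Qed.

Lemma e_shift2 z : zR F 11 != 0 -> zR F 11 ^+ 2 * peval quad2 ((zR F 75 + z) / zR F 11) =
  r2 ^+ 2 + b2 * z + c2 * z ^+ 2.
Proof. by move=> n11; apply: zR_shift => //; vm_compute. Qed.
End GenusOneCurve.

(** * Behaviour near the origin *)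

Section NearInfinity.
Variables (K k : fieldType) (v : place K k) (E : ellcurve K) (E' : ellcurve k).
Hypotheses (ha : v (ec_a E) = Some (ec_a E')) (hb : v (ec_b E) = Some (ec_b E')).
Variables (x y : K).
Hypotheses (on_xy : on_curve E (Some (x, y))) (hx : v x = None).

(** Since x0 and y0 are finite, U is equivalent to y / x, whose square is equivalent to x. *)
Lemma chord_slope_inf x0 y0 c0 d0 (U := (y + y0) / (x - x0)) :
  v x0 = Some c0 -> v y0 = Some d0 -> v (U ^+ 2 / x) = Some 1 /\ v U = None.
Proof.
move=> hx0 hy0; have hy := curve_inf_y ha hb on_xy hx.
have [xn0 yn0] := (residue_inf_neq0 hx, residue_inf_neq0 hy).
have n0 : x - x0 != 0 by apply: residue_inf_neq0; apply: residue_infD hx (residueN hx0).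
have n1 := residueD (residue1 v) (residueM hy0 (residue_inf hy)).
have n2 := residueB (residue1 v) (residueM hx0 (residue_inf hx)).
rewrite mulr0 addr0 in n1; rewrite mulr0 subr0 in n2.
have e1 : v (U ^+ 2 / x) = Some 1.
  have -> : U ^+ 2 / x = y ^+ 2 / x ^+ 3 * ((1 + y0 * y^-1) / (1 - x0 * x^-1)) ^+ 2.
    by rewrite /U; field; rewrite xn0 yn0 n0.
  have := residueM (curve_inf_ratio ha hb on_xy hx)
    (residueX 2 (residue_div n1 n2 (oner_neq0 _))).
  by rewrite divr1 expr1n mulr1.
split=> //; have U0 : U != 0.
  by have := residue_neq0 e1 (oner_neq0 _); apply: contraNneq => ->; rewrite expr0n mul0r.
apply/residue_infP; split=> //; apply: residue_sqr0.
have -> : U^-1 ^+ 2 = (U ^+ 2 / x)^-1 * x^-1 by field; rewrite xn0 U0.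
by rewrite (residueM (residueV e1 (oner_neq0 _)) (residue_inf hx)) mulr0.
Qed.

Lemma affine_inf U S sg c s : v U = None -> v S = Some c -> v sg = Some s -> s != 0 ->
  v ((U + S) / sg) = None /\ v (U / ((U + S) / sg)) = Some s.
Proof.
move=> hU hS hs s0; have U0 := residue_inf_neq0 hU; have sg0 := residue_neq0 hs s0.
have hd := residueD (residue1 v) (residueM hS (residue_inf hU)).
rewrite mulr0 addr0 in hd; have d0 := residue_neq0 hd (oner_neq0 _).
have US : U + S != 0 by rewrite (_ : U + S = U * (1 + S / U)) ?mulf_neq0 //; field.
have e1 : v (U / ((U + S) / sg)) = Some s.
  have -> : U / ((U + S) / sg) = sg / (1 + S / U) by field; rewrite sg0 U0 US.
  by rewrite (residue_div hs hd (oner_neq0 _)) divr1.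
split=> //; apply/residue_infP; split; first by rewrite mulf_neq0 ?invr_eq0.
have -> : ((U + S) / sg)^-1 = U / ((U + S) / sg) * U^-1 by field; rewrite sg0 U0 US.
by rewrite (residueM e1 (residue_inf hU)) mulr0.
Qed.

(** For u near infinity z behaves like - 2 r / u, so the point of the conic tends to (0, - r),
    opposite to the centre of projection (0, r). *)
Lemma conic_inf u r b c r' b' c' :
  v u = None -> v r = Some r' -> v b = Some b' -> v c = Some c' ->
  [/\ u ^+ 2 - c != 0, v (conic_z r b c u) = Some 0,
      v (u * conic_z r b c u) = Some (- (2 * r')) & v (conic_V r b c u) = Some (- r')].
Proof.
move=> hu hr hb' hc; have u0 := residue_inf_neq0 hu; have hi := residue_inf hu.
have hd := residueB (residue1 v) (residueM hc (residueX 2 hi)).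
rewrite expr0n mulr0 subr0 in hd; have d0 := residue_neq0 hd (oner_neq0 _).
have n0 : u ^+ 2 - c != 0.
  by rewrite (_ : _ - c = u ^+ 2 * (1 - c * u^-1 ^+ 2)) ?mulf_neq0 ?expf_neq0 //; field.
have hw : v (u * conic_z r b c u) = Some (- (2 * r')).
  have -> : u * conic_z r b c u = (b * u^-1 - 2 * r) / (1 - c * u^-1 ^+ 2).
    by rewrite /conic_z; field; rewrite u0 n0.
  have := residue_div (residueB (residueM hb' hi) (residueM (residue_nat v 2) hr)) hd (oner_neq0 _).
  by rewrite mulr0 sub0r divr1.
split=> //.
  have -> : conic_z r b c u = u * conic_z r b c u * u^-1 by rewrite mulrAC divff // mul1r.
  by rewrite (residueM hw hi) mulr0.
rewrite (residueD hr hw); congr Some; ring.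
Qed.

Hypotheses (sg0 : zR k e_sigma != 0) (n11 : zR k 11 != 0).
Hypotheses (r10 : 2 * zR k e_r1 != 0) (r20 : 2 * zR k e_r2 != 0).

(** The origin of the elliptic curve lies over the base point. There U has a pole and U ^ 2 is
    equivalent to x, so u1 has a pole, z tends to 0 and V1 to - r1. As sigma u1 is equivalent to U,
    V2 tends to r2 (2 - 1) = r2. *)
Lemma near_infinity :
  [/\ x - zR K e_X0 != 0, e_u1 x y ^+ 2 - zR K e_c1 != 0, e_z x y != 0
    & e_u2 x y ^+ 2 - zR K e_c2 != 0] /\
  [/\ v (e_t x y) = Some (zR k 75 / zR k 11),
      v (e_v1 x y) = Some (- zR k e_r1 / zR k 11)
    & v (e_v2 x y) = Some (zR k e_r2 / zR k 11)].
Proof.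
have C z := residue_zR v z.
have xn0 := residue_inf_neq0 hx.
have n0 : x - zR K e_X0 != 0.
  by apply: residue_inf_neq0; apply: residue_infD hx (residueN (C _)).
have [hr hU] := chord_slope_inf (C e_X0) (C e_Y0).
have [hu hUu] := affine_inf hU (C e_S) (C e_sigma) sg0.
rewrite -/(e_U x y) in hr hU hu hUu; rewrite -/(e_u1 x y) in hu hUu.
have [n1 hz hw hV] := conic_inf hu (C e_r1) (C e_b1) (C e_c1).
have hz' : e_z x y != 0.
  rewrite /e_z; have : e_u1 x y * conic_z (zR K e_r1) (zR K e_b1) (zR K e_c1) (e_u1 x y) != 0.
    by apply: residue_neq0 hw _; rewrite oppr_eq0.
  by apply: contraNneq => ->; rewrite mulr0.
have [U0 u0] := (residue_inf_neq0 hU, residue_inf_neq0 hu).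
have sK := residue_neq0 (C e_sigma) sg0.
have hV2 : v (e_V2 x y) = Some (zR k e_r2).
  have hd := residueB (residue1 v) (residueM (C e_c1) (residueX 2 (residue_inf hu))).
  rewrite expr0n mulr0 subr0 in hd; have d0 := residue_neq0 hd (oner_neq0 _).
  have hn := residueB (residue_div (residueD (residue_nat v 2) (residueM (C e_X0) (residue_inf hx))) hr
     (oner_neq0 _)) (residue1 v).
  have s2 := expf_neq0 2 sg0.
  have := residue_div (residueM (residueM (C e_r2) hn) (residueX 2 hUu))
     (residueM (residueX 2 (C e_sigma)) hd) _; rewrite !mulr1 mulr0 addr0 divr1.
  move/(_ s2); rewrite (_ : 2 - 1 = 1 :> k); last by ring.
  rewrite mulr1 mulfK // => <-; congr (v _); rewrite /e_V2.
  move: (e_u1 x y) (e_U x y) (zR K e_c1) (zR K e_sigma) (zR K e_X0) (zR K e_r2) n1 u0 U0 sK d0.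
  move=> u U c s x0 r n1 u0 U0 sK d0; field.
  by rewrite u0 n1 sK U0 xn0.
have hu2 : v (e_u2 x y) = None.
  have hS := residueD hV2 (C e_r2).
  have S0 : zR k e_r2 + zR k e_r2 != 0 by rewrite -mulr2n -mulr_natl.
  have Sn0 := residue_neq0 hS S0.
  apply/residue_infP; split; first by rewrite mulf_neq0 ?invr_eq0.
  by rewrite /e_u2 invf_div (residue_div hz hS S0) mul0r.
(* The zeros for r and b are arbitrary: the conclusion kept concerns u2 and c2 alone. *)
have [n2 _ _ _] := conic_inf hu2 (C 0%ZZ) (C 0%ZZ) (C e_c2).
split=> //; split.
- by rewrite /e_t (residue_div (residueD (C 75%ZZ) hz) (C 11%ZZ) n11) addr0.
- by rewrite /e_v1 (residue_div hV (C 11%ZZ) n11).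
- by rewrite /e_v2 (residue_div hV2 (C 11%ZZ) n11).
Qed.
End NearInfinity.

(* At 2 the abscissa of 2 P has one more factor 4 in the denominator than     *)
(* that of P, provided P is close enough to the origin.                       *)
Section Doubling.
Variables (E : ellcurve rat) (a' b' : int).
Hypotheses (ea : ec_a E = 16 * a'%:~R) (eb : ec_b E = 64 * b'%:~R).
Local Notation v := (padic (isT : prime 2)).

Lemma doubling2 (P : ec_point E) x y : val P = Some (x, y) -> v (x / 4) = None ->
  exists x2 y2, [/\ val (P + P) = Some (x2, y2), v (x2 / 4) = None & v (x / x2) = Some 0].
Proof.
move=> eP hx; have /eqP on_P : on_curve E (Some (x, y)) by rewrite -eP; apply: (valP P).
have x0 : x != 0 by have := residue_inf_neq0 hx; apply: contraNneq => ->; rewrite mul0r.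
pose z := 4 / x; have hz : v z = Some 0 by rewrite /z -invf_div; apply: residue_inf.
have hA := residueM (residue_int v a') (residueX 2 hz).
have hB := residueM (residue_int v b') (residueX 3 hz).
rewrite expr0n mulr0 in hA; rewrite expr0n mulr0 in hB.
have hN := residueD (residueD (residue1 v) hA) hB; rewrite !addr0 in hN.
have hD := residueB (residueX 2 (residueB (residue1 v) hA)) (residueM (residue_nat v 8) hB).
rewrite mulr0 !subr0 expr1n in hD.
have o := oner_neq0 'F_2; have [N0 D0] := (residue_neq0 hN o, residue_neq0 hD o).
set N := _ + _ in hN N0; set D := _ - _ in hD D0.
have y2E : y ^+ 2 = x ^+ 3 * N.
  by rewrite on_P ea eb /N /z; field; rewrite x0.
have y0 : y != 0.
  by have := mulf_neq0 (expf_neq0 3 x0) N0; rewrite -y2E expf_eq0.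
have yy : y != - y by rewrite -addr_eq0 -mulr2n -mulr_natl mulf_neq0 ?pnatr_eq0.
pose l := (3 * x ^+ 2 + ec_a E) / (2 * y); pose x2 := l ^+ 2 - x - x.
have e2 : val (P + P) = Some (x2, l * (x - x2) - y).
  by rewrite -[val _]/(add_raw E (val P) (val P)) eP /= eqxx (negPf yy).
have n4 : 4 != 0 :> rat by rewrite pnatr_eq0.
have eD : (3 * x ^+ 2 + ec_a E) ^+ 2 - 8 * x * (x ^+ 3 * N) = D * x ^+ 4.
  by rewrite ea /N /D /z; field; rewrite x0.
have ex2 : x2 = x * D / (4 * N).
  apply: (mulIf (mulf_neq0 n4 (expf_neq0 2 y0))).
  have -> : x2 * (4 * y ^+ 2) = (3 * x ^+ 2 + ec_a E) ^+ 2 - 8 * x * y ^+ 2.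
    by rewrite /x2 /l; field.
  by rewrite y2E eD; field.
have r : v (x / x2) = Some 0.
  have -> : x / x2 = 4 * (N / D) by rewrite ex2; field; rewrite x0 N0 D0.
  rewrite (residueM (residue_nat v 4) (residue_div hN hD o)).
  by congr Some; apply/eqP.
have x20 : x2 != 0 by rewrite ex2 !mulf_neq0 ?invr_eq0 ?mulf_neq0.
exists x2, (l * (x - x2) - y); split; [exact: e2 | | exact: r].
apply/residue_infP; split; first exact: mulf_neq0.
have -> : (x2 / 4)^-1 = x / x2 * z by rewrite invf_div /z [RHS]mulrC mulrA mulfVK.
by rewrite (residueM r hz) mulr0.
Qed.
End Doubling.

(** * Points of infinite order *)

Section Torsion.
Variable A : zmodType.

(* If c P = 0 with c = 2^k d, d odd, then 2^(k + phi(d)) P = 2^k P. *)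
Lemma non_torsion_of_doublings (P : A) :
  injective (fun n => P *+ 2 ^ n) -> forall c : int, P *~ c = 0 -> c = 0.
Proof.
move=> inj c h; apply/eqP; rewrite -absz_eq0; apply/negPn/negP => c0.
have hn : P *+ `|c|%N = 0.
  case: c h {c0} => n; first by [].
  by rewrite NegzE mulrNz abszN => /eqP; rewrite oppr_eq0 => /eqP.
have c_gt0 : (0 < `|c|)%N by rewrite lt0n.
set m := `|c|%N in c0 hn c_gt0.
have [d co em] := pfactor_coprime (isT : prime 2) c_gt0.
set k := logn 2 m in em.
have : P *+ 2 ^ (k + totient d) = P *+ 2 ^ k.
  have /eqP := Euler_exp_totient co; rewrite eqn_mod_dvd ?expn_gt0 // => /dvdnP[q e].
  have e2 : (2 ^ totient d = q * d + 1)%N by rewrite -e subnK // expn_gt0.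
  have e3 : (2 ^ k * (q * d) = m * q)%N by rewrite em mulnC -mulnA mulnC.
  by rewrite expnD e2 mulnDr muln1 mulrnDr e3 mulrnA hn mul0rn add0r.
move/inj/eqP; rewrite -[X in _ == X]addn0 eqn_add2l => /eqP t0.
have d_gt0 : (0 < d)%N by case: (d) co.
by have := totient_gt0 d; rewrite t0 d_gt0.
Qed.
End Torsion.

Section ReductionKernel.
Variables (k : finFieldType) (K : fieldType) (v : place K k) (E : ellcurve K) (E' : ellcurve k).
Hypotheses (ha : v (ec_a E) = Some (ec_a E')) (hb : v (ec_b E) = Some (ec_b E')).
Local Notation rd := (reduce ha hb).

Lemma reduce0 : rd 0 = 0.
Proof. exact: val_inj. Qed.

Lemma reduceMn P n : rd (P *+ n) = rd P *+ n.
Proof. by elim: n => [|n IH]; rewrite ?mulr0n ?reduce0 // !mulrS reduceD IH. Qed.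

(** The reduced curve has finitely many points, so two distinct multiples of P have the same
    reduction; their difference is in the kernel. *)
Lemma reduction_kernel_multiple (P : ec_point E) :
  exists2 n, (0 < n)%N & red_raw v (val (P *+ n)) = None.
Proof.
pose T : finType := option (k * k).
pose f (i : 'I_(#|T|).+1) : T := val (rd P *+ i).
have /injectivePn[i [j nij eij]] : ~~ injectiveb f.
  apply/negP => /injectiveP inj; have := leq_card f inj.
  by rewrite card_ord ltnn.
wlog lt_ij : i j nij eij / (i < j)%N => [hw|].
  case: (ltngtP i j) => [lt|lt|e]; [exact: hw nij eij lt | | ].
    by apply: (hw j i); rewrite 1?eq_sym.
  by case/eqP: nij; apply: val_inj.
exists (j - i)%N; first by rewrite subn_gt0.
have -> : red_raw v (val (P *+ (j - i))) = val (rd (P *+ (j - i))) by [].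
rewrite reduceMn mulrnBr ?(ltnW lt_ij) //.
have -> : rd P *+ j = rd P *+ i by apply: val_inj.
by rewrite subrr.
Qed.
End ReductionKernel.

Definition char_primes : seq nat := 47%N :: unzip1 descent_chars.

Lemma zR_rat_eq0 z : (zR rat z == 0) = Z.eqb z 0.
Proof.
rewrite zRE intr_eq0; apply/eqP/idP => [e|/Zeqb_true -> //].
by apply/Z.eqb_eq; apply: (can_inj int_of_ZK).
Qed.

Lemma zR_disc (F : fieldType) (a b : Z) :
  zR F (- 16 * (4 * (a * a * a) + 27 * (b * b)))%ZZ =
  - 16 * (4 * zR F a ^+ 3 + 27 * zR F b ^+ 2).
Proof.
rewrite !zRM zRD !zRM [zR F (-16)]zRE [zR F 4]zRE [zR F 27]zRE.
by rewrite !exprS !expr0 !mulr1 !mulrA.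
Qed.

Fact E0_disc : - 16 * (4 * zR rat e_A ^+ 3 + 27 * zR rat e_B ^+ 2) != 0.
Proof. by rewrite -zR_disc zR_rat_eq0; vm_compute. Qed.

Definition E0 : ellcurve rat := EllCurve E0_disc.

Fact A0_on_curve : on_curve E0 (Some (zR rat e_X0, zR rat e_Y0)).
Proof. by apply/eqP; apply: e_basepoint. Qed.

Definition A0 : ec_point E0 := EcPoint A0_on_curve.

Local Notation v2 := (padic (isT : prime 2)).

Lemma A0_doubling (P : ec_point E0) x y : val P = Some (x, y) -> v2 (x / 4) = None ->
  exists x2 y2, [/\ val (P + P) = Some (x2, y2), v2 (x2 / 4) = None & v2 (x / x2) = Some 0].
Proof.
have multiple c q : (c = q * (c / q))%ZZ -> exists n : int, zR rat c = zR rat q * n%:~R.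
  by move/(congr1 (zR rat)); rewrite zRM => ->; exists (int_of_Z (c / q)); rewrite [zR _ (c / q)]zRE.
have [a' ea] : exists n : int, ec_a E0 = 16 * n%:~R.
  by have := @multiple e_A 16; rewrite [zR _ 16]zRE; apply; vm_compute.
have [b' eb] : exists n : int, ec_b E0 = 64 * n%:~R.
  by have := @multiple e_B 64; rewrite [zR _ 64]zRE; apply; vm_compute.
exact: (doubling2 ea eb).
Qed.

Lemma mulr_pow2S (A : zmodType) (P : A) n : P *+ 2 ^ n.+1 = P *+ 2 ^ n + P *+ 2 ^ n.
Proof. by rewrite expnS mul2n -addnn mulrnDr. Qed.

Lemma A0_doublings n : exists x y, val (A0 *+ 2 ^ n) = Some (x, y) /\ v2 (x / 4) = None.
Proof.
elim: n => [|n [x [y [e h]]]]; last first.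
  by rewrite mulr_pow2S; have [x2 [y2 [e2 h2 _]]] := A0_doubling e h; exists x2, y2.
exists (zR rat e_X0), (zR rat e_Y0); split; first by rewrite expn0 mulr1n.
(* If the quotient by 4 were 2-integral, [e_X0] would be even; it is odd. *)
case e: (v2 _) => [c|] //; have := residueM (residue_nat v2 4) e.
have four0 : 4 = 0 :> 'F_2 by apply/eqP.
rewrite mulrC mulfVK ?pnatr_eq0 // residue_zR four0 mul0r => -[/eqP].
by rewrite (zR_Fp_eq0 (isT : prime 2)).
Qed.

Lemma A0_doublings_ratio n k x y : val (A0 *+ 2 ^ n) = Some (x, y) ->
  exists x2 y2, val (A0 *+ 2 ^ (n + k.+1)) = Some (x2, y2) /\ v2 (x / x2) = Some 0.
Proof.
move=> e; elim: k => [|k [x1 [y1 [e1 h1]]]].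
  have [x' [y' [e' h']]] := A0_doublings n; move: e'; rewrite e => -[ex ey].
  rewrite -ex in h'; have [x2 [y2 [e2 _ h2]]] := A0_doubling e h'.
  by exists x2, y2; rewrite addn1 mulr_pow2S.
have [x' [y' [e' h']]] := A0_doublings (n + k.+1); move: e'; rewrite e1 => -[ex ey].
rewrite -ex in h'; have [x2 [y2 [e2 _ h2]]] := A0_doubling e1 h'.
exists x2, y2; rewrite addnS mulr_pow2S; split=> //.
have x10 : x1 != 0 by have := residue_inf_neq0 h'; apply: contraNneq => ->; rewrite mul0r.
have -> : x / x2 = x / x1 * (x1 / x2) by rewrite mulrA mulfVK.
by rewrite (residueM h1 h2) mulr0.
Qed.

Lemma A0_non_torsion (c : int) : A0 *~ c = 0 -> c = 0.
Proof.
apply: non_torsion_of_doublings => n m /= e.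
wlog lt : n m e / (n < m)%N => [hw|].
  by case: (ltngtP n m) => // lt; [apply: hw | apply/esym; apply: hw].
have [x [y [en hn]]] := A0_doublings n.
have [x2 [y2 [em h]]] := A0_doublings_ratio (m - n).-1 en.
have x0 : x != 0 by have := residue_inf_neq0 hn; apply: contraNneq => ->; rewrite mul0r.
move: em; rewrite prednK ?subn_gt0 // subnKC ?(ltnW lt) // -e en => -[ex _].
by move: h; rewrite -ex divff // residue1.
Qed.

Lemma E0_rank : rank_ge (ec_point E0) 1.
Proof.
exists (fun=> A0) => c; rewrite big_ord_recl big_ord0 addr0 => /A0_non_torsion c0 i.
by rewrite (ord1 i).
Qed.

Definition E0_good p : bool := [&& good_prime p,
  ~~ mod0 p (- 16 * (4 * (e_A * e_A * e_A) + 27 * (e_B * e_B)))%ZZ,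
  ~~ mod0 p e_sigma, ~~ mod0 p 11, ~~ mod0 p (2 * e_r1)%ZZ & ~~ mod0 p (2 * e_r2)%ZZ].

Lemma char_primes_good : all E0_good char_primes.
Proof. by vm_compute. Qed.

Section E0ModPrime.
Variables (p : nat) (p_pr : prime p) (hp : E0_good p).

Fact E0_mod_disc : - 16 * (4 * zR 'F_p e_A ^+ 3 + 27 * zR 'F_p e_B ^+ 2) != 0.
Proof. by rewrite -zR_disc (zR_Fp_eq0 p_pr); case/and3P: hp. Qed.

Definition E0_mod : ellcurve 'F_p := EllCurve E0_mod_disc.

Lemma E0_mod_a : padic p_pr (ec_a E0) = Some (ec_a E0_mod).
Proof. exact: residue_zR. Qed.
Lemma E0_mod_b : padic p_pr (ec_b E0) = Some (ec_b E0_mod).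
Proof. exact: residue_zR. Qed.

Lemma E0_near x y : on_curve E0 (Some (x, y)) -> padic p_pr x = None ->
  [/\ x - zR rat e_X0 != 0, e_u1 x y ^+ 2 - zR rat e_c1 != 0, e_z x y != 0
    & e_u2 x y ^+ 2 - zR rat e_c2 != 0] /\
  near_base p (e_t x y) (e_v1 x y) (e_v2 x y).
Proof.
move=> on_xy hx; case/and3P: hp => _ _ /and4P[]; rewrite /mod0 -!(zR_Fp_eq0 p_pr).
rewrite !zRM [zR _ 2]zRE => sg0 n11 r10 r20.
have [h1 [h2 h3 h4]] := near_infinity E0_mod_a E0_mod_b on_xy hx sg0 n11 r10 r20.
split=> //; split; [exact: h2 | by rewrite -zRN in h3; apply: h3 |].
apply: (etrans h4); congr Some; have -> : e_r2 = (11 * base_v2)%ZZ by [].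
by rewrite zRM mulrC mulKf.
Qed.
End E0ModPrime.

Lemma seq_kernel_multiple (s : seq nat) : all E0_good s ->
  exists2 N, (0 < N)%N & forall p (p_pr : prime p), p \in s ->
    red_raw (padic p_pr) (val (A0 *+ N)) = None.
Proof.
elim: s => [|q s IH] /=; first by exists 1%N.
case/andP=> hq hs; have [N N0 hN] := IH hs; have q_pr := good_prime_prime (andP hq).1.
have [M M0 hM] := reduction_kernel_multiple (E0_mod_a q_pr hq) (E0_mod_b q_pr hq) A0.
exists (M * N)%N => [|p p_pr]; first by rewrite muln_gt0 M0.
have K r (r_pr : prime r) (hr : E0_good r) (P : ec_point E0) n :
    red_raw (padic r_pr) (val P) = None -> red_raw (padic r_pr) (val (P *+ n)) = None.
  move=> h; rewrite -[LHS]/(val (reduce (E0_mod_a r_pr hr) (E0_mod_b r_pr hr) (P *+ n))).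
  rewrite reduceMn; have -> : reduce (E0_mod_a r_pr hr) (E0_mod_b r_pr hr) P = 0.
    exact: val_inj.
  by rewrite mul0rn.
rewrite inE; case/orP=> [/eqP e|ps].
  by subst q; rewrite mulrnA; apply: K => //; rewrite (bool_irrelevance p_pr q_pr).
by rewrite mulnC mulrnA; apply: (K p) => //; [apply: (allP hs) | apply: hN].
Qed.

(* The multiples of a suitable multiple of A0 reduce to the origin of E0      *)
(* modulo all the primes involved.                                            *)
Lemma E0_sequence : exists xs ys : nat -> rat,
  [/\ injective xs, forall n, on_curve E0 (Some (xs n, ys n))
    & forall n p (p_pr : prime p), p \in char_primes -> padic p_pr (xs n) = None].
Proof.
have [N N0 hN] := seq_kernel_multiple char_primes_good.
(* The multiples n.+1 are positive, which keeps the origin out and also makes abscissas distinct: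
   equal ones would give Q n = Q m or Q n = - Q m, and the latter would make [A0] a torsion
   point. *)
pose Q n := A0 *+ N *+ n.+1.
have Q0 n : Q n <> 0.
  rewrite /Q -mulrnA pmulrn => /A0_non_torsion/eqP.
  by rewrite eqz_nat muln_eq0 (gtn_eqF N0).
have hQ n : exists xy, val (Q n) = Some xy.
  case e: (val (Q n)) => [xy|]; first by exists xy.
  by case: (Q0 n); apply: val_inj.
pose xy n := odflt (0, 0) (val (Q n)).
have xyE n : val (Q n) = Some (xy n) by rewrite /xy; have [z ->] := hQ n.
exists (fun n => (xy n).1), (fun n => (xy n).2).
have hS n : val (Q n) = Some ((xy n).1, (xy n).2) by rewrite xyE; case: (xy n).
split=> [n m e|n|n p p_pr ps].
- have on_n : on_curve E0 (Some ((xy n).1, (xy n).2)) by rewrite -hS; apply: valP.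
  have on_m : on_curve E0 (Some ((xy m).1, (xy m).2)) by rewrite -hS; apply: valP.
  have : (xy n).2 ^+ 2 == (xy m).2 ^+ 2 by rewrite (eqP on_n) (eqP on_m) e.
  rewrite eqf_sqr => /orP[/eqP ey|/eqP ey].
    have : Q n = Q m by apply: val_inj; rewrite !hS e ey.
    rewrite /Q -!mulrnA !pmulrn => /eqP; rewrite -subr_eq0 -mulrzBr => /eqP/A0_non_torsion/eqP.
    by rewrite subr_eq0 eqz_nat eqn_mul2l (gtn_eqF N0) /= eqSS => /eqP.
  have : Q n = - Q m by apply: val_inj; rewrite hS e ey; apply/esym; rewrite -[LHS]/(opp_raw (val (Q m))) hS.
  rewrite /Q -!mulrnA => /eqP; rewrite -addr_eq0 -mulrnDr pmulrn => /eqP/A0_non_torsion/eqP.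
  by rewrite eqz_nat -mulnDr muln_eq0 (gtn_eqF N0).
- by rewrite -hS; apply: valP.
have hp : E0_good p := allP char_primes_good p ps.
have : red_raw (padic p_pr) (val (Q n)) = None.
  rewrite -[LHS]/(val (reduce (E0_mod_a p_pr hp) (E0_mod_b p_pr hp) (Q n))).
  rewrite reduceMn; have -> : reduce (E0_mod_a p_pr hp) (E0_mod_b p_pr hp) (A0 *+ N) = 0.
    by apply: val_inj; apply: hN.
  by rewrite mul0rn.
move=> h; have := red_raw_None (E0_mod_a p_pr hp) (E0_mod_b p_pr hp) (valP (Q n)) h.
by rewrite hS => -[//|[x [y [[-> _]]]]].
Qed.

(** * Pulling back the surface *)

Definition independent (A : zmodType) (n : nat) (P : 'I_n -> A) :=
  forall c : 'I_n -> int, \sum_(i < n) P i *~ c i = 0 -> forall i, c i = 0.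

Lemma independent_lift (A : zmodType) n (P : 'I_n.+1 -> A) k :
  independent P -> independent (fun i => P (lift k i)).
Proof.
move=> h c e i.
pose c' j := if unlift k j is Some j' then c j' else 0.
have := h c'; rewrite (bigD1_ord k) //= {1}/c' unlift_none mulr0z add0r => h'.
have := h' _ (lift k i); rewrite /c' liftK; apply.
by rewrite -[RHS]e; apply: eq_bigr => j _; rewrite liftK.
Qed.

Section MapPoints.
Variables (K L : fieldType) (f : {rmorphism K -> L}) (E : ellcurve K) (E' : ellcurve L).
Hypothesis ea : ec_a E' = f (ec_a E).

Definition map_raw (P : option (K * K)) : option (L * L) :=
  if P is Some (x, y) then Some (f x, f y) else None.

Lemma map_raw_add P Q : map_raw (add_raw E P Q) = add_raw E' (map_raw P) (map_raw Q).
Proof.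
case: P Q => [[x1 y1]|] [[x2 y2]|] //=; rewrite ea.
rewrite -(rmorphN f) !(inj_eq (fmorph_inj f)); case: ifP => // _ /=.
have -> : (if x1 == x2 then (3 * f x1 ^+ 2 + f (ec_a E)) / (2 * f y1)
           else (f y1 + f (- y2)) / (f x1 - f x2)) =
  f (if x1 == x2 then (3 * x1 ^+ 2 + ec_a E) / (2 * y1) else (y1 - y2) / (x1 - x2)).
  case: ifP => _; rewrite fmorph_div; last by rewrite rmorphD rmorphB.
  by rewrite rmorphD [f (3 * _)]rmorphM [f (2 * _)]rmorphM [f (_ ^+ 2)]rmorphXn !rmorph_nat.
set l := (if _ then _ else _).
have -> : f (l ^+ 2 - x1 - x2) = f l ^+ 2 - f x1 - f x2 by rewrite 2!rmorphB rmorphXn.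
have -> : f (l * (x1 - (l ^+ 2 - x1 - x2)) - y1) =
    f l * (f x1 - (f l ^+ 2 - f x1 - f x2)) - f y1.
  by rewrite rmorphB rmorphM 3!rmorphB rmorphXn.
by [].
Qed.

Variables (n : nat) (P : 'I_n -> ec_point E) (Q : 'I_n -> ec_point E').
Hypothesis PQ : forall i, val (Q i) = map_raw (val (P i)).

Lemma independent_map : independent Q -> independent P.
Proof.
move=> h c e; apply: h.
pose rel (X : ec_point E) (Y : ec_point E') := val Y = map_raw (val X).
have relD X Y X' Y' : rel X Y -> rel X' Y' -> rel (X + X') (Y + Y').
  by rewrite /rel => hX hX'; rewrite -[LHS]/(add_raw E' (val Y) (val Y')) hX hX' -map_raw_add.
have relN X Y : rel X Y -> rel (- X) (- Y).
  rewrite /rel => hX; rewrite -[LHS]/(opp_raw (val Y)) -[val (- X)]/(opp_raw (val X)) hX.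
  by case: (val X) => [[x y]|] //=; rewrite rmorphN.
have relMn X Y m : rel X Y -> rel (X *+ m) (Y *+ m).
  by move=> hX; elim: m => [|m IH] //; rewrite !mulrS; apply: relD.
have relMz X Y (m : int) : rel X Y -> rel (X *~ m) (Y *~ m).
  by move=> hX; case: m => m; [apply: relMn | apply: relN; apply: relMn].
have : rel (\sum_(i < n) P i *~ c i) (\sum_(i < n) Q i *~ c i).
  elim: (index_enum _) => [|i s IH]; first by rewrite !big_nil.
  by rewrite !big_cons; apply: relD => //; apply: relMz; apply: PQ.
by rewrite e => hs; apply: val_inj.
Qed.
End MapPoints.

Section SurfacePullback.
Variables (L : fieldType) (f : {rmorphism ratfun rat -> L}).

Lemma poly_of_coefs_peval (cs : seq N) :
  (poly_of_coefs cs)%:F = peval [seq Z.of_N c | c <- rev cs] 'X%:F.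
Proof.
have nE c : zR (ratfun rat) (Z.of_N c) = (nat_of_bin c)%:R.
  by rewrite -zR_of_nat; congr (zR _ _); lia.
rewrite /poly_of_coefs; elim: (rev cs) => [|c s IH]; first by rewrite /= tofrac0.
rewrite [map _ _]/= [Poly _]/= cons_poly_def tofracD tofracM IH /= addrC mulrC; congr (_ + _).
by rewrite nE polyC_natr rmorph_nat.
Qed.

Lemma surface_a : ec_a (base_change f surface) = - 27 * peval list_S (f 'X%:F).
Proof.
rewrite -(peval_rmorph f) -[LHS]/(f (- 27 * S_poly%:F)) rmorphM rmorphN rmorph_nat.
by rewrite /S_poly poly_of_coefs_peval.
Qed.

Lemma surface_b : ec_b (base_change f surface) = 27 * peval list_T4 (f 'X%:F).
Proof.
rewrite -(peval_rmorph f) -[LHS]/(f (27 / 4 * T_poly%:F)) rmorphM fmorph_div !rmorph_nat.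
rewrite /T_poly poly_of_coefs_peval -mulrA; congr (_ * _).
have n4 : 4 != 0 :> ratfun rat.
  by rewrite -(rmorph_nat (@tofrac _ \o polyC)) fmorph_eq0 pnatr_eq0.
rewrite -[4](rmorph_nat f) -fmorphV -rmorphM; congr (f _).
apply: (mulfI n4); rewrite mulrA divff // mul1r.
have -> : 4 = zR (ratfun rat) 4 by rewrite zRE.
by rewrite -pevalZ; apply: peval_eq; vm_compute.
Qed.
End SurfacePullback.

(** * Quadratic covers *)

Definition rat_ratfun : {rmorphism rat -> ratfun rat} := @tofrac _ \o polyC.

Lemma zR_char0_eq0 (L : fieldType) (iota : {rmorphism rat -> L}) z :
  (zR L z == 0) = Z.eqb z 0.
Proof. by rewrite -(zR_rmorph iota) fmorph_eq0 zR_rat_eq0. Qed.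

Lemma algebraic_zR (L : fieldType) (iota : {rmorphism rat -> L}) z :
  algebraicOver iota (zR L z).
Proof. by rewrite -(zR_rmorph iota); apply: algebraic_id. Qed.

Lemma ratfun_sqr_sub_neq0 c : XF ^+ 2 - zR (ratfun rat) c != 0.
Proof.
rewrite -(zR_rmorph rat_ratfun) -tofracXn -tofracB tofrac_eq0 monic_neq0 //.
exact: monicXnsubC.
Qed.

Lemma zR_rat_lt0 z : Z.ltb z 0 -> zR rat z < 0.
Proof. by move=> h; rewrite zRE ltrz0; lia. Qed.

(** A rational function squaring to a polynomial is a polynomial, and the square of a polynomial is
    nonnegative at s. *)
Lemma peval_nonsquare (q : seq Z) (s : Z) : Z.ltb (zpeval q s) 0 ->
  forall z : ratfun rat, z ^+ 2 != peval q XF.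
Proof.
move=> neg; have -> : peval q XF = (peval q 'X)%:F by rewrite (peval_rmorph (@tofrac _)).
apply: poly_nonsquare_frac => d; apply/eqP => /(congr1 (horner_eval (zR rat s))).
rewrite rmorphXn (peval_rmorph (horner_eval _)) => e.
have {}e : d.[zR rat s] ^+ 2 = peval q 'X.[zR rat s] := e.
rewrite hornerX peval_zR in e; have := zR_rat_lt0 neg.
by rewrite -e ltNge sqr_ge0.
Qed.

Section QuadraticCover.
Variables (r b c : Z) (q : seq Z) (s : Z).
Hypothesis r0 : Z.eqb r 0 = false.
Hypothesis shift : forall (F : fieldType) (z : F), zR F 11 != 0 ->
  zR F 11 ^+ 2 * peval q ((zR F 75 + z) / zR F 11) =
  zR F r ^+ 2 + zR F b * z + zR F c * z ^+ 2.
Hypothesis neg : Z.ltb (zpeval q s) 0.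
Local Notation K := (ratfun rat).
Local Notation cz u := (conic_z (zR _ r) (zR _ b) (zR _ c) u).
Local Notation cV u := (conic_V (zR _ r) (zR _ b) (zR _ c) u).

(** The slope u is a root of z X ^ 2 + 2 r X - (c z + b), whose middle coefficient is nonzero. *)
Lemma conic_z_transcendental (L : fieldType) (iota : {rmorphism rat -> L}) (u : L) :
  u ^+ 2 - zR _ c != 0 -> ~ algebraicOver iota u -> ~ algebraicOver iota (cz u).
Proof.
move=> n0 tr.
apply: (transcendental_of_quadratic tr (a := cz u) (b := 2 * zR _ r)
         (c := - (zR _ c * cz u + zR _ b))).
- transitivity (cz u * (u ^+ 2 - zR _ c) - (zR _ b - 2 * zR _ r * u)); first by ring.
  by rewrite /conic_z mulfVK // subrr.
- have -> : 2 = zR L 2 by rewrite zRE.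
  by rewrite !mulf_eq0 !(zR_char0_eq0 iota) r0 /= orbT.
move=> alg_z; split=> //.
  apply: algebraic_mul; last exact: algebraic_zR.
  have -> : 2 = zR L 2 by rewrite zRE.
  exact: algebraic_zR.
exact: algebraic_opp (algebraic_add (algebraic_mul (algebraic_zR _ _) alg_z) (algebraic_zR _ _)).
Qed.

Definition cover_t (L : fieldType) (u : L) : L := (zR L 75 + cz u) / zR L 11.

Lemma cover_t_sub (L : fieldType) (u : L) : zR L 11 != 0 ->
  cz u = cover_t u * zR L 11 - zR L 75.
Proof. by move=> n11; rewrite /cover_t mulfVK // [zR L 75 + _]addrC addrK. Qed.

Lemma cover_V_sqr (L : fieldType) (u : L) : zR L 11 != 0 -> u ^+ 2 - zR L c != 0 ->
  cV u ^+ 2 = zR L 11 ^+ 2 * peval q (cover_t u).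
Proof. by move=> n11 n0; rewrite conic_V_sqr // -shift. Qed.

Lemma cover_v_sqr (L : fieldType) (u : L) : zR L 11 != 0 -> u ^+ 2 - zR L c != 0 ->
  (cV u / zR L 11) ^+ 2 = peval q (cover_t u).
Proof.
move=> n11 n0; rewrite exprMn cover_V_sqr // exprVn mulrC mulKf //.
exact: expf_neq0.
Qed.

Lemma cover_slope (L : fieldType) (u : L) : cz u != 0 -> u = (cV u - zR L r) / cz u.
Proof. by move=> z0; rewrite /conic_V [zR L r + _]addrC addrK mulfK. Qed.

Lemma cover_t_transcendental (L : fieldType) (iota : {rmorphism rat -> L}) (u : L) :
  u ^+ 2 - zR _ c != 0 -> ~ algebraicOver iota u -> ~ algebraicOver iota (cover_t u).
Proof.
move=> n0 tr alg; apply: (conic_z_transcendental n0 tr).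
rewrite cover_t_sub ?(zR_char0_eq0 iota) //.
exact: algebraic_sub (algebraic_mul alg (algebraic_zR _ _)) (algebraic_zR _ _).
Qed.

Lemma cover_nonsquare (z : K) : z ^+ 2 != zR K 11 ^+ 2 * peval q XF.
Proof.
have n11 : zR K 11 ^+ 2 != 0 by rewrite expf_neq0 ?(zR_char0_eq0 rat_ratfun).
have := peval_nonsquare neg (z / zR K 11); apply: contraNneq => e.
by rewrite exprMn e exprVn mulrC mulKf.
Qed.

(** The conic has a rational point, so its function field is Q(u). It is generated over Q(t) by V, a
    square root of 121 q(t), because the slope u is recovered as (V - r) / z. *)
Lemma quadratic_cover : exists phi : {rmorphism K -> K},
  phi XF = cover_t XF /\ ext_degree phi 2.
Proof.
have n11 : zR K 11 != 0 by rewrite (zR_char0_eq0 rat_ratfun).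
have n0 := ratfun_sqr_sub_neq0 c.
have trX : ~ algebraicOver rat_ratfun XF.
  exact: (@ratfun_var_transcendental _ (idfun : {rmorphism K -> K}) rat_ratfun).
have [phi hphi] := ratfun_lift (cover_t_transcendental n0 trX).
have z0 : cz XF != 0.
  apply/eqP => e; apply: (conic_z_transcendental n0 trX); rewrite e.
  exact: algebraic0.
exists phi; split; first exact: hphi.
apply: (@ext_degree2 _ _ phi (zR K 11 ^+ 2 * peval q XF) (cV XF) _ cover_nonsquare).
  by rewrite (cover_V_sqr n11 n0) rmorphM rmorphXn zR_rmorph peval_rmorph hphi.
move=> S hS Sf Sw; apply: (subfield_ratfun hS (f := idfun)).
rewrite (cover_slope z0); case: (hS) => _ sB sV; apply: (sV).
  by apply: (sB); [exact: Sw | rewrite -(zR_rmorph phi); exact: Sf].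
rewrite (cover_t_sub _ n11) -hphi; apply: (sB).
  by apply: (subfield_mul hS); [exact: Sf | rewrite -(zR_rmorph phi); exact: Sf].
by rewrite -(zR_rmorph phi); exact: Sf.
Qed.
End QuadraticCover.

(** * The biquadratic cover *)

Lemma zR_neg_sqr (F : fieldType) z : zR F (- z) ^+ 2 = zR F z ^+ 2.
Proof. by rewrite zRN sqrrN. Qed.

Lemma e_shift2N (F : fieldType) (z : F) : zR F 11 != 0 ->
  zR F 11 ^+ 2 * peval quad2 ((zR F 75 + z) / zR F 11) =
  zR F (- e_r2) ^+ 2 + zR F e_b2 * z + zR F e_c2 * z ^+ 2.
Proof. by move=> n11; rewrite zR_neg_sqr; apply: e_shift2. Qed.

(* The quartic e_V2^2 (u1^2 - c1)^2 in u1. *)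
Definition e_delta_q : seq Z := [:: - e_c1; 0; 1]%ZZ.
Definition e_delta_l : seq Z := [:: e_b1; - (2 * e_r1)]%ZZ.
Definition e_delta : seq Z :=
  zadd (zscale (e_r2 * e_r2) (zmul e_delta_q e_delta_q))
    (zadd (zscale e_b2 (zmul e_delta_l e_delta_q))
      (zscale e_c2 (zmul e_delta_l e_delta_l))).

Lemma e_delta_peval (F : fieldType) (u : F) : u ^+ 2 - zR F e_c1 != 0 ->
  let z := conic_z (zR F e_r1) (zR F e_b1) (zR F e_c1) u in
  (u ^+ 2 - zR F e_c1) ^+ 2 * (zR F e_r2 ^+ 2 + zR F e_b2 * z + zR F e_c2 * z ^+ 2) =
  peval e_delta u.
Proof.
move=> n0 z; rewrite /e_delta !(pevalD, pevalZ, pevalM) /e_delta_q /e_delta_l !peval_cons [peval [::] u]/=.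
rewrite !zRN !zRM zR0 zR1 [zR F 2]zRE /z /conic_z; move: (zR F e_r1) (zR F e_b1) n0 => r b; move: (zR F e_c1) => c n0.
by field.
Qed.

Section CurveSquares.
Variables (F : fieldType) (x y : F).
Hypotheses (n11 : zR F 11 != 0) (n1 : e_u1 x y ^+ 2 - zR F e_c1 != 0).

Lemma e_v1_sqr : e_v1 x y ^+ 2 = peval quad1 (e_t x y).
Proof.
have n := expf_neq0 2 n11; apply: (mulfI n).
rewrite (e_shift1 _ n11) -(conic_V_sqr _ _ n1) /e_v1 exprMn exprVn.
by rewrite mulrC (mulfVK n).
Qed.

Hypotheses (on_xy : y ^+ 2 = x ^+ 3 + zR F e_A * x + zR F e_B).
Hypotheses (n0 : x - zR F e_X0 != 0) (s0 : zR F e_sigma != 0).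

Lemma e_v2_sqr : e_v2 x y ^+ 2 = peval quad2 (e_t x y).
Proof.
have n := expf_neq0 2 n11; apply: (mulfI n).
rewrite (e_shift2 _ n11) -(e_V2_sqr on_xy n0 s0 n1) /e_v2 exprMn exprVn.
by rewrite mulrC (mulfVK n).
Qed.
End CurveSquares.

Lemma conic_z_rmorph (K L : fieldType) (f : {rmorphism K -> L}) r b c u :
  f (conic_z r b c u) = conic_z (f r) (f b) (f c) (f u).
Proof.
rewrite /conic_z fmorph_div rmorphB rmorphB [f (u ^+ 2)]rmorphXn.
by rewrite [f (2 * _ * _)]rmorphM [f (2 * _)]rmorphM rmorph_nat.
Qed.

Lemma conic_V_rmorph (K L : fieldType) (f : {rmorphism K -> L}) r b c u :
  f (conic_V r b c u) = conic_V (f r) (f b) (f c) (f u).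
Proof. by rewrite /conic_V rmorphD rmorphM conic_z_rmorph. Qed.

Lemma cover_t_rmorph (K L : fieldType) (f : {rmorphism K -> L}) r b c u :
  f (cover_t r b c u) = cover_t r b c (f u).
Proof. by rewrite /cover_t fmorph_div rmorphD conic_z_rmorph !zR_rmorph. Qed.

Section GenericPoint.
Variables (L : fieldType) (iota : {rmorphism rat -> L}) (x y : L).
Hypothesis on_xy : y ^+ 2 = x ^+ 3 + zR L e_A * x + zR L e_B.
Hypothesis tr_x : ~ algebraicOver iota x.
Local Notation alg := (algebraicOver iota).
Local Notation Z0 := (zR_char0_eq0 iota).
Local Notation u1 := (e_u1 x y).
Local Notation u2 := (e_u2 x y).

Lemma alg_zR z : alg (zR L z). Proof. exact: algebraic_zR. Qed.

Lemma e_n11 : zR L 11 != 0. Proof. by rewrite Z0. Qed.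
Lemma e_sigma_neq0 : zR L e_sigma != 0. Proof. by rewrite Z0. Qed.
Lemma e_r2_neq0 : zR L e_r2 != 0. Proof. by rewrite Z0. Qed.

Lemma e_xX0 : x - zR L e_X0 != 0.
Proof.
rewrite subr_eq0; apply/eqP => e; apply: tr_x; rewrite e; exact: alg_zR.
Qed.

Lemma e_U_u1 : e_U x y = zR L e_sigma * u1 - zR L e_S.
Proof. by rewrite /e_u1 mulrC (mulfVK e_sigma_neq0) addrK. Qed.

Lemma e_u1_transcendental : ~ alg u1.
Proof.
apply: (transcendental_of_quadratic tr_x (a := 1) (b := zR L e_X0 - e_U x y ^+ 2)
  (c := zR L e_X0 ^+ 2 + zR L e_A + e_U x y ^+ 2 * zR L e_X0 + 2 * e_U x y * zR L e_Y0)).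
- by rewrite mul1r; apply: (chord_quadratic e_xX0 on_xy (e_basepoint L)).
- by rewrite oner_neq0.
move=> alg_u.
have alg_U : alg (e_U x y).
  rewrite e_U_u1; apply: algebraic_sub (alg_zR _).
  exact: algebraic_mul (alg_zR _) alg_u.
have alg2 a : alg a -> alg (a ^+ 2) by move=> h; rewrite expr2; apply: algebraic_mul.
split; first exact: algebraic1.
  exact: algebraic_sub (alg_zR _) (alg2 _ alg_U).
apply: algebraic_add; last first.
  apply: algebraic_mul (alg_zR _); apply: algebraic_mul alg_U.
  have -> : 2 = zR L 2 by rewrite zRE.
  exact: alg_zR.
apply: algebraic_add; last exact: algebraic_mul (alg2 _ alg_U) (alg_zR _).
exact: algebraic_add (alg2 _ (alg_zR _)) (alg_zR _).
Qed.

Lemma transcendental_sqr_sub_neq0 (u : L) z : ~ alg u -> u ^+ 2 - zR L z != 0.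
Proof.
move=> tr; apply/eqP => e.
apply: (transcendental_of_quadratic tr (w := zR L z) (a := 1) (b := 0) (c := - zR L z)) (alg_zR z).
- by rewrite -[RHS]e; ring.
- by rewrite oner_neq0.
by move=> h; split; [exact: algebraic1 | exact: algebraic0 | exact: algebraic_opp].
Qed.

Definition e_n1 := transcendental_sqr_sub_neq0 e_c1 e_u1_transcendental.

Lemma e_z_transcendental : ~ alg (e_z x y).
Proof. exact: (@conic_z_transcendental e_r1 e_b1 e_c1 erefl _ _ _ e_n1 e_u1_transcendental). Qed.

Lemma e_z_neq0 : e_z x y != 0.
Proof. by apply/eqP => e; apply: e_z_transcendental; rewrite e; apply: algebraic0. Qed.

Lemma e_u2_def : e_u2 x y = (e_V2 x y - zR L (- e_r2)) / e_z x y.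
Proof. by rewrite zRN opprK. Qed.

Lemma e_V2_conic_sqr : e_V2 x y ^+ 2 =
  zR L (- e_r2) ^+ 2 + zR L e_b2 * e_z x y + zR L e_c2 * e_z x y ^+ 2.
Proof. by rewrite zR_neg_sqr; apply: (e_V2_sqr on_xy e_xX0 e_sigma_neq0 e_n1). Qed.

Lemma e_V2_u2 : e_V2 x y = zR L (- e_r2) + u2 * e_z x y.
Proof. by rewrite e_u2_def (mulfVK e_z_neq0) addrC subrK. Qed.

(** The transcendental z satisfies the linear equation (u2 ^ 2 - c2) z = b2 - 2 r u2, with r = - r2.
    If both coefficients vanished, the second quadratic would have discriminant zero, that is b2 ^ 2
    = 4 r2 ^ 2 c2, which the integers refute. *)
Lemma e_u2_transcendental : ~ alg u2.
Proof.
set r := zR L (- e_r2).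
apply: (transcendental_of_quadratic e_z_transcendental (a := 0)
   (b := u2 ^+ 2 - zR L e_c2) (c := - (zR L e_b2 - 2 * r * u2))).
- apply: (mulIf e_z_neq0); rewrite mul0r.
  have := e_V2_conic_sqr; rewrite e_V2_u2 -/r => e.
  transitivity ((r + u2 * e_z x y) ^+ 2 -
    (r ^+ 2 + zR L e_b2 * e_z x y + zR L e_c2 * e_z x y ^+ 2)); first by ring.
  by rewrite e subrr mul0r.
- apply/negPn/negP; rewrite !negb_or !negbK => /and3P[_ /eqP e1 /eqP e2].
  have : zR L (4 * (e_r2 * e_r2) * e_c2 - e_b2 * e_b2)%ZZ = 0.
    rewrite zRB !zRM [zR L 4]zRE -!mulrA.
    have -> : zR L e_b2 = 2 * r * u2 by apply/eqP; rewrite -subr_eq0 -oppr_eq0 e2.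
    have -> : zR L e_c2 = u2 ^+ 2 by apply/eqP; rewrite eq_sym -subr_eq0 e1.
    by rewrite /r zRN; ring.
  by move/eqP; rewrite Z0.
have alg2 : alg 2.
  have -> : 2 = zR L 2 by rewrite zRE.
  exact: alg_zR.
move=> h; split; first exact: algebraic0.
  by apply: algebraic_sub (alg_zR _); rewrite expr2; apply: algebraic_mul.
apply: algebraic_opp; apply: algebraic_sub (alg_zR _) _.
by apply: algebraic_mul h; apply: algebraic_mul alg2 (alg_zR _).
Qed.

Lemma e_z_u2 : conic_z (zR L (- e_r2)) (zR L e_b2) (zR L e_c2) u2 = e_z x y.
Proof.
have := conic_param e_z_neq0 e_V2_conic_sqr; rewrite /= -e_u2_def; apply.
exact: transcendental_sqr_sub_neq0 e_u2_transcendental.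
Qed.

Lemma e_t_cover1 : e_t x y = cover_t e_r1 e_b1 e_c1 u1. Proof. by []. Qed.

Lemma e_t_cover2 : e_t x y = cover_t (- e_r2) e_b2 e_c2 u2.
Proof. by rewrite /cover_t e_z_u2. Qed.

Hypothesis gen : forall S : L -> Prop, subfield_pred S -> S x -> S y -> forall w, S w.

(** The slope U is affine in u1, x is recovered from V2 and U through the formula for the square
    root of the chord discriminant, and y from the line of slope U. *)
Lemma e_generated (S : L -> Prop) : subfield_pred S -> S u1 -> S (e_V2 x y) ->
  forall w, S w.
Proof.
move=> hS Su SV; have C z : S (zR L z) by rewrite -(zR_rmorph iota); apply: subfield_rat.
have M := subfield_mul hS; have D a b := @subfield_sum _ S a b hS.
case: (hS) => _ B V.
have SU : S (e_U x y) by rewrite e_U_u1; apply: (B) => //; apply: (M).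
have Sx : S x.
  set d := zR L e_sigma ^+ 2 * (u1 ^+ 2 - zR L e_c1).
  have d0 : d != 0 by rewrite mulf_neq0 ?expf_neq0 ?e_sigma_neq0 ?e_n1.
  have two0 : zR L 2 != 0 by rewrite Z0.
  have -> : x = (e_V2 x y * d / zR L e_r2 + e_U x y ^+ 2 - zR L e_X0) / zR L 2.
    rewrite /e_V2 -/d (mulfVK d0) [zR L e_r2 * _]mulrC (mulfK e_r2_neq0).
    by apply: (mulIf two0); rewrite (mulfVK two0) [zR L 2]zRE; ring.
  by apply: (V) => //; apply: (B) => //; apply: (D); [apply: (V) => //; apply: (M) => //; rewrite /d expr2;
    apply: (M); [apply: (M) | rewrite expr2; apply: (B) => //; apply: (M)] | rewrite expr2; apply: (M)].
apply: gen => //.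
have -> : y = e_U x y * (x - zR L e_X0) - zR L e_Y0 by rewrite /e_U (mulfVK e_xX0) addrK.
by apply: (B) => //; apply: (M) => //; apply: (B).
Qed.

(** Each conic field has degree 2 over Q(t). The field of the curve has degree 2 over Q(u1),
    generated by V2, since [e_delta] is not a square. Moreover V2 = - r2 + u2 z with z a function of
    t, so the two conic fields generate it. *)
Lemma e_biquadratic : exists phi1 phi2 : {rmorphism ratfun rat -> ratfun rat},
  exists i1 i2 : {rmorphism ratfun rat -> L},
  [/\ phi1 XF = cover_t e_r1 e_b1 e_c1 XF /\ ext_degree phi1 2,
      phi2 XF = cover_t (- e_r2) e_b2 e_c2 XF /\ ext_degree phi2 2,
      i1 XF = u1 /\ i2 XF = u2,
      is_compositum phi1 phi2 i1 i2 & ext_degree (i1 \o phi1) 4].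
Proof.
(* The sample values 1 and - 2 here, and 49000 for the quartic below, are integers at which the
   polynomials are negative, as [peval_nonsquare] requires. *)
have neg1 : Z.ltb (zpeval quad1 1) 0 by vm_compute.
have neg2 : Z.ltb (zpeval quad2 (- 2)) 0 by vm_compute.
have [phi1 [h1 d1]] := @quadratic_cover e_r1 e_b1 e_c1 quad1 1 erefl (@e_shift1) neg1.
have [phi2 [h2 d2]] := @quadratic_cover (- e_r2) e_b2 e_c2 quad2 (- 2) erefl (@e_shift2N) neg2.
have [i1 hi1] := ratfun_lift e_u1_transcendental.
have [i2 hi2] := ratfun_lift e_u2_transcendental.
exists phi1, phi2, i1, i2; split=> //.
- split.
    apply: (@ratfun_rmorph_ext _ (i1 \o phi1) (i2 \o phi2)).
    by rewrite /= h1 h2 !cover_t_rmorph hi1 hi2 -e_t_cover1 -e_t_cover2.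
  move=> S hS S1 S2; apply: e_generated => //; first by rewrite -hi1; exact: S1.
  rewrite e_V2_u2; have C z : S (zR L z) by rewrite -(zR_rmorph i1); exact: S1.
  apply: (subfield_sum hS) => //; apply: (subfield_mul hS); first by rewrite -hi2; exact: S2.
  have -> : e_z x y = e_t x y * zR L 11 - zR L 75.
    exact: (cover_t_sub e_r1 e_b1 e_c1 u1 e_n11).
  case: (hS) => _ B _; apply: (B) => //; apply: (subfield_mul hS) => //.
  by rewrite e_t_cover1 -hi1 -cover_t_rmorph; exact: S1.
- apply: (@ext_degree_comp _ _ _ phi1 i1 2 2 d1).
  have negd : Z.ltb (zpeval e_delta 49000) 0 by vm_compute.
  apply: (@ext_degree2 _ _ i1 (peval e_delta XF) (e_V2 x y * (u1 ^+ 2 - zR L e_c1))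
            _ (peval_nonsquare negd)).
    rewrite (peval_rmorph i1) hi1 -(e_delta_peval e_n1) exprMn mulrC.
    by rewrite (e_V2_sqr on_xy e_xX0 e_sigma_neq0 e_n1).
  move=> S hS S1 SV; have Su : S u1 by rewrite -hi1; exact: S1.
  have C z : S (zR L z) by rewrite -(zR_rmorph i1); exact: S1.
  apply: e_generated => //.
  rewrite -[e_V2 x y](mulfK e_n1); case: (hS) => _ B V; apply: (V) => //.
  by apply: (B) => //; rewrite expr2; apply: (subfield_mul hS).
Qed.
End GenericPoint.

(** * Tracking functions along a sequence of points *)

Section Tracking.
Variables (L : fieldType) (g : germ L).

Definition tracks (l : L) (l_ : nat -> rat) := eventually (fun n => g l n = l_ n).

Lemma tracksD a b a_ b_ : tracks a a_ -> tracks b b_ -> tracks (a + b) (fun n => a_ n + b_ n).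
Proof.
move=> ha hb; apply: eventually_mono (eventually_and (eventually_and ha hb) (germD g a b)) _.
by move=> n [[<- <-] ->].
Qed.

Lemma tracksB a b a_ b_ : tracks a a_ -> tracks b b_ -> tracks (a - b) (fun n => a_ n - b_ n).
Proof.
move=> ha hb; apply: eventually_mono (eventually_and (eventually_and ha hb) (germB g a b)) _.
by move=> n [[<- <-] ->].
Qed.

Lemma tracksM a b a_ b_ : tracks a a_ -> tracks b b_ -> tracks (a * b) (fun n => a_ n * b_ n).
Proof.
move=> ha hb; apply: eventually_mono (eventually_and (eventually_and ha hb) (germM g a b)) _.
by move=> n [[<- <-] ->].
Qed.

Lemma tracks_div a b a_ b_ : tracks a a_ -> tracks b b_ -> tracks (a / b) (fun n => a_ n / b_ n).
Proof.
move=> ha hb; apply: eventually_mono (eventually_and (eventually_and ha hb) (germ_ratio g a b)) _.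
by move=> n [[<- <-] ->].
Qed.

Lemma tracksX a a_ m : tracks a a_ -> tracks (a ^+ m) (fun n => a_ n ^+ m).
Proof.
by move=> ha; apply: eventually_mono (eventually_and ha (germX g a m)) _ => n [<- ->].
Qed.

Lemma tracks_zR z : tracks (zR L z) (fun=> zR rat z).
Proof. by apply: eventually_mono (germ_int g (int_of_Z z)) _ => n; rewrite !zRE. Qed.

Lemma tracks_nat m : tracks m%:R (fun=> m%:R).
Proof. exact: germ_nat. Qed.

Lemma tracks_peval q t t_ : tracks t t_ -> tracks (peval q t) (fun n => peval q (t_ n)).
Proof.
move=> ht; elim: q => [|c q IH]; first exact: germ0.
exact: tracksD (tracks_zR c) (tracksM ht IH).
Qed.

Lemma tracks_horner (iota : {rmorphism rat -> L}) (p : {poly rat}) t t_ :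
  tracks t t_ -> tracks (map_poly iota p).[t] (fun n => p.[t_ n]).
Proof.
move=> ht; elim/poly_ind: p => [|p c IH].
  rewrite rmorph0 horner0; apply: eventually_mono (germ0 g) _ => n ->.
  by rewrite horner0.
rewrite rmorphD rmorphM /= map_polyX map_polyC hornerMXaddC.
apply: eventually_mono (tracksD (tracksM IH ht) (germ_rat g iota c)) _ => n ->.
by rewrite hornerMXaddC.
Qed.

Lemma tracks_transcendental (iota : {rmorphism rat -> L}) (p : {poly rat}) t t_ :
  ~ algebraicOver iota t -> tracks t t_ -> p != 0 -> eventually (fun n => p.[t_ n] != 0).
Proof.
move=> tr ht p0; have h0 : (map_poly iota p).[t] != 0.
  by apply/negP => h; apply: tr; exists p.
apply: eventually_mono (eventually_and (germV g h0) (tracks_horner iota p ht)) _.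
by move=> n [[+ _] e]; rewrite e.
Qed.

Variables (x y : L) (xs ys : nat -> rat).
Hypotheses (hx : tracks x xs) (hy : tracks y ys).

Lemma tracks_U : tracks (e_U x y) (fun n => e_U (xs n) (ys n)).
Proof. exact: tracks_div (tracksD hy (tracks_zR _)) (tracksB hx (tracks_zR _)). Qed.

Lemma tracks_u1 : tracks (e_u1 x y) (fun n => e_u1 (xs n) (ys n)).
Proof. exact: tracks_div (tracksD tracks_U (tracks_zR _)) (tracks_zR _). Qed.

Lemma tracks_u1_conic :
  tracks (e_u1 x y ^+ 2 - zR L e_c1) (fun n => e_u1 (xs n) (ys n) ^+ 2 - zR rat e_c1).
Proof. exact: tracksB (tracksX 2 tracks_u1) (tracks_zR _). Qed.

Lemma tracks_z : tracks (e_z x y) (fun n => e_z (xs n) (ys n)).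
Proof.
apply: tracks_div tracks_u1_conic; apply: tracksB (tracks_zR _) _.
exact: tracksM (tracksM (tracks_nat 2) (tracks_zR _)) tracks_u1.
Qed.

Lemma tracks_t : tracks (e_t x y) (fun n => e_t (xs n) (ys n)).
Proof. exact: tracks_div (tracksD (tracks_zR _) tracks_z) (tracks_zR _). Qed.

Lemma tracks_v1 : tracks (e_v1 x y) (fun n => e_v1 (xs n) (ys n)).
Proof.
apply: tracks_div (tracks_zR _).
exact: tracksD (tracks_zR _) (tracksM tracks_u1 tracks_z).
Qed.

Lemma tracks_v2 : tracks (e_v2 x y) (fun n => e_v2 (xs n) (ys n)).
Proof.
apply: tracks_div (tracks_zR _); apply: tracks_div.
  apply: tracksM (tracks_zR _) _; apply: tracksB (tracksX 2 tracks_U).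
  exact: tracksD (tracksM (tracks_nat 2) hx) (tracks_zR _).
exact: tracksM (tracksX 2 (tracks_zR _)) tracks_u1_conic.
Qed.

Lemma tracks_bp_x P t v t_ v_ : tracks t t_ -> tracks v v_ ->
  tracks (bp_x P t v) (fun n => bp_x P (t_ n) (v_ n)).
Proof.
move=> ht hv; apply: tracks_div (tracksX 2 (tracks_zR _)).
exact: tracksD (tracks_peval _ ht) (tracksM (tracks_peval _ ht) hv).
Qed.

Lemma tracks_bp_y P t v t_ v_ : tracks t t_ -> tracks v v_ ->
  tracks (bp_y P t v) (fun n => bp_y P (t_ n) (v_ n)).
Proof.
move=> ht hv; apply: tracks_div (tracksX 3 (tracks_zR _)).
exact: tracksD (tracks_peval _ ht) (tracksM (tracks_peval _ ht) hv).
Qed.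
End Tracking.

Lemma bp_m_char0_neq0 (L : fieldType) (iota : {rmorphism rat -> L}) (i : 'I_19) :
  zR L (bp_m (nth bisection1 all_points i)) != 0.
Proof. by rewrite -(zR_rmorph iota) fmorph_eq0 bp_m_rat_neq0. Qed.

Section NearDisc.
Variables (t v1 v2 : rat).
Hypothesis near : near_base 47 t v1 v2.

(** The discriminant is nonzero already modulo 47, where it is that of the fibre over the base
    point. *)
Fact near_disc :
  - 16 * (4 * (- 27 * peval list_S t) ^+ 3 + 27 * (27 * peval list_T4 t) ^+ 2) != 0.
Proof.
have /andP[hp _] := good_prime47; have [ht _ _] := near_base_zR hp near.
have C (n : nat) := residue_nat (padic (good_prime_prime hp)) n.
have hS := residueM (residueN (C 27%N)) (residue_peval list_S ht).
have hT := residueM (C 27%N) (residue_peval list_T4 ht).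
apply: (residue_neq0 _ (base_disc hp)).
apply: etrans (residueM (residueN (C 16%N)) (residueD (residueM (C 4%N) (residueX 3 hS))
  (residueM (C 27%N) (residueX 2 hT)))) _.
by rewrite !peval_zR /base_a /base_b !zRM [zR _ (-27)]zRE [zR _ 27]zRE.
Qed.
End NearDisc.

(** * Ranks *)

Lemma bp_x_rmorph (K L : fieldType) (f : {rmorphism K -> L}) P t v :
  f (bp_x P t v) = bp_x P (f t) (f v).
Proof.
by rewrite /bp_x fmorph_div rmorphD rmorphM rmorphXn !(peval_rmorph f) (zR_rmorph f).
Qed.

Lemma bp_y_rmorph (K L : fieldType) (f : {rmorphism K -> L}) P t v :
  f (bp_y P t v) = bp_y P (f t) (f v).
Proof.
by rewrite /bp_y fmorph_div rmorphD rmorphM rmorphXn !(peval_rmorph f) (zR_rmorph f).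
Qed.

Lemma section_no_root (F : fieldType) j (t v v' : F) : (j < 17)%N ->
  bp_x (nth bisection1 sections j) t v = bp_x (nth bisection1 sections j) t v' /\
  bp_y (nth bisection1 sections j) t v = bp_y (nth bisection1 sections j) t v'.
Proof.
move=> lt_j.
have : all (fun P => nilp (bp_D P) && nilp (bp_B P)) sections by vm_compute.
move/(all_nthP bisection1)/(_ j lt_j)/andP => [/nilP hD /nilP hB].
by rewrite /bp_x /bp_y hD hB [peval [::] t]/= !mul0r.
Qed.

Lemma point_coord1 (F : fieldType) (t v1 v2 : F) (i : 'I_19) : i != 1%N :> nat ->
  point_x t v1 v2 i = bp_x (nth bisection1 all_points i) t v1 /\
  point_y t v1 v2 i = bp_y (nth bisection1 all_points i) t v1.
Proof.
rewrite /point_x /point_y; case: i => [[|[|j]] hj] n1; [by split | by [] | ].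
exact: (@section_no_root _ j).
Qed.

Lemma point_coord2 (F : fieldType) (t v1 v2 : F) (i : 'I_19) : i != 0%N :> nat ->
  point_x t v1 v2 i = bp_x (nth bisection1 all_points i) t v2 /\
  point_y t v1 v2 i = bp_y (nth bisection1 all_points i) t v2.
Proof. by rewrite /point_x /point_y => /negPf ->. Qed.

Section Descend.
Variables (K L : fieldType) (f : {rmorphism K -> L}) (E : ellcurve K) (E' : ellcurve L).
Hypothesis ea : ec_a E' = f (ec_a E).
Variables (t v : K) (v1 v2 : L) (k : 'I_19).
Hypothesis on_E : forall i : 'I_18, on_curve E
  (Some (bp_x (nth bisection1 all_points (lift k i)) t v,
         bp_y (nth bisection1 all_points (lift k i)) t v)).
Variable Q : 'I_19 -> ec_point E'.
Hypothesis QE : forall i, val (Q i) = Some (point_x (f t) v1 v2 i, point_y (f t) v1 v2 i).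
Hypothesis coord : forall i : 'I_18,
  point_x (f t) v1 v2 (lift k i) = bp_x (nth bisection1 all_points (lift k i)) (f t) (f v) /\
  point_y (f t) v1 v2 (lift k i) = bp_y (nth bisection1 all_points (lift k i)) (f t) (f v).

(** Point k is the bisection over the other conic. The remaining eighteen points come from K, and a
    relation over K maps to a relation over L. *)
Lemma rank18_descend : independent Q -> rank_ge (ec_point E) 18.
Proof.
move=> /(@independent_lift _ _ _ k) ind.
exists (fun i => EcPoint (on_E i)).
apply: (independent_map ea (Q := fun i => Q (lift k i)) _ ind) => i.
rewrite QE -[val _]/(Some (bp_x (nth bisection1 all_points (lift k i)) t v,
         bp_y (nth bisection1 all_points (lift k i)) t v)) /map_raw.
by rewrite bp_x_rmorph bp_y_rmorph; have [-> ->] := coord i.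
Qed.
End Descend.

Section Assembly.
Variables (xs ys : nat -> rat).
Hypothesis xs_inj : injective xs.
Hypothesis on_E0 : forall n, on_curve E0 (Some (xs n, ys n)).
Hypothesis xs_inf : forall n p (p_pr : prime p), p \in char_primes -> padic p_pr (xs n) = None.
Local Notation t_ n := (e_t (xs n) (ys n)).
Local Notation v1_ n := (e_v1 (xs n) (ys n)).
Local Notation v2_ n := (e_v2 (xs n) (ys n)).
Local Notation L := (ec_funfield E0).
Local Notation x := (ff_x E0 : L).
Local Notation y := (ff_y E0 : L).

Definition rat_ff : {rmorphism rat -> L} := ff_base E0 \o rat_ratfun.

Lemma on_ff : y ^+ 2 = x ^+ 3 + zR L e_A * x + zR L e_B.
Proof.
by rewrite (@ff_on_curve _ E0 rat_ff (fun=> erefl)) -!(zR_rmorph rat_ff).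
Qed.

Lemma ff_x_transcendental : ~ algebraicOver rat_ff x.
Proof. exact: (@ratfun_var_transcendental _ (ff_base E0) rat_ff). Qed.

Lemma ff_xy_generate (S : L -> Prop) : subfield_pred S -> S x -> S y -> forall w, S w.
Proof.
by move=> hS Sx Sy; apply: (ff_generated hS) => //; apply: (subfield_ratfun hS).
Qed.

Definition E0_germ : germ L := ff_germ (injective_seq_generic xs_inj) on_E0.

Lemma seq_near n p : p \in char_primes -> near_base p (t_ n) (v1_ n) (v2_ n).
Proof.
move=> hp; have gp : E0_good p := allP char_primes_good p hp.
have pr := good_prime_prime (andP gp).1.
by have [] := E0_near gp (on_E0 n) (xs_inf n pr hp).
Qed.

Lemma seq_facts n : xs n - zR rat e_X0 != 0 /\ e_u1 (xs n) (ys n) ^+ 2 - zR rat e_c1 != 0.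
Proof.
have hp : 47%N \in char_primes by exact: mem_head.
have gp : E0_good 47 := allP char_primes_good 47%N hp.
have pr := good_prime_prime (andP gp).1.
have [[h1 h2 _ _] _] := E0_near gp (on_E0 n) (xs_inf n pr hp).
split; [exact: h1 | exact: h2].
Qed.

Definition fiber n : ellcurve rat :=
  EllCurve (near_disc (seq_near n (mem_head _ _))).

Lemma seq_v1_sqr n : v1_ n ^+ 2 = peval quad1 (t_ n).
Proof. by have [_ h] := seq_facts n; apply: e_v1_sqr h; rewrite zR_rat_eq0. Qed.

Lemma seq_v2_sqr n : v2_ n ^+ 2 = peval quad2 (t_ n).
Proof.
have [h0 h1] := seq_facts n; apply: (e_v2_sqr _ h1 _ h0); rewrite ?zR_rat_eq0 //.
exact: (eqP (on_E0 n)).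
Qed.

Definition fiber_point n (i : 'I_19) : ec_point (fiber n) :=
  @rat_point (t_ n) (v1_ n) (v2_ n) (fiber n) erefl erefl (seq_v1_sqr n) (seq_v2_sqr n) i.

Lemma fiber_independent n : independent (fiber_point n).
Proof.
by move=> c; apply: rat_points_independent => p; apply: seq_near.
Qed.

Section Generic.
Variable E : ellcurve L.
Hypotheses (ea : ec_a E = - 27 * peval list_S (e_t x y))
  (eb : ec_b E = 27 * peval list_T4 (e_t x y)).

Fact generic_v1 : e_v1 x y ^+ 2 = peval quad1 (e_t x y).
Proof.
exact: (e_v1_sqr (e_n11 rat_ff) (e_n1 on_ff ff_x_transcendental)).
Qed.

Fact generic_v2 : e_v2 x y ^+ 2 = peval quad2 (e_t x y).
Proof.
exact: (e_v2_sqr (e_n11 rat_ff) (e_n1 on_ff ff_x_transcendental) on_ff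
  (e_xX0 ff_x_transcendental) (e_sigma_neq0 rat_ff)).
Qed.

Definition generic_point (i : 'I_19) : ec_point E :=
  EcPoint (point_on_curve ea eb (bp_m_char0_neq0 rat_ff) i generic_v1 generic_v2).

Local Notation g := E0_germ.

Lemma E0_tracks_x : tracks g x xs.
Proof. exact: (ff_germ_x (injective_seq_generic xs_inj) on_E0). Qed.
Lemma E0_tracks_y : tracks g y ys.
Proof. exact: (ff_germ_y (injective_seq_generic xs_inj) on_E0). Qed.

Lemma generic_independent : independent generic_point.
Proof.
have [hx hy] := (E0_tracks_x, E0_tracks_y); have ht := tracks_t hx hy.
apply: (@specialize_rank _ g E fiber _ _ _ fiber_point); last exact: fiber_independent.
  rewrite ea; apply: tracksM (tracks_peval list_S ht).
  by apply: eventually_mono (germ_int g (- 27)) _ => n ->.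
move=> i; have [h1 h2] := (tracks_v1 hx hy, tracks_v2 hx hy).
have hX : tracks g (point_x (e_t x y) (e_v1 x y) (e_v2 x y) i)
    (fun n => point_x (t_ n) (v1_ n) (v2_ n) i).
  by rewrite /point_x; case: ifP => _; apply: tracks_bp_x.
have hY : tracks g (point_y (e_t x y) (e_v1 x y) (e_v2 x y) i)
    (fun n => point_y (t_ n) (v1_ n) (v2_ n) i).
  by rewrite /point_y; case: ifP => _; apply: tracks_bp_y.
apply: eventually_mono (eventually_and hX hY) _ => n [eX eY].
rewrite -[val (fiber_point n i)]/(Some (point_x (t_ n) (v1_ n) (v2_ n) i,
  point_y (t_ n) (v1_ n) (v2_ n) i)) -eX -eY.
reflexivity.
Qed.
End Generic.
End Assembly.

(** * The theorem *)

(** The ratio of a ^ 3 to b ^ 2 determines the j-invariant; an isomorphism multiplies both by u ^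
    12. *)
Lemma ec_iso_ratio (E E' : ellcurve rat) : ec_iso E E' ->
  ec_a E' ^+ 3 * ec_b E ^+ 2 = ec_a E ^+ 3 * ec_b E' ^+ 2.
Proof. by case=> u _ [-> ->]; ring. Qed.

(* Vanishes at t when the fiber at t has the j-invariant of y^2 = x^3 + a x + b. *)
Definition same_j (a b : rat) : {poly rat} :=
  (peval list_S 'X * (- 27)%:P) ^+ 3 * (b ^+ 2)%:P -
  (a ^+ 3)%:P * (peval list_T4 'X * 27%:P) ^+ 2.

Lemma horner_peval q (t : rat) : (peval q 'X).[t] = peval q t.
Proof. by apply: (etrans (peval_rmorph (horner_eval t) q 'X)); congr peval; apply: hornerX. Qed.

Lemma horner_same_j a b t : (same_j a b).[t] =
  (- 27 * peval list_S t) ^+ 3 * b ^+ 2 - a ^+ 3 * (27 * peval list_T4 t) ^+ 2.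
Proof.
by rewrite /same_j hornerD hornerN !hornerM !hornerC !horner_peval; ring.
Qed.

(** Were it zero, eliminating a and b between t = 0 and t = 1 would give S(0)^3 T(1)^2 = S(1)^3
    T(0)^2, refuted by computation, unless b = 0. In that case a = 0 because T(0) is nonzero,
    against the discriminant. *)
Lemma same_j_neq0 (E : ellcurve rat) : same_j (ec_a E) (ec_b E) != 0.
Proof.
apply/eqP => e0; have ev z : (- 27 * zR rat (zpeval list_S z)) ^+ 3 * ec_b E ^+ 2 =
    ec_a E ^+ 3 * (27 * zR rat (zpeval list_T4 z)) ^+ 2.
  apply/eqP; rewrite -subr_eq0 -!peval_zR -horner_same_j e0 horner0.
  exact: eqxx.
have alg (s0 s1 t0 t1 A B : rat) : s0 * B = A * t0 -> s1 * B = A * t1 ->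
    (s0 * t1 - s1 * t0) * B = 0.
  move=> e e'; transitivity (s0 * B * t1 - s1 * B * t0); first by ring.
  by rewrite e e'; ring.
have := alg _ _ _ _ _ _ (ev 0%ZZ) (ev 1%ZZ).
move/eqP; rewrite mulf_eq0 => /orP[|/eqP b0].
  have -> : - 27 = zR rat (- 27) by rewrite zRE.
  have -> : 27 = zR rat 27 by rewrite zRE.
  rewrite -!zRM !exprS !expr0 !mulr1 -!zRM -zRB zR_rat_eq0.
  have F (b : bool) : b = false -> b -> False by move=> ->.
  by apply: F; vm_compute.
have := ev 0%ZZ; rewrite b0 mulr0 => /esym/eqP.
rewrite mulf_eq0 !expf_eq0 /= => /orP[/eqP a0|].
  case: E {e0 ev} a0 b0 => a b h /= a0 /eqP; rewrite expf_eq0 /= => /eqP b0.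
  by move/eqP: h; case; rewrite a0 b0; ring.
rewrite mulf_eq0 zR_rat_eq0 pnatr_eq0 => /orP[//|].
by have -> : Z.eqb (zpeval list_T4 0) 0 = false by vm_compute.
Qed.
(** Greedy choice: each new index is beyond the thresholds after which no term is related to a
    previously chosen one. *)
Lemma infinite_family (T : Type) (E : nat -> T) (R : T -> T -> Prop) :
  (forall X Y, R X Y -> R Y X) ->
  (forall m, eventually (fun n => ~ R (E m) (E n))) ->
  exists sub : nat -> nat, forall m n, R (E (sub m)) (E (sub n)) -> m = n.
Proof.
move=> sym ev; pose f m := proj1_sig (constructive_indefinite_description _ (ev m)).
have hf m := proj2_sig (constructive_indefinite_description _ (ev m)).
pose sub := fix sub k := if k is k'.+1 then maxn (sub k') (f (sub k')) else 0%N.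
have lt_ok m n : (m < n)%N -> ~ R (E (sub m)) (E (sub n)).
  move=> lt; apply: hf; elim: n lt => // n IH; rewrite ltnS leq_eqVlt => /orP[/eqP <-|/IH h].
    exact: leq_maxr.
  exact: leq_trans h (leq_maxl _ _).
exists sub => m n h; case: (ltngtP m n) => // lt.
- by case: (lt_ok _ _ lt h).
- by case: (lt_ok _ _ lt (sym _ _ h)).
Qed.

Lemma ec_iso_sym (E E' : ellcurve rat) : ec_iso E E' -> ec_iso E' E.
Proof.
case=> u u0 [ea eb]; exists u^-1; first by rewrite invr_eq0.
by rewrite ea eb; split; field.
Qed.

Theorem theorem3 :
  (exists phi : {rmorphism ratfun rat -> ratfun rat},
     ext_degree phi 2 /\ rank_ge (ec_point (base_change phi surface)) 18)
  /\
  (exists (phi1 phi2 : {rmorphism ratfun rat -> ratfun rat})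
          (E0 : ellcurve rat)
          (i1 i2 : {rmorphism ratfun rat -> ec_funfield E0}),
     [/\ ext_degree phi1 2 /\ rank_ge (ec_point (base_change phi1 surface)) 18,
         ext_degree phi2 2 /\ rank_ge (ec_point (base_change phi2 surface)) 18,
         is_compositum phi1 phi2 i1 i2,
         ext_degree (i1 \o phi1) 4
       & rank_ge (ec_point E0) 1 /\
         rank_ge (ec_point (base_change (i1 \o phi1) surface)) 19])
  /\
  (exists E : nat -> ellcurve rat,
     (forall n, rank_ge (ec_point (E n)) 19) /\
     (forall m n, ec_iso (E m) (E n) -> m = n)).
Proof.
have [xs [ys [xs_inj on_E0 xs_inf]]] := E0_sequence.
have [phi1 [phi2 [i1 [i2 [[h1 d1] [h2 d2] [hi1 hi2] comp d4]]]]] :=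
  e_biquadratic on_ff ff_x_transcendental ff_xy_generate.
have [agree _] := comp.
have ht1 : i1 (phi1 XF) = e_t (ff_x E0) (ff_y E0).
  by rewrite h1 cover_t_rmorph hi1.
have ht2 : i2 (phi2 XF) = e_t (ff_x E0) (ff_y E0) by rewrite -agree.
have ea : ec_a (base_change (i1 \o phi1) surface) =
    - 27 * peval list_S (e_t (ff_x E0) (ff_y E0)).
  by rewrite -ht1; exact: (surface_a (i1 \o phi1)).
have eb : ec_b (base_change (i1 \o phi1) surface) =
    27 * peval list_T4 (e_t (ff_x E0) (ff_y E0)).
  by rewrite -ht1; exact: (surface_b (i1 \o phi1)).
have ind := @generic_independent xs ys xs_inj on_E0 xs_inf _ ea eb.
have bd := @bp_m_char0_neq0 _ rat_ratfun.
have n11 : zR (ratfun rat) 11 != 0 by rewrite (zR_char0_eq0 rat_ratfun).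
(* Index 1, the second bisection, is left out over the first conic, and index 0 over the second. *)
have k1P (i : 'I_18) : lift (inord 1 : 'I_19) i != 1%N :> nat.
  by have := neq_lift (inord 1 : 'I_19) i; rewrite -val_eqE eq_sym [val (inord 1)]inordK.
have k0P (i : 'I_18) : lift (ord0 : 'I_19) i != 0%N :> nat by [].
pose v1 : ratfun rat := conic_V (zR _ e_r1) (zR _ e_b1) (zR _ e_c1) XF / zR _ 11.
pose v2 : ratfun rat := conic_V (zR _ (- e_r2)) (zR _ e_b2) (zR _ e_c2) XF / zR _ 11.
have q1 : v1 ^+ 2 = peval quad1 (phi1 XF).
  by rewrite h1; apply: (cover_v_sqr (@e_shift1) n11 (ratfun_sqr_sub_neq0 _)).
have q2 : v2 ^+ 2 = peval quad2 (phi2 XF).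
  by rewrite h2; apply: (cover_v_sqr (@e_shift2N) n11 (ratfun_sqr_sub_neq0 _)).
have r1 : rank_ge (ec_point (base_change phi1 surface)) 18.
  apply: (@rank18_descend _ _ i1 _ _ _ (phi1 XF) v1 _ _ (inord 1)
    (fun i => point_on_curve1 (surface_a phi1) (surface_b phi1) bd (k1P i) q1) _ _ _ ind).
  - by [].
  - by move=> i; rewrite ht1.
  move=> i; rewrite ht1.
  have -> : i1 v1 = e_v1 (ff_x E0) (ff_y E0).
    by rewrite /v1 fmorph_div conic_V_rmorph !zR_rmorph hi1.
  exact: point_coord1.
have r2 : rank_ge (ec_point (base_change phi2 surface)) 18.
  apply: (@rank18_descend _ _ i2 _ _ _ (phi2 XF) v2 _ _ ord0
    (fun i => point_on_curve2 (surface_a phi2) (surface_b phi2) bd (k0P i) q2) _ _ _ ind).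
  - exact: agree.
  - by move=> i; rewrite ht2.
  move=> i; rewrite ht2.
  have -> : i2 v2 = e_v2 (ff_x E0) (ff_y E0).
    rewrite /v2 fmorph_div conic_V_rmorph !zR_rmorph hi2 /e_v2.
    by rewrite (e_V2_u2 on_ff ff_x_transcendental) /conic_V (e_z_u2 on_ff ff_x_transcendental).
  exact: point_coord2.
split; [by exists phi1 | split].
  exists phi1, phi2, E0, i1, i2; split=> //; split; first exact: E0_rank.
  exact: (ex_intro _ _ ind).
pose E n := fiber on_E0 xs_inf n.
(* A fibre isomorphic to [E m] makes [same_j] of [E m] vanish at its t. This nonzero polynomial does
   not vanish at the transcendental generic value of t, hence at only finitely many terms of the
   sequence. *)
have ev m : eventually (fun n => ~ ec_iso (E m) (E n)).
  have ht := tracks_t (E0_tracks_x xs_inj on_E0) (E0_tracks_y xs_inj on_E0).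
  have tr : ~ algebraicOver rat_ff (e_t (ff_x E0) (ff_y E0)).
    by rewrite -ht1; apply: (@ratfun_var_transcendental _ (i1 \o phi1)).
  apply: eventually_mono (tracks_transcendental tr ht (same_j_neq0 (E m))) _ => n + /ec_iso_ratio e.
  by rewrite horner_same_j [X in X - _]e subrr eqxx.
have [sub hsub] := infinite_family ec_iso_sym ev.
exists (E \o sub); split=> // n.
exact: (ex_intro _ _ (@fiber_independent xs ys on_E0 xs_inf (sub n))).
Qed.
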